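(* Let $\mathscr J$ be a Jacobi matrix with parameters $b_n>0$, $a_n\in\mathbb R$ satisfying, for $n\ge1$, $$b_n=n^{\beta_1}\Big(x_0+\frac{x_1}n+\chi_n\Big),\qquad a_n=n^{\beta_2}\Big(y_0+\frac{y_1}n+\mu_n\Big),$$ where $\beta_1,\beta_2,x_0,x_1,x_2,y_0,y_1,y_2$ are real, $x_0>0$, $y_0\ne0$, and, for some $\epsilon>0$, $\chi_n=\frac{x_2}{n^2}+O(n^{-(2+\epsilon)})$ and $\mu_n=\frac{y_2}{n^2}+O(n^{-(2+\epsilon)})$. Set $\sigma=\frac{2x_1}{x_0}-\frac{2y_1}{y_0}$. Then $\mathscr J$ is in limit circle case if and only if one of the following cases takes place. (i) Small diagonal case with $\beta_1>1$; (ii) Simply critical case with $\frac32<\beta_1<\sigma$; (iii) Doubly critical case with $2<\beta_1=\sigma<\frac32+\eta$, where $$\eta=2\left(\frac{2x_2}{x_0}-\frac{2y_2}{y_0}+\frac{y_1}{y_0}-\frac{2x_1y_1}{x_0y_0}+\frac{2y_1^2}{y_0^2}\right).$$ If $\mathscr J$ is in limit circle case, the order $\rho$ of its Nevanlinna matrix is equal to $\frac1{\beta_1}$, except in the simply critical case when $\frac32<\beta_1<2$, where $\rho$ is equal to $\frac1{2(\beta_1-1)}$.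
   Context: **Cases.** Small diagonal: $\beta_2<\beta_1$, or ($\beta_1=\beta_2$ and $|y_0|<2x_0$). Simply critical: $\beta_1=\beta_2$, $|y_0|=2x_0$ and $\beta_1\ne\sigma$. Doubly critical: $\beta_1=\beta_2$, $|y_0|=2x_0$ and $\beta_1=\sigma$. (The remaining case, $\beta_2>\beta_1$ or ($\beta_1=\beta_2$ and $|y_0|>2x_0$), is called large diagonal.) **Jacobi matrix.** $\mathscr J$ is the tridiagonal matrix with diagonal $(a_n)_{n\ge0}$ and off-diagonal $(b_n)_{n\ge0}$, $a_n\in\mathbb R$, $b_n>0$. Its minimal operator is the closure in $\ell^2(\mathbb N_0)$ of $u\mapsto\mathscr Ju$ on finitely supported sequences. $\mathscr J$ is in limit circle case if the minimal operator is not self-adjoint (equivalently, for every $z\in\mathbb C$ all solutions of $b_nu_{n+1}+a_nu_n+b_{n-1}u_{n-1}=zu_n$, $n\ge1$, are in $\ell^2$; equivalently, the associated Hamburger moment problem is indeterminate), and in limit point case otherwise. **Nevanlinna matrix.** Let $p_n,q_n$ be the orthogonal polynomials of first and second kind: both solve $b_nu_{n+1}(z)+a_nu_n(z)+b_{n-1}u_{n-1}(z)=zu_n(z)$, $n\ge1$, with $p_0=1$, $p_1(z)=(z-a_0)/b_0$, $q_0=0$, $q_1=1/b_0$. In limit circle case the Nevanlinna matrix is the entire matrix function $W=\begin{pmatrix} A & C \\ B & D \end{pmatrix}$ with $A(z)=z\sum_k q_k(0)q_k(z)$, $B(z)=-1+z\sum_k q_k(0)p_k(z)$, $C(z)=1+z\sum_k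 p_k(0)q_k(z)$, $D(z)=z\sum_k p_k(0)p_k(z)$. Its order is $\rho=\limsup_{r\to\infty}\frac{\log\log\max_{|z|=r}\|W(z)\|}{\log r}$. *)

(* Defs.v *)
From HB Require Import structures.
From mathcomp Require Import all_boot all_order all_algebra.
From mathcomp Require Import complex.
From mathcomp Require Import all_classical all_reals all_analysis.
Import Order.TTheory GRing.Theory Num.Theory.
Import numFieldNormedType.Exports.

Set Implicit Arguments.
Unset Strict Implicit.
Unset Printing Implicit Defensive.

Local Open Scope classical_set_scope.
Local Open Scope ring_scope.

Section EllTwo.
Variable R : realType.
Implicit Types u v w : nat -> R[i].

Definition cmod (z : R[i]) : R := Normc.normc z.

(* In \bar R, so that a divergent series has value +oo and not a default. *)
Definition l2sqnorm u : \bar R :=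
  (\sum_(0 <= k <oo) (cmod (u k) ^+ 2)%:E)%E.

Definition ell2 u : Prop := (l2sqnorm u < +oo)%E.

(* R[i] only receives its topology when seen as a numFieldType. *)
Definition numsum (K : numFieldType) (f : nat -> K) : K := limn (series f).
Definition csum (f : nat -> R[i]) : R[i] := numsum f.

Definition l2dot u v : R[i] := csum (fun k => u k * (v k)^*%C).

(* Unbounded operators of ell^2(N_0) are represented by their graphs. *)
Definition l2graph := set ((nat -> R[i]) * (nat -> R[i])).

Definition l2closure (G : l2graph) : l2graph :=
  [set p | [/\ ell2 p.1, ell2 p.2 &
     forall e : R, 0 < e -> exists q, [/\ G q,
       (l2sqnorm (p.1 \- q.1)%R < (e ^+ 2)%:E)%E &
       (l2sqnorm (p.2 \- q.2)%R < (e ^+ 2)%:E)%E]]].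

Definition l2adjoint (G : l2graph) : l2graph :=
  [set p | [/\ ell2 p.1, ell2 p.2 &
     forall q, G q -> l2dot q.2 p.1 = l2dot q.1 p.2]].

Definition self_adjoint (G : l2graph) : Prop := l2adjoint G = G.

End EllTwo.

Section Jacobi.
Variables (R : realType) (a b : nat -> R).

Definition jacobi_mul (u : nat -> R[i]) (n : nat) : R[i] :=
  (b n)%:C%C * u n.+1 + (a n)%:C%C * u n +
  (if n is m.+1 then (b m)%:C%C * u m else 0).

Definition jacobi_min : l2graph R :=
  l2closure [set (u, jacobi_mul u) |
    u in [set u : nat -> R[i] | \forall n \near \oo, u n = 0]].

Definition limit_circle : Prop := ~ self_adjoint jacobi_min.

Fixpoint jacobi_sol (z u0 u1 : R[i]) (n : nat) {struct n} : R[i] :=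
  match n with
  | 0%N => u0
  | 1%N => u1
  | (k.+1 as m).+1 =>
      ((z - (a m)%:C%C) * jacobi_sol z u0 u1 m
       - (b k)%:C%C * jacobi_sol z u0 u1 k) / (b m)%:C%C
  end.

Definition pol1 (n : nat) (z : R[i]) : R[i] :=
  jacobi_sol z 1 ((z - (a 0%N)%:C%C) / (b 0%N)%:C%C) n.

Definition pol2 (n : nat) (z : R[i]) : R[i] :=
  jacobi_sol z 0 (b 0%N)%:C%C^-1 n.

Definition nevA (z : R[i]) : R[i] := z * csum (fun k => pol2 k 0 * pol2 k z).
Definition nevB (z : R[i]) : R[i] := -1 + z * csum (fun k => pol2 k 0 * pol1 k z).
Definition nevC (z : R[i]) : R[i] := 1 + z * csum (fun k => pol1 k 0 * pol2 k z).
Definition nevD (z : R[i]) : R[i] := z * csum (fun k => pol1 k 0 * pol1 k z).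

Definition nevanlinna (z : R[i]) : 'M[R[i]]_2 :=
  \matrix_(i < 2, j < 2)
    if i == 0 then (if j == 0 then nevA z else nevC z)
    else (if j == 0 then nevB z else nevD z).

End Jacobi.

Section Order.
Variable R : realType.

(* The order of an entire matrix function does not depend on the choice of
   the matrix norm; the largest modulus of an entry is used. *)
Definition mxmod (M : 'M[R[i]]_2) : R :=
  \big[Num.max/0]_(i < 2) \big[Num.max/0]_(j < 2) cmod (M i j).

Definition max_modulus (F : R[i] -> 'M[R[i]]_2) (r : R) : R :=
  sup [set mxmod (F z) | z in [set z : R[i] | cmod z = r]].

Definition growth_order (F : R[i] -> 'M[R[i]]_2) : \bar R :=
  limf_esup (fun r : R => (ln (ln (max_modulus F r)) / ln r)%:E) (pinfty_nbhs R).

End Order.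

Section Cases.
Variables (R : realType) (beta1 beta2 x0 y0 sigma : R).

Definition small_diagonal : Prop :=
  beta2 < beta1 \/ (beta1 = beta2 /\ `|y0| < 2 * x0).

Definition simply_critical : Prop :=
  [/\ beta1 = beta2, `|y0| = 2 * x0 & beta1 <> sigma].

Definition doubly_critical : Prop :=
  [/\ beta1 = beta2, `|y0| = 2 * x0 & beta1 = sigma].

End Cases.

(* Main.v *)
(* A Jacobi matrix is in limit circle case iff the two solutions p, q of the
   recurrence at z = 0 are square-summable, so the first part is a question on
   their decay.  Let s be the sign of y0.  In the critical cases
   v_n = (-s)^n u_n satisfies a discretized Sturm-Liouville equation whose
   potential b_n + b_(n-1) - s a_n is, relative to b_n, (sigma - beta1)/n in the
   simply critical case and (eta/2)/n^2 in the doubly critical one; quadratic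
   Lyapunov functions give p, q = O(n^(-gamma/2)) with gamma up to beta1 (small
   diagonal), beta1 - 1/2 (simply critical), or above 1 (doubly critical).
   Conversely, Carleman's test, a monotonously growing solution, a Levinson
   type weight, or comparison with the subsolution n^(-1/2) give limit point.

   For the order, variation of constants represents the entries of the
   Nevanlinna matrix by solutions at z; they stay bounded beyond the n with
   |z| sum_(k > n) (p_k^2 + q_k^2) <= T, which together with an energy estimate
   below that n yields log |W| <= T up to logarithms.  From below,
   |W(iy)|^2 >= y sum |p_k(iy)|^2, where p_(n+1)(iy) >= (y/b_n) p_n(iy) in
   modulus gives the order 1/beta1, and exponential growth of v at the rate
   sqrt(y/b_n) for n up to y^(1/(beta1-1)) gives 1/(2(beta1-1)). *)

(* No asymptotic formula for solutions is derived: Lyapunov functions give [u_n^2 = O(n^(-gam))] for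
   every gam below the true exponent. This loss is harmless, since square-summability is claimed
   only under strict inequalities and the order ignores small changes of exponents; in exchange,
   borderline parameters need limit point arguments of their own. The thresholds have these sources.
   The model v'' + (beta/n) v' + (kap/n) v = 0 has solutions of size n^(1/4 - beta/2), whence 3/2.
   Euler's equation with c = eta/2 has exponents solving r (r + beta - 1) + c = 0, and r = -1/2, the
   border of l^2, is a root exactly if beta1 = 3/2 + eta. For the order in the simply critical case,
   the row r^(1/(beta1 - 1)) is the turning point where the defect n^(beta1 - 1) overtakes r; there
   the exponents of the energy estimate and of the tail both equal 1/(2(beta1 - 1)). This exceeds
   the exponent 1/beta1 of the first rows precisely when beta1 < 2, which explains the exceptional
   case. *)
Require Import Defs.
From HB Require Import structures.
From mathcomp Require Import all_boot all_order all_algebra.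
From mathcomp Require Import complex.
From mathcomp Require Import all_classical all_reals all_analysis.
From mathcomp Require Import ring lra.
Import Order.TTheory GRing.Theory Num.Theory.
Import numFieldNormedType.Exports.
Local Open Scope classical_set_scope.
Local Open Scope ring_scope.
Set Implicit Arguments.
Unset Strict Implicit.
Unset Printing Implicit Defensive.

(** * Moduli, series and square-summable sequences *)

(* [ring] recognizes the ring R[i] only when the type of the equation is
   syntactically R[i]; inside big sums it is a coerced structure instead. *)
Ltac cring := match goal with R : realType |- @eq _ ?x ?y =>
  change (@eq (complex (Real.sort R)) x y); ring end.
Ltac cfield := match goal with R : realType |- @eq _ ?x ?y =>
  change (@eq (complex (Real.sort R)) x y); field end.

Section ComplexModulus.
Variable R : realType.
Implicit Types (z w : R[i]) (x : R).

Lemma cmod_ge0 z : 0 <= cmod z.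
Proof. by rewrite /cmod; case: z => x y; rewrite sqrtr_ge0. Qed.

Lemma cmodM z w : cmod (z * w) = cmod z * cmod w.
Proof. exact: Normc.normcM. Qed.

Lemma cmodV z : cmod z^-1 = (cmod z)^-1.
Proof. exact: Normc.normcV. Qed.

Lemma cmodD z w : cmod (z + w) <= cmod z + cmod w.
Proof. exact: complex.le_normcD. Qed.

Lemma cmodN z : cmod (- z) = cmod z.
Proof. exact: complex.normcN. Qed.

Lemma cmodB z w : cmod (z - w) <= cmod z + cmod w.
Proof. by rewrite -(cmodN w) cmodD. Qed.

Lemma cmod0 : cmod (0 : R[i]) = 0.
Proof. exact: Normc.normc0. Qed.

Lemma cmod1 : cmod (1 : R[i]) = 1.
Proof. exact: Normc.normc1. Qed.

Lemma cmod_eq0 z : cmod z = 0 -> z = 0.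
Proof. exact: Normc.eq0_normc. Qed.

Lemma cmod_sqr z : cmod z ^+ 2 = complex.Re z ^+ 2 + complex.Im z ^+ 2.
Proof. by case: z => x y; rewrite /cmod /= sqr_sqrtr// addr_ge0 ?sqr_ge0. Qed.

Lemma cmod_real x : cmod x%:C%C = `|x|.
Proof. by rewrite /cmod /= expr0n/= addr0 sqrtr_sqr. Qed.

Lemma cmodJ z : cmod z^*%C = cmod z.
Proof. by case: z => x y; rewrite /cmod /= sqrrN. Qed.

Lemma le_Re_cmod z : `|complex.Re z| <= cmod z.
Proof.
rewrite -(@ler_pXn2r _ 2) ?nnegrE ?cmod_ge0// cmod_sqr real_normK ?num_real//.
by rewrite lerDl sqr_ge0.
Qed.

Lemma le_Im_cmod z : `|complex.Im z| <= cmod z.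
Proof.
rewrite -(@ler_pXn2r _ 2) ?nnegrE ?cmod_ge0// cmod_sqr real_normK ?num_real//.
by rewrite lerDr sqr_ge0.
Qed.

Lemma cmod_le_ReIm z : cmod z <= `|complex.Re z| + `|complex.Im z|.
Proof.
rewrite -(@ler_pXn2r _ 2) ?nnegrE ?cmod_ge0// ?addr_ge0// cmod_sqr.
rewrite sqrrD !real_normK ?num_real//.
have : 0 <= `|complex.Re z| * `|complex.Im z| by rewrite mulr_ge0.
by rewrite mulr2n; lra.
Qed.

Lemma cmod_sum (n m : nat) (f : nat -> R[i]) :
  cmod (\sum_(n <= k < m) f k) <= \sum_(n <= k < m) cmod (f k).
Proof.
elim/big_ind2 : _ => [|x1 x2 y1 y2 h1 h2|//]; first by rewrite cmod0.
by apply: le_trans (cmodD _ _) (lerD h1 h2).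
Qed.

Lemma Re_sum (n m : nat) (f : nat -> R[i]) :
  complex.Re (\sum_(n <= k < m) f k) = \sum_(n <= k < m) complex.Re (f k).
Proof. by apply: (big_morph _ (id1 := 0) _ _) => // -[? ?] [? ?]. Qed.

Lemma Im_sum (n m : nat) (f : nat -> R[i]) :
  complex.Im (\sum_(n <= k < m) f k) = \sum_(n <= k < m) complex.Im (f k).
Proof. by apply: (big_morph _ (id1 := 0) _ _) => // -[? ?] [? ?]. Qed.

Lemma real_sum (n m : nat) (f : nat -> R) :
  (\sum_(n <= k < m) f k)%:C%C = \sum_(n <= k < m) (f k)%:C%C :> R[i].
Proof.
by apply: (big_morph (fun x : R => x%:C%C : R[i])) => [x y|]; [rewrite rmorphD|].
Qed.

Lemma mul_conjc z : z * z^*%C = (cmod z ^+ 2)%:C%C.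
Proof. by rewrite cmod_sqr; case: z => x y /=; apply/eqP; rewrite eq_complex /=; apply/andP; split; apply/eqP; ring. Qed.

End ComplexModulus.

Lemma norm_of_sqr1 (R : realDomainType) (s : R) : s ^+ 2 = 1 -> `|s| = 1.
Proof. by move=> s2; apply/eqP; rewrite -(@eqrXn2 _ 2)// real_normK ?num_real// s2 expr1n. Qed.

Lemma numsumE (K : numFieldType) (f : nat -> K) l :
  (forall e, 0 < e -> exists N : nat, forall n, (N <= n)%N ->
    `|l - \sum_(0 <= k < n) f k| < e) -> numsum f = l.
Proof.
move=> fl; apply/cvg_lim; first exact: norm_hausdorff.
apply/cvgrPdist_lt => e /fl [N HN].
by exists N => // n; exact: HN.
Qed.

Section Series.
Variable R : realType.
Implicit Types (f u v : nat -> R[i]) (g : nat -> R).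

(** [csum] is a [limn], with a default value on divergent series; the proof therefore evaluates it
    only through this explicit form of convergence. *)
Definition csum_to f (l : R[i]) := forall e : R, 0 < e ->
  exists N : nat, forall n, (N <= n)%N -> cmod (\sum_(0 <= k < n) f k - l) <= e.

Lemma csum_toE f l : csum_to f l -> csum f = l.
Proof.
move=> fl; apply: numsumE => e e0.
(* In the order of [R[i]] a positive element has imaginary part 0. *)
have [e1 ee] : exists e1 : R, e = e1%:C%C.
  exists (complex.Re e); apply/eqP; rewrite eq_complex /= eqxx /=.
  by move: e0; rewrite ltcE /= => /andP[].
have e10 : 0 < e1 by move: e0; rewrite ee ltcR.
have [|N HN] := fl (e1 / 2); first by rewrite divr_gt0.
exists N => n Nn; rewrite distrC ee.
suff : cmod (\sum_(0 <= k < n) f k - l) < e1.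
  by rewrite -ltcR; apply: le_lt_trans; rewrite normc_def /cmod; case: (_ - _).
apply: le_lt_trans (HN n Nn) _.
by rewrite ltr_pdivrMr// mulr_natr mulr2n ltrDl.
Qed.

Lemma series_bounded_cvg g M : (forall n, 0 <= g n) ->
  (forall n, \sum_(0 <= k < n) g k <= M) -> cvgn (series g).
Proof.
move=> g0 gM; apply: nondecreasing_is_cvgn.
  by apply: nondecreasing_series => n _ _; exact: g0.
by exists M => _ [n _ <-]; exact: gM.
Qed.

Lemma rseries_lim g M : (forall n, \sum_(0 <= k < n) `|g k| <= M) ->
  exists l, forall e, 0 < e -> exists N : nat, forall n, (N <= n)%N ->
    `|\sum_(0 <= k < n) g k - l| <= e.
Proof.
move=> gM.
have cg : cvgn (series g).
  apply: normed_cvg.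
  exact: (@series_bounded_cvg (fun k => `|g k|) M (fun=> normr_ge0 _) gM).
exists (limn (series g)) => e e0.
have /cvgrPdist_le/(_ e e0) [N _ HN] := cg.
by exists N => n Nn; rewrite distrC; apply: (HN n Nn).
Qed.

Lemma csum_abs f M : (forall n, \sum_(0 <= k < n) cmod (f k) <= M) ->
  csum_to f (csum f).
Proof.
move=> fM.
have [|lr Hr] := @rseries_lim (fun k => complex.Re (f k)) M.
  move=> n; apply: le_trans (fM n); apply: ler_sum => k _; exact: le_Re_cmod.
have [|li Hi] := @rseries_lim (fun k => complex.Im (f k)) M.
  move=> n; apply: le_trans (fM n); apply: ler_sum => k _; exact: le_Im_cmod.
have H : csum_to f (lr +i* li)%C.
  move=> e e0; have e20 : 0 < e / 2 by rewrite divr_gt0.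
  have [N1 H1] := Hr _ e20; have [N2 H2] := Hi _ e20.
  exists (maxn N1 N2) => n; rewrite geq_max => /andP[n1 n2].
  apply: le_trans (cmod_le_ReIm _) _.
  rewrite [leRHS](splitr e); apply: lerD.
    by have := H1 n n1; rewrite -Re_sum; case: (\sum_(_ <= _ < _) _).
  by have := H2 n n2; rewrite -Im_sum; case: (\sum_(_ <= _ < _) _).
by rewrite (csum_toE H).
Qed.

Definition l2part u n : R := \sum_(0 <= k < n) cmod (u k) ^+ 2.

Lemma l2part_ge0 u n : 0 <= l2part u n.
Proof. by apply: sumr_ge0 => k _; rewrite sqr_ge0. Qed.

Lemma l2partS u n : l2part u n.+1 = l2part u n + cmod (u n) ^+ 2.
Proof. by rewrite /l2part big_nat_recr. Qed.

Lemma l2part_mono u n m : (n <= m)%N -> l2part u n <= l2part u m.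
Proof.
elim: m => [|m ih]; first by rewrite leqn0 => /eqP ->.
rewrite leq_eqVlt => /predU1P[->//|]; rewrite ltnS => /ih h.
by rewrite l2partS (le_trans h)// lerDl sqr_ge0.
Qed.

Lemma l2part_term u k n : (k < n)%N -> cmod (u k) ^+ 2 <= l2part u n.
Proof.
move=> kn; apply: le_trans (l2part_mono u kn).
by rewrite l2partS lerDr l2part_ge0.
Qed.

Lemma l2part_le_sqnorm u n : ((l2part u n)%:E <= l2sqnorm u)%E.
Proof.
rewrite /l2part /l2sqnorm -sumEFin; apply: nneseries_lim_ge => k _ _.
by rewrite lee_fin sqr_ge0.
Qed.

Lemma l2sqnorm_le u M : (forall n, l2part u n <= M) -> (l2sqnorm u <= M%:E)%E.
Proof.
move=> uM; apply: lime_le.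
  by apply: is_cvg_nneseries => k _ _; rewrite lee_fin sqr_ge0.
by apply: nearW => n; rewrite sumEFin lee_fin; exact: uM.
Qed.

Lemma ell2P u : ell2 u <-> exists M, forall n, l2part u n <= M.
Proof.
split=> [|[M uM]]; last first.
  by apply: (le_lt_trans (l2sqnorm_le uM)); rewrite ltry.
rewrite /ell2 => h; exists (fine (l2sqnorm u)) => n.
have := l2part_le_sqnorm u n; move: h.
by case: (l2sqnorm u) => // x _; rewrite lee_fin.
Qed.

Lemma cauchy_schwarz (f g : nat -> R) m n :
  (\sum_(m <= k < n) f k * g k) ^+ 2 <=
  (\sum_(m <= k < n) f k ^+ 2) * (\sum_(m <= k < n) g k ^+ 2).
Proof.
have [nm|] := leqP n m; first by rewrite !big_geq// expr0n mul0r.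
elim: n => // n ih; rewrite ltnS leq_eqVlt => /predU1P[<-|mn].
  by rewrite !big_nat1 exprMn.
have {}ih := ih mn; have {}mn := ltnW mn.
rewrite !big_nat_recr//=.
set S := \sum_(_ <= _ < _) _ in ih *; set A := \sum_(_ <= _ < _) _ in ih *.
set B := \sum_(_ <= _ < _) _ in ih *.
have A0 : 0 <= A by apply: sumr_ge0 => k _; rewrite sqr_ge0.
have B0 : 0 <= B by apply: sumr_ge0 => k _; rewrite sqr_ge0.
set x := f n; set y := g n.
have h : 2 * (S * (x * y)) <= A * y ^+ 2 + x ^+ 2 * B.
  apply: le_trans (ler_norm _) _.
  rewrite -(@ler_pXn2r _ 2) ?nnegrE ?normr_ge0//; last first.
    by rewrite addr_ge0// mulr_ge0// sqr_ge0.
  rewrite real_normK ?num_real//.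
  have : 0 <= (A * y ^+ 2 - x ^+ 2 * B) ^+ 2 by rewrite sqr_ge0.
  have : S ^+ 2 * (x ^+ 2 * y ^+ 2) <= A * B * (x ^+ 2 * y ^+ 2).
    by rewrite ler_wpM2r// mulr_ge0 ?sqr_ge0.
  nra.
rewrite sqrrD mulrDr !mulrDl exprMn; lra.
Qed.

Lemma cauchy_schwarz_le (f g : nat -> R) m n (A B : R) :
  0 <= A -> 0 <= B ->
  \sum_(m <= k < n) f k ^+ 2 <= A ^+ 2 -> \sum_(m <= k < n) g k ^+ 2 <= B ^+ 2 ->
  \sum_(m <= k < n) f k * g k <= A * B.
Proof.
move=> A0 B0 fA gB; apply: le_trans (ler_norm _) _.
rewrite -(@ler_pXn2r _ 2) ?nnegrE ?normr_ge0 ?mulr_ge0//.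
rewrite real_normK ?num_real// exprMn.
apply: le_trans (cauchy_schwarz f g m n) _.
by apply: ler_pM => //; apply: sumr_ge0 => k _; rewrite sqr_ge0.
Qed.

Lemma cmodD_sqr (z w : R[i]) : cmod (z + w) ^+ 2 <= 2 * (cmod z ^+ 2 + cmod w ^+ 2).
Proof.
have := cmodD z w; have := cmod_ge0 (z + w).
have : 0 <= (cmod z - cmod w) ^+ 2 by rewrite sqr_ge0.
nra.
Qed.

Lemma l2partD u v n : l2part (fun k => u k + v k) n <= 2 * (l2part u n + l2part v n).
Proof.
rewrite /l2part -big_split/= mulr_sumr; apply: ler_sum => k _; exact: cmodD_sqr.
Qed.

Lemma eq_l2part u v n : (forall k, u k = v k) -> l2part u n = l2part v n.
Proof. by move=> uv; apply: eq_bigr => k _; rewrite uv. Qed.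

Lemma l2partZ c u n : l2part (fun k => c * u k) n = cmod c ^+ 2 * l2part u n.
Proof. by rewrite /l2part mulr_sumr; apply: eq_bigr => k _; rewrite cmodM exprMn. Qed.

Lemma l2partN u n : l2part (fun k => - u k) n = l2part u n.
Proof. by rewrite /l2part; apply: eq_bigr => k _; rewrite cmodN. Qed.

Lemma ell2D u v : ell2 u -> ell2 v -> ell2 (fun k => u k + v k).
Proof.
move=> /ell2P[M hM] /ell2P[M' hM']; apply/ell2P; exists (2 * (M + M')) => n.
by apply: le_trans (l2partD _ _ _) _; rewrite ler_wpM2l// lerD.
Qed.

Lemma ell2Z c u : ell2 u -> ell2 (fun k => c * u k).
Proof.
move=> /ell2P[M hM]; apply/ell2P; exists (cmod c ^+ 2 * M) => n.
by rewrite l2partZ ler_wpM2l ?sqr_ge0.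
Qed.

Lemma ell2N u : ell2 u -> ell2 (fun k => - u k).
Proof.
by move=> /ell2P[M hM]; apply/ell2P; exists M => n; rewrite l2partN.
Qed.

Lemma ell2_tail u e : ell2 u -> 0 < e ->
  exists N, forall n, \sum_(N <= k < n) cmod (u k) ^+ 2 <= e.
Proof.
move=> /ell2P[M uM] e0.
have c : cvgn (series (fun k => cmod (u k) ^+ 2)).
  by apply: (series_bounded_cvg (M := M)) => // n; rewrite sqr_ge0.
have /cvgrPdist_le/(_ _ (divr_gt0 e0 (ltr0Sn R 1))) [N _ HN] := c.
exists N => n; have [nN|Nn] := leqP n N; first by rewrite big_geq// ltW.
have H1 := HN N (leqnn N); have H2 := HN n (ltnW Nn).
rewrite /series/= in H1 H2.
have E : \sum_(0 <= k < n) cmod (u k) ^+ 2 =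
   \sum_(0 <= k < N) cmod (u k) ^+ 2 + \sum_(N <= k < n) cmod (u k) ^+ 2.
  by rewrite (@big_cat_nat _ _ _ N)//= ltnW.
rewrite E in H2; move: H1 H2; rewrite !ler_norml => /andP[a1 b1] /andP[a2 b2].
by lra.
Qed.

End Series.

(** * The Jacobi recurrence *)

Section JacobiAlgebra.
Variables (R : realType) (a b : nat -> R).
Hypothesis b_gt0 : forall n, 0 < b n.
Implicit Types (u v : nat -> R[i]) (z : R[i]).
Local Notation J := (jacobi_mul a b).
Local Notation "x %:C" := (x%:C)%C.

(** The first unit vector. [pol2] solves the eigenvalue equation in every row except row 0, where
    the residual is 1. *)
Definition e0 (n : nat) : R[i] := if n is 0 then 1 else 0.

Lemma bC_neq0 n : (b n)%:C != 0 :> R[i].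
Proof. by rewrite (inj_eq (@complexI R)) gt_eqF. Qed.

Lemma jacobi_mul0 u : J u 0 = (b 0%N)%:C * u 1%N + (a 0%N)%:C * u 0%N.
Proof. by rewrite /jacobi_mul addr0. Qed.

Lemma jacobi_mulS u n : J u n.+1 =
  (b n.+1)%:C * u n.+2 + (a n.+1)%:C * u n.+1 + (b n)%:C * u n.
Proof. by []. Qed.

Definition jacobi_mulE := (jacobi_mul0, jacobi_mulS).

Lemma jacobi_mulD u v n : J (fun k => u k + v k) n = J u n + J v n.
Proof. by case: n => [|n]; rewrite !jacobi_mulE; cring. Qed.

Lemma jacobi_mulZ c u n : J (fun k => c * u k) n = c * J u n.
Proof. by case: n => [|n]; rewrite !jacobi_mulE; cring. Qed.

Lemma jacobi_mulB u v n : J (fun k => u k - v k) n = J u n - J v n.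
Proof. by case: n => [|n]; rewrite !jacobi_mulE; cring. Qed.

Lemma jacobi_mulJ u n : J (fun k => (u k)^*%C) n = (J u n)^*%C.
Proof.
rewrite /jacobi_mul rmorphD rmorphD !rmorphM /= !oppr0; congr (_ + _).
by case: n => [|n]; rewrite ?rmorph0// rmorphM /= oppr0.
Qed.

(** Telescoping: row 0 has no left neighbour and leaves no boundary term, so only the Casoratian at
    n remains. *)
Lemma jacobi_lagrange u v n :
  \sum_(0 <= k < n.+1) (u k * J v k - J u k * v k) =
  (b n)%:C * (u n * v n.+1 - u n.+1 * v n).
Proof.
elim: n => [|n ih]; first by rewrite big_nat1 !jacobi_mulE; cring.
by rewrite big_nat_recr//= ih !jacobi_mulE; cring.
Qed.

Lemma jacobi_solSS z (x y : R[i]) n : jacobi_sol a b z x y n.+2 =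
  ((z - (a n.+1)%:C) * jacobi_sol a b z x y n.+1 -
   (b n)%:C * jacobi_sol a b z x y n) / (b n.+1)%:C.
Proof. by []. Qed.

Lemma pol1_J z n : J (fun k => pol1 a b k z) n = z * pol1 a b n z.
Proof.
have := bC_neq0 n; case: n => [|n] b0; rewrite jacobi_mulE /pol1 ?jacobi_solSS /=; by cfield.
Qed.

Lemma pol2_J z n : J (fun k => pol2 a b k z) n = z * pol2 a b n z + e0 n.
Proof.
have := bC_neq0 n; case: n => [|n] b0; rewrite jacobi_mulE /pol2 ?jacobi_solSS /=; by cfield.
Qed.

Lemma pol_wronskian z n :
  (b n)%:C * (pol1 a b n z * pol2 a b n.+1 z - pol1 a b n.+1 z * pol2 a b n z) = 1.
Proof.
rewrite -(jacobi_lagrange (fun k => pol1 a b k z) (fun k => pol2 a b k z)).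
rewrite big_nat_recl// big1 ?addr0 => [|k _]; rewrite !pol1_J !pol2_J /e0.
  by rewrite /pol1 /pol2 /=; cring.
by cring.
Qed.

(* Im z * sum |u_k|^2 is a boundary term, up to the source at row 0. *)
Lemma green u z s n : (forall k, J u k = z * u k + s * e0 k) ->
  complex.Im z * l2part u n.+1 + complex.Im (s * (u 0%N)^*%C) =
  b n * complex.Im ((u n)^*%C * u n.+1).
Proof.
move=> Ju; pose v k := (u k)^*%C.
have := congr1 (@complex.Im R) (jacobi_lagrange v u n).
rewrite Im_sum.
have E k : complex.Im (v k * J u k - J v k * u k) =
    2 * (complex.Im z * cmod (u k) ^+ 2) + (if k is 0 then 2 * complex.Im (s * v k) else 0).
  rewrite jacobi_mulJ Ju cmod_sqr /v.
  case: (u k) => x y; case: z {Ju} => z1 z2; case: s => s1 s2.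
  by case: k => [|k] /=; ring.
under eq_bigr do rewrite E.
rewrite big_split /= -mulr_sumr -mulr_sumr -/(l2part u n.+1).
rewrite big_nat_recl// big1 ?addr0 => [H|//].
have : complex.Im ((b n)%:C * (v n * u n.+1 - v n.+1 * u n)) =
   2 * (b n * complex.Im ((u n)^*%C * u n.+1)).
  rewrite /v; case: (u n) => x1 y1; case: (u n.+1) => x2 y2 /=; ring.
by rewrite -H -mulrDr => /(mulfI (lt0r_neq0 (ltr0Sn R 1))).
Qed.

Lemma pol1_green z n :
  complex.Im z * l2part (fun k => pol1 a b k z) n.+1 =
  b n * complex.Im ((pol1 a b n z)^*%C * pol1 a b n.+1 z).
Proof.
rewrite -(@green (fun k => pol1 a b k z) z 0) => [|k]; last by rewrite pol1_J; cring.
by rewrite mul0r addr0.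
Qed.

End JacobiAlgebra.

(** * Variation of constants and change of the spectral parameter *)

Section VariationOfConstants.
Variables (R : realType) (a b : nat -> R) (z0 z s : R[i]) (u : nat -> R[i]).
Hypothesis b_gt0 : forall n, 0 < b n.
Hypothesis Ju : forall k, jacobi_mul a b u k = z * u k + s * e0 R k.
Local Notation p := (fun k => pol1 a b k z0).
Local Notation q := (fun k => pol2 a b k z0).

(** The coordinates of u in the basis p, q of solutions at z0. For z0 = 0 they are, up to sign,
    partial sums of the entries of the Nevanlinna matrix: B and D for u = [pol1] at z with s = 0,
    and A and C for u = [pol2] at z with s = 1. *)
Definition coordX n := u 0%N + (z0 - z) * \sum_(0 <= k < n) q k * u k.
Definition coordY n := - s + (z0 - z) * \sum_(0 <= k < n) p k * u k.

Lemma coordXS n : coordX n.+1 = coordX n + (z0 - z) * (q n * u n).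
Proof. by rewrite /coordX big_nat_recr//= mulrDr addrA. Qed.

Lemma coordYS n : coordY n.+1 = coordY n + (z0 - z) * (p n * u n).
Proof. by rewrite /coordY big_nat_recr//= mulrDr addrA. Qed.

Let three_term v n (y : R[i]) : jacobi_mul a b v n.+1 = y * v n.+1 ->
  (b n.+1)%:C%C * v n.+2 = (y - (a n.+1)%:C%C) * v n.+1 - (b n)%:C%C * v n.
Proof. by rewrite jacobi_mulE => E; rewrite mulrBl -E; cring. Qed.

Let Ju1 n : jacobi_mul a b u n.+1 = z * u n.+1.
Proof. by rewrite Ju mulr0 addr0. Qed.

Let Jq1 n : jacobi_mul a b q n.+1 = z0 * q n.+1.
Proof. by rewrite pol2_J// addr0. Qed.

Lemma coordXE n : coordX n.+1 = (b n)%:C%C * (u n * q n.+1 - u n.+1 * q n).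
Proof.
elim: n => [|n ih].
  have b0 := bC_neq0 b_gt0 0.
  by rewrite coordXS /coordX big_geq// /pol2 /=; cfield.
rewrite coordXS ih.
transitivity (u n.+1 * ((b n.+1)%:C%C * q n.+2) - ((b n.+1)%:C%C * u n.+2) * q n.+1).
  by rewrite (three_term (Jq1 n)) (three_term (Ju1 n)); cring.
by cring.
Qed.

Lemma coordYE n : coordY n.+1 = (b n)%:C%C * (u n * p n.+1 - u n.+1 * p n).
Proof.
elim: n => [|n ih].
  have b0 := bC_neq0 b_gt0 0.
  have J0 := Ju 0; rewrite jacobi_mulE /e0 mulr1 in J0.
  have -> : coordY 1 = z0 * u 0%N - (z * u 0%N + s).
    by rewrite coordYS /coordY big_geq// /pol1 /=; cring.
  by rewrite -J0 /pol1 /=; cfield.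
rewrite coordYS ih.
transitivity (u n.+1 * ((b n.+1)%:C%C * p n.+2) - ((b n.+1)%:C%C * u n.+2) * p n.+1).
  by rewrite (three_term (pol1_J a b_gt0 z0 n.+1)) (three_term (Ju1 n)); cring.
by cring.
Qed.

(** From index 1 on the coordinates are the Casoratians of u with q and with p; solving for u uses
    that the Casoratian of p and q is 1. *)
Lemma coord_sol n : u n = coordX n * p n - coordY n * q n.
Proof.
case: n => [|n]; first by rewrite /coordX big_geq// /pol1 /pol2 /=; cring.
rewrite coordXE coordYE -[LHS]mulr1 -(pol_wronskian a b_gt0 z0 n); cring.
Qed.

Definition coord_norm n := cmod (coordX n) + cmod (coordY n).

Lemma coord_normS n : coord_norm n.+1 <=
  (1 + 2 * cmod (z0 - z) * (cmod (p n) ^+ 2 + cmod (q n) ^+ 2)) * coord_norm n.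
Proof.
rewrite /coord_norm coordXS coordYS.
apply: le_trans (lerD (cmodD _ _) (cmodD _ _)) _.
rewrite !cmodM.
have un : cmod (u n) <= cmod (coordX n) * cmod (p n) + cmod (coordY n) * cmod (q n).
  by rewrite {1}coord_sol -!cmodM; exact: cmodB.
move: un (cmod_ge0 (coordX n)) (cmod_ge0 (coordY n)) (cmod_ge0 (p n)) (cmod_ge0 (q n)) (cmod_ge0 (z0 - z)) (cmod_ge0 (u n)).
set X := cmod (coordX n); set Y := cmod (coordY n); set P := cmod (p n).
set Q := cmod (q n); set Z := cmod (z0 - z); set U := cmod (u n).
move=> un X0 Y0 P0 Q0 Z0 U0.
have h : (P + Q) * U <= (2 * (P ^+ 2 + Q ^+ 2)) * (X + Y).
  have h1 : (P + Q) * U <= (P + Q) * ((P + Q) * (X + Y)).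
    apply: ler_wpM2l; first by rewrite addr_ge0.
    apply: le_trans un _.
    have : 0 <= X * Q by exact: mulr_ge0.
    have : 0 <= Y * P by exact: mulr_ge0.
    nra.
  apply: le_trans h1 _; rewrite mulrA; apply: ler_wpM2r; first by rewrite addr_ge0.
  have : 0 <= (P - Q) ^+ 2 by rewrite sqr_ge0.
  nra.
have := ler_wpM2l Z0 h; lra.
Qed.

Lemma coord_norm_ge0 n : 0 <= coord_norm n.
Proof. by rewrite addr_ge0// cmod_ge0. Qed.

(** A discrete Gronwall inequality. The free starting index m lets the order estimate pay only for
    the tail of the sum of p^2 + q^2. *)
Lemma coord_growth m n : (m <= n)%N -> coord_norm n <=
  expR (2 * cmod (z0 - z) * \sum_(m <= k < n) (cmod (p k) ^+ 2 + cmod (q k) ^+ 2))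
  * coord_norm m.
Proof.
elim: n => [|n ih]; first by rewrite leqn0 => /eqP ->; rewrite big_geq// mulr0 expR0 mul1r.
rewrite leq_eqVlt => /predU1P[->|]; first by rewrite big_geq// mulr0 expR0 mul1r.
rewrite ltnS => mn; rewrite big_nat_recr//= [X in expR X]mulrDr expRD mulrAC mulrC.
apply: le_trans (coord_normS n) _; apply: ler_pM; [|exact: coord_norm_ge0| |exact: ih].
  by rewrite addr_ge0// !mulr_ge0 ?cmod_ge0// addr_ge0 ?sqr_ge0.
exact: expR_ge1Dx.
Qed.

Lemma coord_solution_le n :
  cmod (u n) ^+ 2 <= (cmod (p n) ^+ 2 + cmod (q n) ^+ 2) * coord_norm n ^+ 2.
Proof.
have un : cmod (u n) <= cmod (coordX n) * cmod (p n) + cmod (coordY n) * cmod (q n).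
  by rewrite {1}coord_sol -!cmodM; exact: cmodB.
rewrite /coord_norm.
move: un (cmod_ge0 (coordX n)) (cmod_ge0 (coordY n)) (cmod_ge0 (p n)) (cmod_ge0 (q n)) (cmod_ge0 (u n)).
set X := cmod (coordX n); set Y := cmod (coordY n); set P := cmod (p n).
set Q := cmod (q n); set U := cmod (u n) => un X0 Y0 P0 Q0 U0.
have h1 : U ^+ 2 <= (X * P + Y * Q) ^+ 2.
  by rewrite lerXn2r ?nnegrE// addr_ge0// mulr_ge0.
apply: le_trans h1 _.
have : 0 <= (X * Q - Y * P) ^+ 2 by rewrite sqr_ge0.
have : 0 <= (P ^+ 2 + Q ^+ 2) * (X * Y) by rewrite !mulr_ge0// addr_ge0 ?sqr_ge0.
nra.
Qed.

Lemma ell2_coord_bounded : ell2 p -> ell2 q ->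
  exists C, forall n, coord_norm n <= C.
Proof.
move=> /ell2P[Mp Hp] /ell2P[Mq Hq].
exists (expR (2 * cmod (z0 - z) * (Mp + Mq)) * coord_norm 0) => n.
apply: le_trans (coord_growth (leq0n n)) _.
rewrite ler_wpM2r ?coord_norm_ge0// ler_expR ler_wpM2l ?mulr_ge0 ?cmod_ge0//.
by rewrite big_split/= lerD// ?Hp ?Hq.
Qed.

(** Invariance of the limit circle case in the spectral parameter: the Gronwall bound keeps the
    coordinates bounded, so u is dominated by p and q. The source term s makes this applicable to
    [pol2] as well. *)
Lemma ell2_transfer : ell2 p -> ell2 q -> ell2 u.
Proof.
move=> p2 q2; have [C HC] := ell2_coord_bounded p2 q2.
move: p2 q2 => /ell2P[Mp Hp] /ell2P[Mq Hq].
apply/ell2P; exists ((Mp + Mq) * C ^+ 2) => n.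
apply: (@le_trans _ _ (\sum_(0 <= k < n) (cmod (p k) ^+ 2 + cmod (q k) ^+ 2) * C ^+ 2)).
  apply: ler_sum => k _; apply: le_trans (coord_solution_le k) _.
  rewrite ler_wpM2l ?addr_ge0 ?sqr_ge0// lerXn2r ?nnegrE ?coord_norm_ge0//.
  by rewrite (le_trans _ (HC k))// coord_norm_ge0.
by rewrite -mulr_suml ler_wpM2r ?sqr_ge0// big_split/= lerD ?Hp ?Hq.
Qed.

End VariationOfConstants.

(** * Limit circle case and square-summable solutions *)

Section MaximalOperator.
Variables (R : realType) (a b : nat -> R).
Hypothesis b_gt0 : forall n, 0 < b n.
Implicit Types (u v w g : nat -> R[i]) (e : R).
Local Notation J := (jacobi_mul a b).
Local Notation fin u := (\forall n \near \oo, u n = 0).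

Lemma finP u : fin u <-> exists N, forall n, (N <= n)%N -> u n = 0.
Proof. by split=> [[N _ h]|[N h]]; exists N. Qed.

Lemma jacobi_min_approx u g : jacobi_min a b (u, g) ->
  [/\ ell2 u, ell2 g & forall e, 0 < e -> exists2 x, fin x &
     (forall n, l2part (fun k => u k - x k) n <= e ^+ 2) /\
     (forall n, l2part (fun k => g k - J x k) n <= e ^+ 2)].
Proof.
move=> [/= u2 g2 H]; split=> // e /H[_ [[x fx <-] /= h1 h2]]; exists x => //.
split=> n; rewrite -lee_fin; (apply: le_trans (l2part_le_sqnorm _ _) (ltW _)).
  exact: h1.
exact: h2.
Qed.

Lemma jacobi_minI u g : ell2 u -> ell2 g ->
  (forall e, 0 < e -> exists2 x, fin x &
     (forall n, l2part (fun k => u k - x k) n <= e) /\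
     (forall n, l2part (fun k => g k - J x k) n <= e)) ->
  jacobi_min a b (u, g).
Proof.
move=> u2 g2 H; split=> // e e0.
have e20 : 0 < e ^+ 2 by rewrite exprn_gt0.
have [|x fx [h1 h2]] := H (e ^+ 2 / 2); first by rewrite divr_gt0.
exists (x, J x); split; first by exists x.
  apply: (le_lt_trans (l2sqnorm_le h1)).
  by rewrite lte_fin ltr_pdivrMr// mulr_natr mulr2n ltrDl.
apply: (le_lt_trans (l2sqnorm_le h2)).
by rewrite lte_fin ltr_pdivrMr// mulr_natr mulr2n ltrDl.
Qed.

(* Below the support of x the boundary term of [jacobi_lagrange] vanishes. *)
Lemma jacobi_lagrange_fin x v N n : (forall k, (N <= k)%N -> x k = 0) -> (N < n)%N ->
  \sum_(0 <= k < n) (J x k * v k - x k * J v k) = 0.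
Proof.
move=> x0; case: n => // n Nn.
transitivity (- \sum_(0 <= k < n.+1) (x k * J v k - J x k * v k)).
  by rewrite -sumrN; apply: eq_bigr => k _; rewrite opprB.
by rewrite jacobi_lagrange !x0 ?mul0r ?subrr ?mulr0 ?oppr0//; exact: ltnW.
Qed.

Lemma l2part_bound u : ell2 u -> exists2 A, 0 <= A & forall n, l2part u n <= A ^+ 2.
Proof.
move=> /ell2P[M HM]; exists (1 + `|M|) => [|n]; first by rewrite addr_ge0.
apply: le_trans (HM n) _; have := ler_norm M; have := normr_ge0 M; nra.
Qed.

Lemma l2_pairing_le u v A B m n : 0 <= A -> 0 <= B ->
  \sum_(m <= k < n) cmod (u k) ^+ 2 <= A ^+ 2 ->
  \sum_(m <= k < n) cmod (v k) ^+ 2 <= B ^+ 2 ->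
  \sum_(m <= k < n) cmod (u k * v k) <= A * B.
Proof.
move=> A0 B0 uA vB.
under eq_bigr do rewrite cmodM.
exact: (@cauchy_schwarz_le _ (fun k => cmod (u k)) (fun k => cmod (v k))).
Qed.

Lemma ell2_pairing u v : ell2 u -> ell2 v ->
  csum_to (fun k => u k * v k) (csum (fun k => u k * v k)).
Proof.
move=> /l2part_bound[A A0 HA] /l2part_bound[B B0 HB].
apply: (@csum_abs _ _ (A * B)) => n.
exact: (l2_pairing_le A0 B0 (HA n) (HB n)).
Qed.

Lemma ell2J u : ell2 u -> ell2 (fun k => (u k)^*%C).
Proof.
move=> /ell2P[M HM]; apply/ell2P; exists M => n.
rewrite /l2part; under eq_bigr do rewrite cmodJ.
exact: HM.
Qed.

Lemma sum_subMl (f g h : nat -> R[i]) m n :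
  \sum_(m <= k < n) (f k - g k) * h k =
  \sum_(m <= k < n) f k * h k - \sum_(m <= k < n) g k * h k.
Proof. by rewrite -sumrB; apply: eq_bigr => k _; rewrite mulrBl. Qed.

(** Against finitely supported sequences Lagrange's identity has no boundary term; approximation in
    the graph norm carries the symmetry over to the closure. *)
Lemma max_adjoint v w : ell2 v -> ell2 w -> (forall n, w n = J v n) ->
  l2adjoint (jacobi_min a b) (v, w).
Proof.
move=> v2 w2 wJ; split=> // -[u g] /jacobi_min_approx[u2 g2 H] /=.
have := ell2_pairing g2 (ell2J v2); have := ell2_pairing u2 (ell2J w2).
rewrite /l2dot; set S1 := csum (fun k => u k * _); set S2 := csum (fun k => g k * _).
move=> c1 c2.
have [A A0 HA] := l2part_bound (ell2J v2).
have [B B0 HB] := l2part_bound (ell2J w2).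
apply/eqP; rewrite -subr_eq0; apply/eqP/cmod_eq0/eqP.
rewrite eq_le cmod_ge0 andbT; apply/ler_addgt0Pr => e e0; rewrite add0r.
(* The error consists of two Cauchy-Schwarz terms, d A and d B, and two truncation errors d of the
   series. *)
pose d := e / (2 + A + B).
have AB0 : 0 < 2 + A + B by lra.
have d0 : 0 < d by rewrite divr_gt0.
have [x /finP[N0 x0] [h1 h2]] := H d d0.
have [N1 H1] := c1 d d0; have [N2 H2] := c2 d d0.
pose n := (N0.+1 + N1 + N2)%N.
have k1 := H1 n (leq_trans (leq_addl _ _) (leq_addr _ _)).
have k2 := H2 n (leq_addl _ _).
have K0 : \sum_(0 <= k < n) (J x k * (v k)^*%C - x k * (w k)^*%C) = 0.
  rewrite -[RHS](@jacobi_lagrange_fin x (fun k => (v k)^*%C) N0 n x0); last first.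
    by rewrite /n -addnA leq_addr.
  by apply: eq_bigr => k _; rewrite jacobi_mulJ wJ.
have -> : S2 - S1 = \sum_(0 <= k < n) (g k - J x k) * (v k)^*%C
   - \sum_(0 <= k < n) (u k - x k) * (w k)^*%C
   - (\sum_(0 <= k < n) g k * (v k)^*%C - S2)
   + (\sum_(0 <= k < n) u k * (w k)^*%C - S1).
  rewrite !sum_subMl.
  move: K0; rewrite sumrB => /eqP; rewrite subr_eq0 => /eqP ->; cring.
have l1 : cmod (\sum_(0 <= k < n) (g k - J x k) * (v k)^*%C) <= d * A.
  apply: le_trans (cmod_sum _ _ _) _.
  exact: (l2_pairing_le (ltW d0) A0 (h2 n) (HA n)).
have l2 : cmod (\sum_(0 <= k < n) (u k - x k) * (w k)^*%C) <= d * B.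
  apply: le_trans (cmod_sum _ _ _) _.
  exact: (l2_pairing_le (ltW d0) B0 (h1 n) (HB n)).
apply: le_trans (cmodD _ _) _; apply: le_trans (lerD (cmodB _ _) (lexx _)) _.
apply: le_trans (lerD (lerD (cmodB _ _) (lexx _)) (lexx _)) _.
have -> : e = d * (2 + A + B).
  by rewrite /d mulfVK// gt_eqF.
lra.
Qed.

Lemma ell2_fin u M : (forall k, (M <= k)%N -> u k = 0) -> ell2 u.
Proof.
move=> y0; apply/ell2P; exists (l2part u M) => n.
have [/(l2part_mono u)//|Mn] := leqP n M.
rewrite /l2part (@big_cat_nat _ _ _ M) ?(ltnW Mn)//= [X in _ + X]big_nat.
rewrite [X in _ + X]big1 ?addr0// => k /andP[Mk _].
by rewrite y0// cmod0 expr0n.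
Qed.

Lemma jacobi_min_fin x : fin x -> jacobi_min a b (x, J x).
Proof.
move=> fx; have [N x0] := (finP x).1 fx.
apply: jacobi_minI => [||e e0]; first exact: ell2_fin x0.
  apply: (@ell2_fin _ N.+1) => -[//|k] Nk; rewrite jacobi_mulE !x0 ?mulr0 ?addr0//.
  + exact: leq_trans (leqnSn _) Nk.
  + exact: leq_trans (leqnSn _) (leq_trans Nk (leqnSn _)).
exists x => //; split=> n; rewrite /l2part big1 ?ltW// => k _.
  by rewrite subrr cmod0 expr0n.
by rewrite subrr cmod0 expr0n.
Qed.

Definition delta (m n : nat) : R[i] := (n == m)%:R.

(** Testing against the unit vector [delta m] recovers row m. Its image reaches row m+1, hence the
    sums over [m.+2] terms. *)
Lemma adjoint_max v w : l2adjoint (jacobi_min a b) (v, w) ->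
  [/\ ell2 v, ell2 w & forall n, w n = J v n].
Proof.
move=> [/= v2 w2 H]; split=> // m.
have x0 k : (m.+1 <= k)%N -> delta m k = 0 by rewrite /delta; case: eqP => // ->; rewrite ltnn.
have fx : fin (delta m) by apply/finP; exists m.+1.
have := H _ (jacobi_min_fin fx); rewrite /l2dot /=.
have fin_sum f : (forall k, (m.+2 <= k)%N -> f k = 0) -> csum f = \sum_(0 <= k < m.+2) f k.
  move=> f0; apply: csum_toE => e e0; exists m.+2 => n mn.
  rewrite (@big_cat_nat _ _ _ m.+2)//= [X in _ + X - _]big_nat.
  rewrite [X in _ + X - _]big1 => [|k /andP[mk _]]; last exact: f0.
  by rewrite addr0 subrr cmod0 ltW.
rewrite !fin_sum; last 2 first.
- by move=> k mk; rewrite x0 ?mul0r// ltnW.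
- move=> [//|k] mk; rewrite jacobi_mulE !x0 ?mulr0 ?addr0 ?mul0r//.
  + exact: ltnW.
  + by rewrite ltnW// ltnW.
move=> E.
have := @jacobi_lagrange_fin (delta m) (fun k => (v k)^*%C) m.+1 m.+2 x0 (ltnSn _).
rewrite sumrB E -sumrB.
have -> : \sum_(0 <= k < m.+2) (delta m k * (w k)^*%C - delta m k * J (fun k => (v k)^*%C) k) =
   (w m)^*%C - (J v m)^*%C.
  rewrite (bigD1_seq m) ?iota_uniq ?mem_index_iota ?ltnS ?leqnSn//=.
  rewrite big1 ?addr0 => [|k km]; rewrite jacobi_mulJ /delta; last first.
    by rewrite (negbTE km) !mul0r subrr.
  by rewrite eqxx !mul1r.
by move/eqP; rewrite subr_eq0 => /eqP /(inv_inj (@conjcK R)).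
Qed.

(** Each row involves only three entries, so convergence in the graph norm preserves the relation g
    = J u, and [max_adjoint] applies. *)
Lemma jacobi_min_sub_adjoint x : jacobi_min a b x -> l2adjoint (jacobi_min a b) x.
Proof.
case: x => u g /jacobi_min_approx[u2 g2 H]; apply: max_adjoint => // m.
apply/eqP; rewrite -subr_eq0; apply/eqP/cmod_eq0/eqP.
rewrite eq_le cmod_ge0 andbT; apply/ler_addgt0Pr => e e0; rewrite add0r.
pose K := 1 + `|b m| + `|a m| + `|b m.-1|.
have K0 : 0 < K by rewrite /K !ltr_wpDr.
pose d := e / K.
have d0 : 0 < d by rewrite divr_gt0.
have [x fx [h1 h2]] := H d d0.
have t1 k : cmod (u k - x k) <= d.
  rewrite -(@ler_pXn2r _ 2) ?nnegrE ?cmod_ge0 ?(ltW d0)//.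
  apply: le_trans (h1 k.+1).
  exact: (l2part_term (fun k => u k - x k) (ltnSn k)).
have t2 : cmod (g m - J x m) <= d.
  rewrite -(@ler_pXn2r _ 2) ?nnegrE ?cmod_ge0 ?(ltW d0)//.
  apply: le_trans (h2 m.+1).
  exact: (l2part_term (fun k => g k - J x k) (ltnSn m)).
have -> : g m - J u m = (g m - J x m) - J (fun k => u k - x k) m.
  by rewrite jacobi_mulB; cring.
have -> : e = d * K by rewrite /d mulfVK// gt_eqF.
apply: le_trans (cmodB _ _) _.
have dB c k : cmod (c%:C%C * (u k - x k)) <= d * `|c|.
  by rewrite cmodM cmod_real mulrC ler_wpM2r.
suff : cmod (J (fun k => u k - x k) m) <= d * (`|b m| + `|a m| + `|b m.-1|).
  by rewrite /K; lra.
case: (m) => [|m']; rewrite jacobi_mulE.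
  apply: le_trans (cmodD _ _) _; have := dB (b 0%N) 1%N; have := dB (a 0%N) 0%N.
  have : 0 <= d * `|b 0%N| by rewrite mulr_ge0// ltW.
  by rewrite /=; lra.
apply: le_trans (cmodD _ _) _; apply: le_trans (lerD (cmodD _ _) (lexx _)) _.
by have := dB (b m'.+1) m'.+2; have := dB (a m'.+1) m'.+1; have := dB (b m') m'; rewrite /=; lra.
Qed.

(** Both (p, 0) and (q, e0) lie in the adjoint. If the operator were self-adjoint, (p, 0) would lie
    in its graph, and symmetry would give 0 = <0, q> = <p, e0> = 1. *)
Lemma limit_circle_of_ell2 :
  ell2 (fun k => pol1 a b k 0) -> ell2 (fun k => pol2 a b k 0) -> limit_circle a b.
Proof.
move=> p2 q2 SA.
have e2 : ell2 (e0 R).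
  apply/ell2P; exists 1 => -[|n]; first by rewrite /l2part big_geq.
  rewrite /l2part big_nat_recl// -[e0 R 0]/1 cmod1 expr1n big1 ?addr0// => k _.
  by rewrite -[e0 R k.+1]/0 cmod0 expr0n.
have z2 : ell2 (fun _ : nat => 0 : R[i]).
  by apply/ell2P; exists 0 => n; rewrite /l2part big1// => k _; rewrite cmod0 expr0n.
have Pm : jacobi_min a b (fun k => pol1 a b k 0, fun=> 0).
  rewrite -SA; apply: max_adjoint => // n; by rewrite pol1_J// mul0r.
have : l2adjoint (jacobi_min a b) (fun k => pol2 a b k 0, e0 R).
  by apply: max_adjoint => // n; rewrite pol2_J// mul0r add0r.
move=> [/= _ _ /(_ _ Pm)] /=; rewrite /l2dot.
have -> : csum (fun k => 0 * (pol2 a b k 0)^*%C) = 0.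
  apply: csum_toE => e ep; exists 0%N => n _.
  by rewrite big1 ?subrr ?cmod0 ?ltW// => k _; rewrite mul0r.
have -> : csum (fun k => pol1 a b k 0 * (e0 R k)^*%C) = 1.
  apply: csum_toE => e ep; exists 1%N => -[//|n] _.
  rewrite big_nat_recl// big1 ?addr0 => [|k _].
    by rewrite -[e0 R 0]/1 rmorph1 mulr1 -[pol1 a b 0 0]/1 subrr cmod0 ltW.
  by rewrite -[e0 R k.+1]/0 rmorph0 mulr0.
by move/eqP; rewrite eq_sym oner_eq0.
Qed.

End MaximalOperator.

(** * Density of the range of J - i and self-adjointness *)

Section EssentialSelfAdjointness.
Variables (R : realType) (a b : nat -> R).
Hypothesis b_gt0 : forall n, 0 < b n.
Implicit Types (u v w g x : nat -> R[i]) (e : R).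
Local Notation J := (jacobi_mul a b).
Local Notation fin u := (\forall n \near \oo, u n = 0).
Local Notation I := (Complex 0 1 : R[i]).
Local Notation p := (fun k => pol1 a b k I).
Local Notation q := (fun k => pol2 a b k I).

Definition shifted u n : R[i] := J u n - I * u n.
Local Notation T := shifted.

Lemma shiftedB u v n : T (fun k => u k - v k) n = T u n - T v n.
Proof. by rewrite /T jacobi_mulB; cring. Qed.

Lemma shiftedZ c u n : T (fun k => c * u k) n = c * T u n.
Proof. by rewrite /T jacobi_mulZ; cring. Qed.

Lemma back_substitution N (y : nat -> R[i]) : exists u,
  (forall k, (N <= k)%N -> u k = 0) /\
  (forall k, (0 < k <= N)%N -> T u k = y k).
Proof.
suff H j : (j <= N)%N -> exists u, (forall k, (N <= k)%N -> u k = 0) /\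
    (forall k, (N - j < k <= N)%N -> T u k = y k).
  have [u [h1 h2]] := H N (leqnn N).
  by exists u; split => // k; rewrite -[X in (X < _)%N](subnn N); exact: h2.
elim: j => [_|j ih jN].
  exists (fun=> 0); split=> // k; rewrite subn0 => /andP[h1 h2].
  by have := leq_trans h1 h2; rewrite ltnn.
have [u [h1 h2]] := ih (ltnW jN).
pose m := (N - j.+1)%N.
have mj : (N - j = m.+1)%N by rewrite /m subnSK.
have mN : (m < N)%N by rewrite -mj leq_subr.
pose um := (y m.+1 - ((a m.+1)%:C%C - I) * u m.+1 - (b m.+1)%:C%C * u m.+2) / (b m)%:C%C.
exists (fun k => if k == m then um else u k); split=> [k Nk|k /andP[mk kN]].
  by rewrite gtn_eqF ?h1// (leq_trans mN).
case: k mk kN => // k; rewrite -/m ltnS leq_eqVlt => /predU1P[<-{k}|mk] kN.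
  rewrite /T jacobi_mulE eqxx !gtn_eqF// /um.
  have b0 := bC_neq0 b_gt0 m; cfield. exact: b0.
rewrite -(h2 k.+1) ?mj ?ltnS ?mk//.
by rewrite /T !jacobi_mulE !gtn_eqF// ltnW// ltnW.
Qed.

(** Forward recursion: on a fixed window, a sequence starting at 0 is controlled by its residual. It
    is applied to f - f_0 p, which has the same residual as f. *)
Lemma shifted_bound K : exists2 C, 0 <= C & forall u (d : R), 0 <= d -> u 0%N = 0 ->
  (forall j, cmod (T u j) <= d) -> forall j, (j <= K)%N -> cmod (u j) <= C * d.
Proof.
elim: K => [|K [C C0 HC]].
  exists 0 => // u d d0 u0 _ j; rewrite leqn0 => /eqP ->.
  by rewrite u0 cmod0 mul0r.
pose C' := (1 + cmod ((a K)%:C%C - I) * C + `|b K.-1| * C) / b K.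
have C'0 : 0 <= C'.
  by rewrite divr_ge0 ?(ltW (b_gt0 _))// !addr_ge0 ?mulr_ge0 ?cmod_ge0.
exists (C + C'); first by rewrite addr_ge0.
move=> u d d0 u0 Tu j; rewrite leq_eqVlt => /predU1P[->|]; last first.
  rewrite ltnS => jK; apply: le_trans (HC u d d0 u0 Tu j jK) _.
  by rewrite mulrDl lerDl mulr_ge0.
suff H : cmod (u K.+1) * b K <= (C' * d) * b K.
  rewrite mulrDl (le_trans _ (_ : C' * d <= _))// ?lerDr ?mulr_ge0//.
  by rewrite -(ler_pM2r (b_gt0 K)).
rewrite [leRHS]mulrAC /C' mulfVK ?gt_eqF//.
have uK := HC u d d0 u0 Tu K (leqnn K).
have uK1 := HC u d d0 u0 Tu K.-1 (leq_pred K).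
have -> : cmod (u K.+1) * b K = cmod ((b K)%:C%C * u K.+1).
  by rewrite cmodM cmod_real gtr0_norm// mulrC.
have E : (b K)%:C%C * u K.+1 = T u K - ((a K)%:C%C - I) * u K
     - (if K is m.+1 then (b m)%:C%C * u m else 0).
  by rewrite /T; case: (K) => [|k]; rewrite jacobi_mulE; cring.
rewrite E; apply: le_trans (cmodB _ _) _; apply: le_trans (lerD (cmodB _ _) (lexx _)) _.
have h1 : cmod (((a K)%:C%C - I) * u K) <= cmod ((a K)%:C%C - I) * (C * d).
  by rewrite cmodM ler_wpM2l ?cmod_ge0.
have h2 : cmod (if K is m.+1 then (b m)%:C%C * u m else 0) <= `|b K.-1| * (C * d).
  case: (K) uK1 => [|k] uK1; first by rewrite -[X in cmod X]/(0 : R[i]) cmod0 !mulr_ge0.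
  by rewrite cmodM cmod_real ler_wpM2l.
have := Tu K; lra.
Qed.

(** For a symmetric operator |(J - i) x|^2 = |J x|^2 + |x|^2, the cross term being the imaginary
    part of a vanishing boundary term. *)
Lemma shifted_fin x M : fin x -> (forall n, l2part (T x) n <= M) ->
  forall n, l2part x n <= M.
Proof.
move=> /finP[N x0] HM n.
pose m := (maxn n N).+1.
have nm : (n <= m)%N by rewrite /m ltnW// ltnS leq_maxl.
apply: le_trans (l2part_mono x nm) _; apply: le_trans (HM m).
have := @jacobi_lagrange_fin _ a b x (fun k => (x k)^*%C) N m x0.
rewrite /m ltnS leq_maxr -/m => /(_ isT) /(congr1 (@complex.Im R)).
rewrite Im_sum /= => L.
have E k : cmod (T x k) ^+ 2 = cmod (J x k) ^+ 2 + cmod (x k) ^+ 2 -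
   complex.Im (J x k * (x k)^*%C - x k * J (fun k => (x k)^*%C) k).
  rewrite jacobi_mulJ /T !cmod_sqr; case: (J x k) => s t; case: (x k) => c d /=.
  ring.
rewrite /l2part; under [leRHS]eq_bigr do rewrite E.
rewrite sumrB L subr0 big_split/= lerDr.
exact: l2part_ge0.
Qed.

(** Only multiples of conj(p) obstruct solving (J - i) x = g with x supported below N. Removing from
    g on [0, N] its projection onto conj(p) makes the system solvable, and the removed part has
    square norm |<g, conj(p)>|^2 / S with S the partial norm of p, which is small because S is
    unbounded. *)
Lemma approx_residual v : ell2 v -> ell2 (J v) -> ~ ell2 p ->
  forall e, 0 < e -> exists2 x, fin x &
    forall n, l2part (T (fun k => v k - x k)) n <= e.
Proof.
move=> v2 Jv2 p2 e e_gt0.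
pose g := T v.
have g2 : ell2 g by exact: (ell2D Jv2 (ell2N (ell2Z I v2))).
have e8 : 0 < e / 8 by rewrite divr_gt0.
have [K HK] := ell2_tail g2 e8.
pose c := cmod (\sum_(0 <= k < K) g k * p k).
(* N makes the pairing of p with the head of g negligible against the norm of p; beyond K,
   Cauchy-Schwarz and the small tail of g suffice. *)
have [N KN HN] : exists2 N, (K <= N)%N & 8 * c ^+ 2 / e + 1 <= l2part p N.+1.
  apply: contrapT => H; apply: p2; apply/ell2P.
  exists (8 * c ^+ 2 / e + 1) => n; apply/ltW; rewrite ltNge; apply/negP => h.
  apply: H; exists (maxn K n); first exact: leq_maxl.
  apply: le_trans h (l2part_mono _ _).
  by rewrite leqW// leq_maxr.
set S := l2part p N.+1 in HN.
have c20 : 0 <= 8 * c ^+ 2 / e by apply: divr_ge0 (ltW e_gt0); apply: mulr_ge0 (sqr_ge0 _).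
have S0 : 0 < S by apply: lt_le_trans HN; lra.
pose sgp := \sum_(0 <= k < N.+1) g k * p k.
pose l := sgp / S%:C%C.
pose y k := g k - l * (p k)^*%C.
have [u [u0 uy]] := back_substitution N y.
have SE : \sum_(0 <= k < N.+1) (p k)^*%C * p k = S%:C%C.
  under eq_bigr do rewrite mulrC mul_conjc.
  by rewrite /S /l2part real_sum.
(* The remaining row 0 holds automatically: T u and y both pair to 0 with p, they agree in rows 1 to
   N, and p_0 = 1. *)
have Tu0 : T u 0 = y 0%N.
  have H1 : \sum_(0 <= k < N.+1) T u k * p k = 0.
    rewrite -[RHS](@jacobi_lagrange_fin _ a b u p N N.+1 u0 (ltnSn _)).
    by apply: eq_bigr => k _; rewrite pol1_J// /T; cring.
  have H2 : \sum_(0 <= k < N.+1) y k * p k = 0.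
    under eq_bigr do rewrite /y mulrBl -mulrA.
    rewrite sumrB -mulr_sumr SE -/sgp /l mulfVK ?subrr//.
    by rewrite (inj_eq (@complexI R)) gt_eqF.
  have : \sum_(0 <= k < N.+1) (T u k - y k) * p k = 0.
    by rewrite sum_subMl H1 H2 subrr.
  rewrite big_nat_recl// big_nat [X in _ + X]big1 => [|k /andP[_ kN]].
    by rewrite /pol1 /= mulr1 addr0 => /eqP; rewrite subr_eq0 => /eqP.
  by rewrite uy// subrr mul0r.
exists u; first by apply/finP; exists N.
have Tlow k : (k <= N)%N -> T (fun k => v k - u k) k = l * (p k)^*%C.
  move=> kN; rewrite shiftedB -/g.
  have -> : T u k = y k by case: k kN => // k kN; rewrite uy.
  by rewrite /y /g; cring.
have Thigh k : (N < k)%N -> T (fun k => v k - u k) k = g k.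
  case: k => // k; rewrite ltnS => kN; rewrite shiftedB -/g /T jacobi_mulE !u0 ?subr0//.
  - by rewrite !mulr0 !addr0 subr0 subr0.
  - exact: leqW.
  - by rewrite leqW// leqW.
move=> n.
apply: le_trans (l2part_mono _ (leq_maxl n N.+1)) _.
rewrite /l2part (@big_cat_nat _ _ _ N.+1) ?leq_maxr//=.
have -> : \sum_(0 <= k < N.+1) cmod (T (fun k => v k - u k) k) ^+ 2 = cmod l ^+ 2 * S.
  rewrite /S -[RHS](l2partZ l) /l2part.
  by apply: eq_big_nat => k /andP[_ kN]; rewrite Tlow// !cmodM cmodJ.
have -> : \sum_(N.+1 <= k < maxn n N.+1) cmod (T (fun k => v k - u k) k) ^+ 2
   = \sum_(N.+1 <= k < maxn n N.+1) cmod (g k) ^+ 2.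
  by apply: eq_big_nat => k /andP[Nk _]; rewrite Thigh.
have tailN : \sum_(N.+1 <= k < maxn n N.+1) cmod (g k) ^+ 2 <= e / 8.
  apply: le_trans (HK (maxn n N.+1)).
  rewrite [leRHS](@big_cat_nat _ _ _ N.+1) ?leq_maxr ?leqW//=.
  by rewrite lerDr sumr_ge0// => k _; rewrite sqr_ge0.
suff : cmod l ^+ 2 * S <= e / 2 by move: tailN e_gt0; lra.
have sg : cmod sgp <= c + cmod (\sum_(K <= k < N.+1) g k * p k).
  by rewrite /sgp (@big_cat_nat _ _ _ K) ?leqW//=; exact: cmodD.
have sg2 : cmod (\sum_(K <= k < N.+1) g k * p k) ^+ 2 <= e / 8 * S.
  have h0 : cmod (\sum_(K <= k < N.+1) g k * p k) <= \sum_(K <= k < N.+1) cmod (g k) * cmod (p k).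
    by apply: le_trans (cmod_sum _ _ _) _; under eq_bigr do rewrite cmodM.
  apply: (@le_trans _ _ ((\sum_(K <= k < N.+1) cmod (g k) * cmod (p k)) ^+ 2)).
    by rewrite lerXn2r ?nnegrE ?cmod_ge0// (le_trans (cmod_ge0 _) h0).
  apply: le_trans (cauchy_schwarz _ _ _ _) _; apply: ler_pM.
  - by apply: sumr_ge0 => k _; rewrite sqr_ge0.
  - by apply: sumr_ge0 => k _; rewrite sqr_ge0.
  - exact: HK.
  - rewrite /S /l2part [leRHS](@big_cat_nat _ _ _ K) ?leqW//= lerDr.
    by apply: sumr_ge0 => k _; rewrite sqr_ge0.
rewrite /l cmodM cmodV cmod_real gtr0_norm// exprMn exprVn.
rewrite -(ler_pM2r S0).
have -> : cmod sgp ^+ 2 * S ^- 2 * S * S = cmod sgp ^+ 2.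
  by field; rewrite gt_eqF.
have h8 : 8 * c ^+ 2 <= e * S.
  have : 8 * c ^+ 2 / e <= S by move: HN; lra.
  by rewrite ler_pdivrMr// (mulrC e).
move: sg sg2 (cmod_ge0 sgp) (cmod_ge0 (\sum_(K <= k < N.+1) g k * p k)) (cmod_ge0 (\sum_(0 <= k < K) g k * p k)).
rewrite -/c; set t := cmod (\sum_(K <= k < _) _); set s := cmod sgp => sg sg2 s0 t0 c0.
have : s ^+ 2 <= (c + t) ^+ 2 by rewrite lerXn2r ?nnegrE// addr_ge0.
have : 0 <= (c - t) ^+ 2 by rewrite sqr_ge0.
nra.
Qed.

(** For (v, J v) in the adjoint take approximants x with small residual T (v - x). Their mutual
    distances are bounded by the residuals, so v - x is Cauchy; a limit would be an l^2 solution at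
    i, a multiple of p, hence 0. The limit is not constructed: [small] is its quantitative form on a
    window. *)
Lemma self_adjoint_of_pol1 : ~ ell2 p -> self_adjoint (jacobi_min a b).
Proof.
move=> p2; rewrite /self_adjoint; apply/seteqP; split; last first.
  by move=> x /jacobi_min_sub_adjoint; exact.
move=> -[v w] /adjoint_max[v2 w2 wJ].
have Jv2 : ell2 (J v) by rewrite -(_ : w = J v)//; apply/funext.
have A := approx_residual v2 Jv2 p2.
have diff_fin d1 d2 x1 x2 : fin x1 -> fin x2 ->
    (forall n, l2part (T (fun k => v k - x1 k)) n <= d1) ->
    (forall n, l2part (T (fun k => v k - x2 k)) n <= d2) ->
    forall n, l2part (fun k => (v k - x1 k) - (v k - x2 k)) n <= 2 * (d1 + d2).
  move=> /finP[N1 f1] /finP[N2 f2] h1 h2; apply: shifted_fin.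
    apply/finP; exists (maxn N1 N2) => n; rewrite geq_max => /andP[n1 n2].
    by rewrite f1// f2// subrr.
  move=> n; have -> : T (fun k => (v k - x1 k) - (v k - x2 k)) =
     (fun k => T (fun k => v k - x1 k) k + - T (fun k => v k - x2 k) k).
    by apply/funext => k; rewrite shiftedB.
  apply: le_trans (l2partD _ _ _) _; rewrite ler_wpM2l// lerD//.
  by rewrite l2partN.
have [x1 fx1 Tx1] := A 1 ltr01.
pose f1 k := v k - x1 k.
have [C1 C10 HC1] : exists2 C1, 0 <= C1 & forall n, l2part f1 n <= C1.
  have : ell2 f1.
    by apply: (ell2D v2); apply: ell2N; case/finP: fx1 => N h; exact: ell2_fin h.
  by move=> /l2part_bound[C C0 HC]; exists (C ^+ 2) => //; rewrite sqr_ge0.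
(* The residuals converge to 0 in l^2, so [v - x] is close to a multiple of
   the non-square-summable p; being bounded in l^2, it must be small. *)
have small K h : 0 < h -> h <= 8 -> exists2 d, 0 < d & forall x, fin x ->
    (forall n, l2part (T (fun k => v k - x k)) n <= d) ->
    l2part (fun k => v k - x k) K <= h.
  move=> h0 h1.
  pose PK := l2part p K.
  have PK0 : 0 <= PK by exact: l2part_ge0.
  pose Cb := 2 * (C1 + 2 * 2).
  (* The mass of p on [0, L) is so large that the bound Cb on the norm of f forces |f_0|^2 (PK + 1)
     <= h / 4. *)
  have [L PL] : exists L, 8 * (Cb + 1) * (PK + 1) / h <= l2part p L.
    apply: contrapT => H; apply: p2; apply/ell2P.
    exists (8 * (Cb + 1) * (PK + 1) / h) => n; apply/ltW; rewrite ltNge; apply/negP => hh.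
    by apply: H; exists n.
  have [C C0 HC] := shifted_bound (maxn K L).
  pose M : R := 1 + C ^+ 2 * (maxn K L)%:R.
  have M0 : 0 < M by rewrite /M ltr_wpDr// mulr_ge0// sqr_ge0.
  pose d := Num.min 1 (h / (8 * M)).
  have d0 : 0 < d by rewrite lt_min ltr01/= divr_gt0// mulr_gt0.
  exists d => // x fx Tx.
  pose f k := v k - x k.
  have hp : f 0%N - f 0%N * p 0%N = 0 by rewrite /pol1 /= mulr1 subrr.
  have Th j : cmod (T (fun k => f k - f 0%N * p k) j) <= Num.sqrt d.
    rewrite shiftedB shiftedZ {2}/T pol1_J// subrr mulr0 subr0.
    rewrite -(@ler_pXn2r _ 2) ?nnegrE ?cmod_ge0 ?sqrtr_ge0// sqr_sqrtr ?(ltW d0)//.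
    apply: le_trans (Tx j.+1).
    exact: (l2part_term (T f) (ltnSn j)).
  have part_h m : (m <= maxn K L)%N ->
      l2part (fun k => f k - f 0%N * p k) m <= d * M.
    move=> mKL; apply: (@le_trans _ _ (\sum_(0 <= k < m) (C ^+ 2 * d))).
      rewrite /l2part big_nat [leRHS]big_nat; apply: ler_sum => k /andP[_ km].
      have hk := HC _ _ (sqrtr_ge0 d) hp Th k (leq_trans (ltnW km) mKL).
      have -> : C ^+ 2 * d = (C * Num.sqrt d) ^+ 2 by rewrite exprMn sqr_sqrtr// ltW.
      by rewrite lerXn2r ?nnegrE ?cmod_ge0 ?mulr_ge0 ?sqrtr_ge0.
    rewrite sumr_const_nat subn0 -[leLHS]mulr_natl.
    have : m%:R <= (maxn K L)%:R :> R by rewrite ler_nat.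
    have : 0 <= C ^+ 2 * d by rewrite mulr_ge0 ?sqr_ge0 ?ltW.
    rewrite /M; move: d0; nra.
  have dM : d * M <= h / 8.
    have : d <= h / (8 * M) by rewrite ge_min lexx orbT.
    by rewrite ler_pdivlMr ?mulr_gt0//; lra.
  have fb m : l2part f m <= Cb.
    have -> : l2part f m = l2part (fun k => f1 k + - (f1 k - f k)) m.
      by apply: eq_bigr => k _; congr (cmod _ ^+ 2); rewrite opprB addrC subrK.
    apply: le_trans (l2partD _ _ _) _; rewrite l2partN /Cb ler_wpM2l// lerD//.
    apply: le_trans (diff_fin _ _ _ _ fx1 fx Tx1 Tx m) _.
    have : d <= 1 by rewrite ge_min lexx.
    lra.
  have f0p m : (m <= maxn K L)%N -> cmod (f 0%N) ^+ 2 * l2part p m <= 2 * (l2part f m + h / 8).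
    move=> mKL; rewrite -l2partZ.
    have -> : l2part (fun k => f 0%N * p k) m =
       l2part (fun k => f k + - (f k - f 0%N * p k)) m.
      by apply: eq_bigr => k _; congr (cmod _ ^+ 2); rewrite opprB addrC subrK.
    apply: le_trans (l2partD _ _ _) _; rewrite l2partN ler_wpM2l// lerD//.
    exact: le_trans (part_h _ mKL) dM.
  have fK : l2part f K <= 2 * (cmod (f 0%N) ^+ 2 * PK + h / 8).
    have -> : l2part f K = l2part (fun k => f 0%N * p k + (f k - f 0%N * p k)) K.
      by apply: eq_bigr => k _; congr (cmod _ ^+ 2); rewrite addrC subrK.
    apply: le_trans (l2partD _ _ _) _; rewrite l2partZ ler_wpM2l// lerD//.
    exact: le_trans (part_h _ (leq_maxl _ _)) dM.
  apply: le_trans fK _.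
  have := f0p L (leq_maxr _ _); have := fb L; move: PL.
  rewrite ler_pdivrMr//.
  have := l2part_ge0 p L; have := sqr_ge0 (cmod (f 0%N)).
  set F := cmod (f 0%N) ^+ 2; set Q := l2part p L; set G := l2part f L => F0 Q0 PL Gb FQ.
  have Cb0 : 0 <= Cb by rewrite /Cb; lra.
  have FQ' : F * Q <= 2 * (Cb + h / 8) by lra.
  have k1 : F * (8 * (Cb + 1) * (PK + 1)) <= F * (Q * h) by rewrite ler_wpM2l.
  have k2 : F * Q * h <= 2 * (Cb + h / 8) * h by rewrite ler_wpM2r// ltW.
  have k3 : 2 * (Cb + h / 8) * h <= 2 * (Cb + 1) * h.
    by rewrite ler_wpM2r ?(ltW h0)// ler_wpM2l// lerD2l; lra.
  have k4 : (Cb + 1) * (8 * F * (PK + 1)) <= (Cb + 1) * (2 * h) by lra.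
  rewrite ler_pM2l in k4; last by lra.
  lra.
apply: jacobi_minI => // e e0.
pose d := e / 32.
have d0 : 0 < d by rewrite divr_gt0.
have [x fx Tx] := A d d0; exists x => //.
(* Only the auxiliary x' depends on the window n. Its l^2 distance to the fixed x is bounded by the
   residuals, so the estimate for x is uniform in n. *)
have fe n : l2part (fun k => v k - x k) n <= e / 3.
  pose h := Num.min d 8; have hd : h <= d by rewrite ge_min lexx.
  have [||d' d'0 Hd'] := small n h; first by rewrite lt_min d0/=.
    by rewrite ge_min lexx orbT.
  have dd0 : 0 < Num.min d d' by rewrite lt_min d0.
  have [x' fx' Tx'] := A _ dd0.
  have h1 := diff_fin _ _ _ _ fx fx' Tx Tx' n.
  have h2 : l2part (fun k => v k - x' k) n <= d.
    apply: le_trans hd; apply: Hd' => // m; apply: le_trans (Tx' m) _.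
    by rewrite ge_min lexx orbT.
  rewrite (@eq_l2part _ _ (fun k => ((v k - x k) - (v k - x' k)) + (v k - x' k))); last first.
    by move=> k; rewrite subrK.
  apply: le_trans (l2partD _ _ _) _.
  have : Num.min d d' <= d by rewrite ge_min lexx.
  rewrite /d in h1 h2 *; lra.
split=> n; first by apply: le_trans (fe n) _; lra.
rewrite (@eq_l2part _ _ (fun k => T (fun k => v k - x k) k + I * (v k - x k))); last first.
  by move=> k; rewrite wJ /T jacobi_mulB subrK.
apply: le_trans (l2partD _ _ _) _; rewrite l2partZ.
have -> : cmod I = 1 by rewrite /cmod /= expr0n/= add0r expr1n sqrtr1.
have := Tx n; have := fe n; rewrite expr1n mul1r /d; lra.
Qed.

End EssentialSelfAdjointness.

(** * The limit circle case in terms of the solutions at 0 *)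

Section LimitCircle.
Variables (R : realType) (a b : nat -> R).
Hypothesis b_gt0 : forall n, 0 < b n.
Local Notation J := (jacobi_mul a b).
Local Notation I := (Complex 0 1 : R[i]).

(** Orthogonal polynomials have real zeros only: at a zero the boundary term of Green's identity
    would vanish, while the sum of squares is at least 1. *)
Lemma pol1_neq0 n : pol1 a b n.+1 I != 0.
Proof.
apply/eqP => p0; have := pol1_green a b_gt0 I n; rewrite p0 mulr0 /= mulr0 mul1r.
apply/eqP; rewrite gt_eqF//.
apply: lt_le_trans (l2part_term (fun k => pol1 a b k I) (ltn0Sn n)).
by rewrite -[pol1 a b 0 I]/1 cmod1 expr1n.
Qed.

(* Weyl's argument: the solution q + m p with a zero at n+1 has |m| <= 1. *)
Lemma weyl : ell2 (fun k => pol1 a b k I) -> ell2 (fun k => pol2 a b k I).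
Proof.
move=> /ell2P[M HM]; apply/ell2P; exists (2 * (1 + M)) => n.
have M0 : 0 <= M by apply: le_trans (HM 0%N); exact: l2part_ge0.
apply: le_trans (l2part_mono _ (leqnSn n)) _.
pose p k := pol1 a b k I; pose q k := pol2 a b k I.
pose m := - (q n.+1 / p n.+1).
pose f k := q k + m * p k.
have f1 : f n.+1 = 0.
  by rewrite /f /m mulNr mulfVK ?subrr// pol1_neq0.
have f0 : f 0%N = m by rewrite /f /q /p /pol2 /pol1 /= mulr1 add0r.
have Jf k : J f k = I * f k + 1 * e0 R k.
  rewrite jacobi_mulD jacobi_mulZ pol1_J// pol2_J// /f /q /p; cring.
have := green n Jf; rewrite f1 f0 mulr0 mul1r /= mulr0 mul1r => /eqP.
rewrite addr_eq0 => /eqP S.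
have {}S : l2part f n.+1 <= cmod m.
  rewrite S; apply: le_trans (le_Im_cmod m); case: (m) => x y /=.
  by rewrite opprK ler_norm.
have m1 : cmod m <= 1.
  have : cmod m ^+ 2 <= cmod m.
    by rewrite -{1}f0; apply: le_trans S; exact: (l2part_term f (ltn0Sn n)).
  rewrite leNgt => h; rewrite leNgt; apply: contra h => h; nra.
rewrite (@eq_l2part _ _ (fun k => f k + - (m * p k))); last first.
  by move=> k; rewrite /f addrK.
apply: le_trans (l2partD _ _ _) _; rewrite l2partN l2partZ ler_wpM2l// lerD//.
  exact: le_trans S m1.
have := HM n.+1; have := l2part_ge0 p n.+1; have := cmod_ge0 m; rewrite -/p => h0 h1 h2.
by rewrite -[M]mul1r ler_pM ?sqr_ge0// exprn_ile1.
Qed.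

(** The point i serves the operator theory; transferring to 0 gives real solutions, on which all
    asymptotic estimates are made. *)
Lemma limit_circleP : limit_circle a b <->
  ell2 (fun k => pol1 a b k 0) /\ ell2 (fun k => pol2 a b k 0).
Proof.
split=> [lc|[]]; last exact: limit_circle_of_ell2.
have p2 : ell2 (fun k => pol1 a b k I).
  by apply: contrapT => /(self_adjoint_of_pol1 b_gt0).
have q2 := weyl p2.
split.
  apply: (@ell2_transfer _ a b I 0 0) => // k; by rewrite pol1_J// !mul0r addr0.
apply: (@ell2_transfer _ a b I 0 1) => // k; by rewrite pol2_J// mul1r.
Qed.

End LimitCircle.

Section RealSolutions.
Variables (R : realType) (a b : nat -> R).
Hypothesis b_gt0 : forall n, 0 < b n.

Definition recurrence (u : nat -> R) := forall n,
  b n.+1 * u n.+2 + a n.+1 * u n.+1 + b n * u n = 0.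

Definition rpol1 n : R := complex.Re (pol1 a b n 0).
Definition rpol2 n : R := complex.Re (pol2 a b n 0).

Let jacobi_sol_real (x y : R) n :
  complex.Im (jacobi_sol a b 0 x%:C%C y%:C%C n) = 0.
Proof.
suff : complex.Im (jacobi_sol a b 0 x%:C%C y%:C%C n) = 0 /\
       complex.Im (jacobi_sol a b 0 x%:C%C y%:C%C n.+1) = 0 by case.
elim: n => [//|n [h0 h1]]; split => //.
rewrite jacobi_solSS -fmorphV; move: h0 h1.
move: (jacobi_sol a b 0 x%:C%C y%:C%C n.+1) (jacobi_sol a b 0 x%:C%C y%:C%C n).
move=> [s t] [s' t'] /= -> ->.
by ring.
Qed.

Lemma pol1_real n : pol1 a b n 0 = (rpol1 n)%:C%C.
Proof.
rewrite /rpol1 /pol1 -[1](rmorph1 (real_complex R)) sub0r -rmorphN -fmorphV -rmorphM.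
have := jacobi_sol_real 1 (- a 0%N * (b 0%N)^-1) n.
by case: (jacobi_sol _ _ _ _ _ n) => s t /= ->.
Qed.

Lemma pol2_real n : pol2 a b n 0 = (rpol2 n)%:C%C.
Proof.
rewrite /rpol2 /pol2 -fmorphV.
have := jacobi_sol_real 0 (b 0%N)^-1 n.
by case: (jacobi_sol _ _ _ _ _ n) => s t /= ->.
Qed.

Lemma recurrence_rpol1 : recurrence rpol1.
Proof.
move=> n; apply: complexI; have := pol1_J a b_gt0 0 n.+1.
by rewrite mul0r jacobi_mulE !pol1_real !rmorphD !rmorphM.
Qed.

Lemma recurrence_rpol2 : recurrence rpol2.
Proof.
move=> n; apply: complexI; have := pol2_J a b_gt0 0 n.+1.
by rewrite mul0r addr0 jacobi_mulE !pol2_real !rmorphD !rmorphM.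
Qed.

Lemma rpol_wronskian n :
  b n * (rpol1 n * rpol2 n.+1 - rpol1 n.+1 * rpol2 n) = 1.
Proof.
apply: complexI; rewrite -[RHS](pol_wronskian a b_gt0 0 n) !pol1_real !pol2_real.
by rewrite !(rmorphM, rmorphB).
Qed.

Lemma recurrence_basis u : recurrence u ->
  exists c d, forall n, u n = c * rpol1 n + d * rpol2 n.
Proof.
move=> ru; pose c := u 0%N; pose d := b 0%N * (u 1%N - c * rpol1 1).
exists c, d => n.
suff : u n = c * rpol1 n + d * rpol2 n /\ u n.+1 = c * rpol1 n.+1 + d * rpol2 n.+1 by case.
elim: n => [|n [h0 h1]].
  have b0 := lt0r_neq0 (b_gt0 0).
  have -> : rpol2 1 = (b 0%N)^-1.
    by rewrite /rpol2 -[pol2 a b 1 0]/((b 0%N)%:C%C^-1) -fmorphV.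
  by rewrite /d /c /rpol1 /rpol2 /pol1 /pol2 /=; split; [ring|field].
split=> //; apply: (mulfI (lt0r_neq0 (b_gt0 n.+1))).
have := ru n; have /(congr1 ( *%R c)) := recurrence_rpol1 n.
have /(congr1 ( *%R d)) := recurrence_rpol2 n; rewrite h0 h1 !mulr0.
lra.
Qed.

Definition rsummable (u : nat -> R) := exists M, forall n, \sum_(0 <= k < n) u k ^+ 2 <= M.

Lemma ell2_pol1 : ell2 (fun k => pol1 a b k 0) <-> rsummable rpol1.
Proof.
have E n : l2part (fun k => pol1 a b k 0) n = \sum_(0 <= k < n) rpol1 k ^+ 2.
  by apply: eq_bigr => k _; rewrite pol1_real cmod_real real_normK// num_real.
by rewrite ell2P; split=> -[M HM]; exists M => n; rewrite -?E// E.
Qed.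

Lemma ell2_pol2 : ell2 (fun k => pol2 a b k 0) <-> rsummable rpol2.
Proof.
have E n : l2part (fun k => pol2 a b k 0) n = \sum_(0 <= k < n) rpol2 k ^+ 2.
  by apply: eq_bigr => k _; rewrite pol2_real cmod_real real_normK// num_real.
by rewrite ell2P; split=> -[M HM]; exists M => n; rewrite -?E// E.
Qed.

Lemma rsummable_comb (u v : nat -> R) c d : rsummable u -> rsummable v ->
  rsummable (fun n => c * u n + d * v n).
Proof.
move=> [M HM] [M' HM']; exists (2 * c ^+ 2 * M + 2 * d ^+ 2 * M') => n.
apply: (@le_trans _ _ (\sum_(0 <= k < n) (2 * c ^+ 2 * u k ^+ 2 + 2 * d ^+ 2 * v k ^+ 2))).
  apply: ler_sum => k _; have : 0 <= (c * u k - d * v k) ^+ 2 by rewrite sqr_ge0.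
  by rewrite sqrrB sqrrD !exprMn; lra.
by rewrite big_split/= -!mulr_sumr lerD// ler_wpM2l// mulr_ge0// sqr_ge0.
Qed.

Lemma limit_circle_real :
  limit_circle a b <-> forall u, recurrence u -> rsummable u.
Proof.
rewrite limit_circleP// ell2_pol1 ell2_pol2; split=> [[p2 q2] u|H].
  move=> /recurrence_basis[c [d E]]; rewrite (funext E); exact: rsummable_comb.
by split; apply: H; [exact: recurrence_rpol1|exact: recurrence_rpol2].
Qed.

End RealSolutions.

(** * Asymptotic expansions in powers of 1/n *)

Section PowerTaylor.
Variable R : realType.
Implicit Types (g x C : R).

(** The mean value theorem raises a bound on the derivative by one order; three applications to
    powers of x = 1 + c/n give the expansions below. *)
Lemma taylor_step (f df : R -> R) C (k : nat) : f 1 = 0 ->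
  (forall x, 1 <= x <= 2 -> is_derive x 1 f (df x)) ->
  (forall x, 1 <= x <= 2 -> `|df x| <= C * (x - 1) ^+ k) ->
  forall x, 1 <= x <= 2 -> `|f x| <= C * (x - 1) ^+ k.+1.
Proof.
move=> f1 fdf dfC x /andP[x1 x2].
have C0 : 0 <= C.
  have := dfC 2; rewrite (_ : 2 - 1 = 1 :> R) ?expr1n ?mulr1; last by ring.
  by move=> h; apply: le_trans (h _); rewrite ?normr_ge0// lexx andbT; lra.
have [|y|c] := @MVT_segment _ f df 1 x x1.
- by move=> y; rewrite in_itv/= => /andP[y1 yx]; apply: fdf; lra.
- apply: derivable_within_continuous => z; rewrite in_itv/= => /andP[z1 zx].
  by apply: ex_derive; apply: fdf; lra.
rewrite in_itv/= f1 subr0 => /andP[c1 cx] ->.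
rewrite normrM exprSr mulrA [X in _ * X <= _]ger0_norm ?subr_ge0// ler_wpM2r ?subr_ge0//.
have c12 : 1 <= c <= 2 by lra.
apply: le_trans (dfC c c12) _; rewrite ler_wpM2l// lerXn2r ?nnegrE; lra.
Qed.

Lemma powR_taylor0 g : exists2 C, 0 <= C & forall x, 1 <= x <= 2 -> x `^ g <= C.
Proof.
exists (2 `^ `|g|); first exact: powR_ge0.
move=> x /andP[x1 x2]; apply: (@le_trans _ _ (x `^ `|g|)).
  by apply: ler_powR => //; exact: ler_norm.
by rewrite ge0_ler_powR// nnegrE; lra.
Qed.

Let dpow g x : 1 <= x <= 2 -> is_derive x 1 (fun x : R => x `^ g) (g * x `^ (g - 1)).
Proof. by move=> /andP[x1 _]; apply: is_derive1_powR; lra. Qed.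

Lemma powR_taylor1 g : exists2 C, 0 <= C & forall x, 1 <= x <= 2 ->
  `|x `^ g - 1| <= C * (x - 1).
Proof.
have [C C0 HC] := powR_taylor0 (g - 1).
exists (`|g| * C); first by rewrite mulr_ge0.
move=> x hx; rewrite -[x - 1 in leRHS]expr1.
apply: (@taylor_step (fun x => x `^ g - 1) (fun x => g * x `^ (g - 1) - 0)) => //.
- by rewrite powR1 subrr.
- by move=> y hy; have := dpow g hy => d; apply: is_deriveB.
- move=> y hy; rewrite subr0 expr0 mulr1 normrM ler_wpM2l//.
  by rewrite ger0_norm ?powR_ge0// HC.
Qed.

Lemma powR_taylor2 g : exists2 C, 0 <= C & forall x, 1 <= x <= 2 ->
  `|x `^ g - 1 - g * (x - 1)| <= C * (x - 1) ^+ 2.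
Proof.
have [C C0 HC] := powR_taylor1 (g - 1).
exists (`|g| * C); first by rewrite mulr_ge0.
move=> x hx.
apply: (@taylor_step (fun x => x `^ g - 1 - g * (x - 1))
  (fun x => g * x `^ (g - 1) - 0 - g * 1)) => //.
- by rewrite powR1 !subrr mulr0 subr0.
- move=> y hy; have := dpow g hy => d.
  apply: is_deriveB; apply: is_deriveZ.
  rewrite -[X in is_derive _ _ _ X]subr0; exact: is_deriveB.
- move=> y hy; rewrite subr0 -mulrBr normrM expr1 -mulrA ler_wpM2l//.
  exact: HC.
Qed.

Lemma powR_taylor3 g : exists2 C, 0 <= C & forall x, 1 <= x <= 2 ->
  `|x `^ g - 1 - g * (x - 1) - g * (g - 1) / 2 * (x - 1) ^+ 2| <= C * (x - 1) ^+ 3.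
Proof.
have [C C0 HC] := powR_taylor2 (g - 1).
exists (`|g| * C); first by rewrite mulr_ge0.
move=> x hx.
apply: (@taylor_step (fun x => x `^ g - 1 - g * (x - 1) - g * (g - 1) / 2 * (x - 1) ^+ 2)
  (fun x => g * x `^ (g - 1) - 0 - g * 1 - g * (g - 1) / 2 * (2 * (x - 1)))) => //.
- by rewrite powR1 !subrr !mulr0 expr0n/= mulr0 !subr0.
- move=> y hy; have := dpow g hy => d.
  have dB : is_derive y 1 (fun x : R => x - 1) 1.
    rewrite -[X in is_derive _ _ _ X]subr0; exact: is_deriveB.
  apply: is_deriveB; last first.
    apply: is_deriveZ.
    apply: (is_derive_eq (is_deriveM dB dB)).
    by rewrite /GRing.scale /= mulr1; ring.
- move=> y hy; rewrite -[in leRHS]mulrA.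
  have -> : g * y `^ (g - 1) - 0 - g * 1 - g * (g - 1) / 2 * (2 * (y - 1))
    = g * (y `^ (g - 1) - 1 - (g - 1) * (y - 1)) by field.
  by rewrite normrM ler_wpM2l// HC.
Qed.

End PowerTaylor.

Section PowerOrder.
Variable R : realType.
Implicit Types (f g : nat -> R) (e : R).

Definition OO e f := exists C, 0 <= C /\ exists N : nat,
  forall n, (N <= n)%N -> `|f n| <= C * n%:R `^ (- e).

Lemma natr_powD n (x y : R) : (0 < n)%N -> n%:R `^ (x + y) = n%:R `^ x * n%:R `^ y :> R.
Proof. by move=> n0; rewrite powRD// pnatr_eq0 -lt0n n0 implybT. Qed.

Lemma natr_pow_gt0 n (x : R) : (0 < n)%N -> 0 < n%:R `^ x :> R.
Proof. by move=> n0; rewrite powR_gt0// ltr0n. Qed.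

Lemma natr_powN1 n : n%:R `^ (- 1) = n%:R^-1 :> R.
Proof. by rewrite powR_inv1. Qed.

Lemma natr_pow_le n (x y : R) : (0 < n)%N -> x <= y -> n%:R `^ x <= n%:R `^ y :> R.
Proof. by move=> n0 xy; rewrite ler_powR// ler1n. Qed.

Lemma natr_pow_large e (M : R) : 0 < e ->
  exists N : nat, forall n, (N <= n)%N -> M <= n%:R `^ e.
Proof.
move=> e0; pose A := (`|M| + 1) `^ e^-1.
have A0 : 0 < A by rewrite powR_gt0// ltr_wpDl.
exists (Num.bound A) => n Nn.
apply: (@le_trans _ _ (A `^ e)).
  rewrite /A -powRrM mulVf ?gt_eqF// powRr1 ?addr_ge0//.
  by have := ler_norm M; lra.
rewrite ge0_ler_powR ?nnegrE ?(ltW e0) ?(ltW A0)//.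
apply: le_trans (ltW (archi_boundP (ltW A0))) _.
by rewrite ler_nat.
Qed.

Lemma OO_le e e' f : e' <= e -> OO e f -> OO e' f.
Proof.
move=> ee [C [C0 [N HN]]]; exists C; split=> //; exists N.+1 => n Nn.
apply: le_trans (HN n (ltnW Nn)) _; rewrite ler_wpM2l// natr_pow_le ?lerN2//.
exact: leq_ltn_trans Nn.
Qed.

Lemma OOD e f g : OO e f -> OO e g -> OO e (fun n => f n + g n).
Proof.
move=> [C [C0 [N HN]]] [D [D0 [M HM]]]; exists (C + D); split; first exact: addr_ge0.
exists (maxn N M) => n; rewrite geq_max => /andP[Nn Mn].
by rewrite mulrDl; apply: le_trans (ler_normD _ _) (lerD (HN n Nn) (HM n Mn)).
Qed.

Lemma OON e f : OO e f -> OO e (fun n => - f n).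
Proof.
by move=> [C [C0 [N HN]]]; exists C; split=> //; exists N => n /HN; rewrite normrN.
Qed.

Lemma OOB e f g : OO e f -> OO e g -> OO e (fun n => f n - g n).
Proof. by move=> h k; apply: OOD h (OON k). Qed.

Lemma OOM e e' f g : OO e f -> OO e' g -> OO (e + e') (fun n => f n * g n).
Proof.
move=> [C [C0 [N HN]]] [D [D0 [M HM]]]; exists (C * D); split; first exact: mulr_ge0.
exists (maxn N M).+1 => n; rewrite gtn_max => /andP[Nn Mn].
have n0 : (0 < n)%N by exact: leq_ltn_trans Nn.
rewrite normrM opprD natr_powD// mulrACA.
by apply: ler_pM => //; [exact: HN (ltnW Nn)|exact: HM (ltnW Mn)].
Qed.

Lemma OOMl e f g : OO e f -> OO 0 g -> OO e (fun n => f n * g n).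
Proof. by move=> h k; have := OOM h k; rewrite addr0. Qed.

Lemma OOMr e f g : OO 0 f -> OO e g -> OO e (fun n => f n * g n).
Proof. by move=> h k; have := OOM h k; rewrite add0r. Qed.

Lemma OO_const c : OO 0 (fun=> c).
Proof. by exists `|c|; split=> //; exists 0%N => n _; rewrite oppr0 powRr0 mulr1. Qed.

Lemma OOZ e c f : OO e f -> OO e (fun n => c * f n).
Proof. exact: OOMr (OO_const c). Qed.

Lemma OO_pow e : OO e (fun n => n%:R `^ (- e)).
Proof.
by exists 1; split=> //; exists 0%N => n _; rewrite mul1r ger0_norm// powR_ge0.
Qed.

Lemma OO_inv : OO 1 (fun n => n%:R^-1).
Proof.
by exists 1; split=> //; exists 0%N => n _; rewrite mul1r ger0_norm ?invr_ge0// powR_inv1.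
Qed.

Lemma OO_near e f g : (exists N, forall n, (N <= n)%N -> f n = g n) -> OO e f -> OO e g.
Proof.
move=> [M HM] [C [C0 [N HN]]]; exists C; split=> //; exists (maxn N M) => n.
by rewrite geq_max => /andP[Nn Mn]; rewrite -HM// HN.
Qed.

Lemma OO_ext e f g : (forall n, (0 < n)%N -> f n = g n) -> OO e f -> OO e g.
Proof. by move=> fg; apply: OO_near; exists 1%N. Qed.

Lemma OO_shift e f : 0 <= e -> OO e f -> OO e (fun n => f n.+1).
Proof.
move=> e0 [C [C0 [N HN]]]; exists C; split=> //; exists N.+1 => n Nn.
apply: le_trans (HN n.+1 (leqW (ltnW Nn))) _; rewrite ler_wpM2l//.
have n0 : (0 < n)%N by exact: leq_ltn_trans Nn.
rewrite !powRN lef_pV2 ?posrE ?natr_pow_gt0//.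
by rewrite ge0_ler_powR ?nnegrE// ler_nat.
Qed.

Lemma OO_lt e e' f (eta : R) : e' < e -> 0 < eta -> OO e f ->
  exists N : nat, forall n, (N <= n)%N -> `|f n| <= eta * n%:R `^ (- e').
Proof.
move=> ee eta0 [C [C0 [N HN]]].
have [M HM] := @natr_pow_large (e - e') (C / eta) (ltac:(by rewrite subr_gt0)).
exists (maxn N M).+1 => n; rewrite gtn_max => /andP[Nn Mn].
have n0 : (0 < n)%N by exact: leq_ltn_trans Nn.
apply: le_trans (HN n (ltnW Nn)) _.
have -> : - e' = (e - e') + - e by ring.
rewrite natr_powD// mulrA ler_wpM2r ?powR_ge0//.
by have := HM n (ltnW Mn); rewrite ler_pdivrMr// mulrC.
Qed.

Lemma OO_small e f (eta : R) : 0 < e -> 0 < eta -> OO e f ->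
  exists N : nat, forall n, (N <= n)%N -> `|f n| <= eta.
Proof.
move=> e0 eta0 h; have [N HN] := OO_lt e0 eta0 h; exists N => n Nn.
by have := HN n Nn; rewrite oppr0 powRr0 mulr1.
Qed.

Lemma OO0_inv f (k : R) : 0 < k ->
  (exists N : nat, forall n, (N <= n)%N -> k <= `|f n|) -> OO 0 (fun n => (f n)^-1).
Proof.
move=> k0 [N HN]; exists k^-1; split; first by rewrite invr_ge0 ltW.
exists N => n Nn; rewrite oppr0 powRr0 mulr1 normfV lef_pV2 ?posrE ?HN//.
exact: lt_le_trans k0 (HN n Nn).
Qed.

End PowerOrder.

(** * Arithmetic of expansions up to second order *)

Section Expansion.
Variables (R : realType) (e : R).
Hypothesis e_gt0 : 0 < e.
Hypothesis e_le3 : e <= 3.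
Implicit Types (f g : nat -> R).
Local Notation t n := (n%:R^-1 : R).

(** Three coefficients are what the hypotheses provide and what eta consumes; e <= 3 makes the cubic
    terms of products part of the remainder. For e <= 2 or e <= 1 the last one or two coefficients
    carry no information and may be replaced, as in [xp_weaken2] and [xp_weaken1]. *)
Definition xp f (p0 p1 p2 : R) :=
  OO e (fun n => f n - (p0 + p1 * t n + p2 * t n ^+ 2)).

Lemma OO_inv3 : OO e (fun n => t n ^+ 3).
Proof.
apply: (OO_le e_le3); apply: (@OO_ext _ _ (fun n => t n * (t n * t n))) => [n _|].
  by ring.
rewrite (_ : 3 = 1 + (1 + 1)); last by ring.
apply: OOM (OO_inv R) (OOM (OO_inv R) (OO_inv R)).
Qed.

Lemma OO_inv0 : OO 0 (fun n => t n).
Proof. by apply: OO_le (OO_inv R); exact: ler01. Qed.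

Lemma xp_poly (p0 p1 p2 : R) : xp (fun n => p0 + p1 * t n + p2 * t n ^+ 2) p0 p1 p2.
Proof.
apply: (@OO_ext _ _ (fun n => 0 * t n ^+ 3)) => [n _|]; first by rewrite mul0r subrr.
exact: OOZ OO_inv3.
Qed.

Lemma xp_eq f (p0 p1 p2 q0 q1 q2 : R) : q0 = p0 -> q1 = p1 -> q2 = p2 ->
  xp f q0 q1 q2 -> xp f p0 p1 p2.
Proof. by move=> -> -> ->. Qed.

Lemma xp_const c : xp (fun=> c) c 0 0.
Proof.
by apply: OO_ext (xp_poly c 0 0) => n _ /=; rewrite !mul0r !addr0.
Qed.

Lemma xp_inv : xp (fun n => t n) 0 1 0.
Proof. by apply: OO_ext (xp_poly 0 1 0) => n _ /=; rewrite mul0r mul1r !addr0 add0r. Qed.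

Lemma xp_near f g p0 p1 p2 : (exists N, forall n, (N <= n)%N -> f n = g n) ->
  xp f p0 p1 p2 -> xp g p0 p1 p2.
Proof. by move=> [N HN]; apply: OO_near; exists N => n /HN ->. Qed.

Lemma xp_ext f g p0 p1 p2 : (forall n, (0 < n)%N -> f n = g n) ->
  xp f p0 p1 p2 -> xp g p0 p1 p2.
Proof. by move=> fg; apply: xp_near; exists 1%N. Qed.

Lemma xpD f g p0 p1 p2 q0 q1 q2 : xp f p0 p1 p2 -> xp g q0 q1 q2 ->
  xp (fun n => f n + g n) (p0 + q0) (p1 + q1) (p2 + q2).
Proof. by move=> h k; apply: OO_ext (OOD h k) => n _; ring. Qed.

Lemma xpZ c f p0 p1 p2 : xp f p0 p1 p2 ->
  xp (fun n => c * f n) (c * p0) (c * p1) (c * p2).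
Proof. by move=> h; apply: OO_ext (OOZ c h) => n _; ring. Qed.

Lemma xpB f g p0 p1 p2 q0 q1 q2 : xp f p0 p1 p2 -> xp g q0 q1 q2 ->
  xp (fun n => f n - g n) (p0 - q0) (p1 - q1) (p2 - q2).
Proof. by move=> h k; apply: OO_ext (OOB h k) => n _; ring. Qed.

Lemma poly_bounded (p0 p1 p2 : R) : OO 0 (fun n => p0 + p1 * t n + p2 * t n ^+ 2).
Proof.
have h := OO_inv0; have h2 : OO 0 (fun n => t n ^+ 2) by exact: (OOMl h h).
exact: OOD (OOD (OO_const _) (OOZ _ h)) (OOZ _ h2).
Qed.

Lemma xp_bounded f p0 p1 p2 : xp f p0 p1 p2 -> OO 0 f.
Proof.
move=> h; have h0 : OO 0 _ := OO_le (ltW e_gt0) h.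
by apply: OO_ext (OOD h0 (poly_bounded p0 p1 p2)) => n _; ring.
Qed.

Lemma xpM f g p0 p1 p2 q0 q1 q2 : xp f p0 p1 p2 -> xp g q0 q1 q2 ->
  xp (fun n => f n * g n) (p0 * q0) (p0 * q1 + p1 * q0) (p0 * q2 + p1 * q1 + p2 * q0).
Proof.
move=> h k; have bg := xp_bounded k.
have b3 : OO e (fun n => t n ^+ 3 * (p1 * q2 + p2 * q1 + p2 * q2 * t n + 0 * t n ^+ 2)).
  exact: OOMl OO_inv3 (poly_bounded _ _ _).
apply: OO_ext (OOD (OOD (OOMl h bg) (OOMr (poly_bounded p0 p1 p2) k)) b3) => n _; ring.
Qed.

Lemma xp_lim f p0 p1 p2 eta : xp f p0 p1 p2 -> 0 < eta ->
  exists N : nat, forall n, (N <= n)%N -> `|f n - p0| <= eta.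
Proof.
move=> h eta0.
have e10 : 0 < Num.min e 1 by rewrite lt_min e_gt0 ltr01.
have me : Num.min e 1 <= e by rewrite ge_min lexx.
have h1 : OO (Num.min e 1) _ := OO_le me h.
have k : OO (Num.min e 1) (fun n => t n * (p1 + p2 * t n + 0 * t n ^+ 2)).
  apply: OOMl (poly_bounded _ _ _); apply: OO_le (OO_inv R).
  by rewrite ge_min lexx orbT.
by apply: (OO_small e10 eta0); apply: OO_ext (OOD h1 k) => n _; ring.
Qed.

(** The three equations say that f - r g = O(n^(-e)), and 1/g is bounded because q0 is not 0.
    Passing the coefficients through equations lets them be given in any closed form. *)
Lemma xp_div f g p0 p1 p2 q0 q1 q2 (r0 r1 r2 : R) : xp f p0 p1 p2 -> xp g q0 q1 q2 ->
  q0 != 0 -> p0 = r0 * q0 -> p1 = r0 * q1 + r1 * q0 ->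
  p2 = r0 * q2 + r1 * q1 + r2 * q0 ->
  xp (fun n => f n / g n) r0 r1 r2.
Proof.
move=> h k q00 E0 E1 E2.
have := xpB h (xpM (xp_poly r0 r1 r2) k); rewrite -E0 -E1 -E2 !subrr => hk.
have q0p : 0 < `|q0| / 2 by rewrite divr_gt0// normr_gt0.
have [N HN] := xp_lim k q0p.
have lb n : (N <= n)%N -> `|q0| / 2 <= `|g n|.
  move=> /HN; have := ler_normB (g n) (g n - q0); rewrite opprB addrC subrK; lra.
have ig : OO 0 (fun n => (g n)^-1) by apply: (OO0_inv q0p); exists N.
apply: OO_near (OOMl hk ig); exists N => n /lb gn.
have g0 : g n != 0 by rewrite -normr_gt0; exact: lt_le_trans gn.
by rewrite !mul0r !addr0 subr0 mulrBl mulfK.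
Qed.

Lemma xp_pow (g : R) (c : nat) :
  xp (fun n => (1 + c%:R * t n) `^ g) 1 (c%:R * g) (c%:R ^+ 2 * (g * (g - 1) / 2)).
Proof.
have [C C0 HC] := powR_taylor3 g.
apply: OO_le e_le3 _; exists (C * c%:R ^+ 3); split; first by rewrite mulr_ge0// exprn_ge0.
exists c.+1 => n cn.
have n0 : 0 < n%:R :> R by rewrite ltr0n; exact: leq_ltn_trans cn.
have hx : 1 <= 1 + c%:R * t n <= 2.
  apply/andP; split; first by rewrite lerDl mulr_ge0// invr_ge0 ltW.
  suff : c%:R * t n <= 1 by lra.
  by rewrite ler_pdivrMr// mul1r ler_nat ltnW.
have := HC _ hx; rewrite (_ : 1 + c%:R * t n - 1 = c%:R * t n); last by ring.
have -> : C * c%:R ^+ 3 * n%:R `^ (- 3) = C * (c%:R * t n) ^+ 3.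
  by rewrite powR_invn// exprMn exprVn -mulrA.
by apply: le_trans; rewrite le_eqVlt; apply/orP; left; apply/eqP; congr `|_|; ring.
Qed.

Lemma natrS_inv n : (0 < n)%N -> (n.+1%:R^-1 : R) = t n * (1 + 1 * t n)^-1.
Proof.
move=> n0; have : n%:R != 0 :> R by rewrite pnatr_eq0 -lt0n.
have : n%:R + 1 != 0 :> R by rewrite natr1 pnatr_eq0.
by rewrite -natr1 => h1 h0; field; apply/andP; split.
Qed.

Lemma xp_invS : xp (fun n => n.+1%:R^-1) 0 1 (- 1).
Proof.
apply: (@xp_ext (fun n => t n * (1 + 1%:R * t n) `^ (- 1))).
  move=> n n0; rewrite natrS_inv// powR_inv1// addr_ge0// mulr_ge0// invr_ge0//.
by apply: xp_eq (xpM xp_inv (xp_pow (- 1) 1)); field.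
Qed.

Lemma xp_shift f p0 p1 p2 : xp f p0 p1 p2 -> xp (fun n => f n.+1) p0 p1 (p2 - p1).
Proof.
move=> h; have h1 := OO_shift (ltW e_gt0) h.
have k := xpD (xpD (xp_const p0) (xpZ p1 xp_invS)) (xpZ p2 (xpM xp_invS xp_invS)).
apply: xp_eq (xp_ext _ (xpD (_ : xp _ 0 0 0) k)); last first.
- apply: OO_ext h1 => n _ /=; rewrite !mul0r !addr0 subr0; reflexivity.
- by move=> n _ /=; ring.
- by ring.
- by ring.
- by ring.
Qed.

End Expansion.

Section PowerSequences.
Variables (R : realType).
Implicit Types (f g a b : nat -> R) (e : R).
Local Notation t n := (n%:R^-1 : R).

Lemma OO_natmul e f : OO e f -> OO (e - 1) (fun n => n%:R * f n).
Proof.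
move=> [C [C0 [N HN]]]; exists C; split=> //; exists N.+1 => n Nn.
have n0 : (0 < n)%N by exact: leq_ltn_trans Nn.
rewrite normrM ger0_norm// opprB natr_powD// powRr1// mulrCA.
by rewrite ler_wpM2l// HN// ltnW.
Qed.

Lemma xp_weaken e e' f p0 p1 p2 : e' <= e -> xp e f p0 p1 p2 -> xp e' f p0 p1 p2.
Proof. exact: OO_le. Qed.

Lemma xp_weaken2 e f p0 p1 p2 q2 : e <= 2 -> xp e f p0 p1 p2 -> xp e f p0 p1 q2.
Proof.
move=> e2 h.
have k : OO e (fun n => (p2 - q2) * (t n * t n)).
  apply: OOZ; apply: (OO_le e2); rewrite (_ : 2 = 1 + 1) //; exact: (OOM (OO_inv R) (OO_inv R)).
by apply: OO_ext (OOD h k) => n _; ring.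
Qed.

Lemma xp_weaken1 e f p0 p1 p2 q1 q2 : e <= 1 -> xp e f p0 p1 p2 -> xp e f p0 q1 q2.
Proof.
move=> e1 h; have e2 : e <= 2 by lra.
apply: (@xp_weaken2 _ _ _ _ p2) => //.
have k : OO e (fun n => (p1 - q1) * t n) by apply: OOZ; apply: (OO_le e1) (OO_inv R).
by apply: OO_ext (OOD h k) => n _; ring.
Qed.

Lemma xp_natmul e f p1 p2 : e <= 3 -> xp e f 0 p1 p2 ->
  xp (e - 1) (fun n => n%:R * f n) p1 p2 0.
Proof.
move=> e3 h; apply: OO_ext (OO_natmul h) => n n0.
have : n%:R != 0 :> R by rewrite pnatr_eq0 -lt0n.
by move=> ?; field.
Qed.

Lemma xp_OO e f : xp e f 0 0 0 -> OO e f.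
Proof. by move=> h; apply: OO_ext h => n _; rewrite !mul0r !addr0 subr0. Qed.

Definition pw e (beta : R) f p0 p1 p2 := xp e (fun n => f n / n%:R `^ beta) p0 p1 p2.

(** f at n+1 is normalized by n^beta, so that neighbouring entries are compared on one scale; the
    binomial expansion of (1 + 1/n)^beta produces the new coefficients. *)
Lemma pw_shift e beta f p0 p1 p2 : 0 < e -> e <= 3 -> pw e beta f p0 p1 p2 ->
  xp e (fun n => f n.+1 / n%:R `^ beta) p0 (p0 * beta + p1)
    (p0 * (beta * (beta - 1) / 2) + p1 * beta + (p2 - p1)).
Proof.
move=> e0 e3 /(xp_shift e0 e3) h.
apply: xp_eq (xp_ext _ (xpM e0 e3 h (xp_pow e3 beta 1))); first ring.
- by ring.
- by rewrite expr1n; ring.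
move=> n n0 /=.
have n00 : 0 < n%:R :> R by rewrite ltr0n.
have -> : 1 + 1%:R * t n = n.+1%:R * t n.
  by rewrite -natr1; field; rewrite gt_eqF.
have -> : (n.+1%:R * t n) `^ beta = n.+1%:R `^ beta / n%:R `^ beta.
  by rewrite powRM ?invr_ge0// -[t n]powR_inv1// -powRrM mulN1r powRN.
by field; rewrite !gt_eqF// powR_gt0// ltr0n.
Qed.

Lemma pw_ratio e beta b p0 p1 p2 : 0 < e -> e <= 3 -> p0 != 0 ->
  pw e beta b p0 p1 p2 -> exists r2, xp e (fun n => b n / b n.+1) 1 (- beta) r2.
Proof.
move=> e0 e3 p00 h.
have k := pw_shift e0 e3 h.
pose q1 := p0 * beta + p1.
pose q2 := p0 * (beta * (beta - 1) / 2) + p1 * beta + (p2 - p1).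
exists ((p2 - q2 + beta * q1) / p0).
have E0 : p0 = 1 * p0 by rewrite mul1r.
have E1 : p1 = 1 * q1 + - beta * p0 by rewrite /q1; ring.
have E2 : p2 = 1 * q2 + - beta * q1 + (p2 - q2 + beta * q1) / p0 * p0.
  by rewrite mulfVK//; ring.
apply: (xp_ext _ (xp_div e0 e3 h k p00 E0 E1 E2)).
move=> n n0 /=; have : n%:R `^ beta != 0 :> R by rewrite gt_eqF// natr_pow_gt0.
by move=> nb; rewrite invf_div mulrA mulfVK.
Qed.

Lemma pw_bounds e beta b p0 p1 p2 : 0 < e -> 0 < p0 -> (forall n, 0 < b n) ->
  e <= 3 -> pw e beta b p0 p1 p2 ->
  exists c C : R, [/\ 0 < c, 0 < C & forall n, (0 < n)%N ->
    c * n%:R `^ beta <= b n <= C * n%:R `^ beta].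
Proof.
move=> e0 p00 b0 e3 h.
have p02 : 0 < p0 / 2 by rewrite divr_gt0.
have [N HN] := xp_lim e0 h p02.
have {}HN n : (N <= n)%N -> (0 < n)%N -> p0 / 2 * n%:R `^ beta <= b n <= 2 * p0 * n%:R `^ beta.
  move=> Nn n0; have := HN n Nn; have np := @natr_pow_gt0 R n beta n0.
  rewrite ler_norml => /andP[h1 h2].
  have h3 : p0 / 2 <= b n / n%:R `^ beta by lra.
  have h4 : b n / n%:R `^ beta <= 2 * p0 by lra.
  by apply/andP; split; [rewrite -ler_pdivlMr|rewrite -ler_pdivrMr].
(* The expansion controls only large n; the finitely many remaining indices are added one at a time,
   so that the bounds hold for all n >= 1. *)
have fin : exists c C : R, [/\ 0 < c, 0 < C & forall n, (n <= N)%N -> (0 < n)%N ->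
    c * n%:R `^ beta <= b n <= C * n%:R `^ beta].
  elim: N {HN} => [|N [c [C [c0 C0 H]]]]; first by exists 1, 1; split=> // -[].
  pose r := b N.+1 / N.+1%:R `^ beta.
  have np := @natr_pow_gt0 R N.+1 beta (ltn0Sn _).
  have r0 : 0 < r by rewrite divr_gt0.
  exists (Num.min c r), (Num.max C r); split; first by rewrite lt_min c0.
    by rewrite lt_max C0.
  move=> n; rewrite leq_eqVlt => /predU1P[->|nN] n0.
    have -> : b N.+1 = r * N.+1%:R `^ beta by rewrite /r mulfVK// gt_eqF.
    by rewrite !ler_pM2r// ge_min le_max lexx !orbT.
  have /andP[h1 h2] := H n nN n0; have nb := @natr_pow_gt0 R n beta n0.
  apply/andP; split.
    by apply: le_trans h1; rewrite ler_pM2r// ge_min lexx.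
  by apply: le_trans h2 _; rewrite ler_pM2r// le_max lexx.
have [c [C [c0 C0 H]]] := fin.
exists (Num.min c (p0 / 2)), (Num.max C (2 * p0)); split.
- by rewrite lt_min c0.
- by rewrite lt_max C0.
move=> n n0; have nb := @natr_pow_gt0 R n beta n0.
have [nN|Nn] := leqP n N.
  have /andP[h1 h2] := H n nN n0; apply/andP; split.
    by apply: le_trans h1; rewrite ler_pM2r// ge_min lexx.
  by apply: le_trans h2 _; rewrite ler_pM2r// le_max lexx.
have /andP[h1 h2] := HN n (ltnW Nn) n0; apply/andP; split.
  by apply: le_trans h1; rewrite ler_pM2r// ge_min lexx orbT.
by apply: le_trans h2 _; rewrite ler_pM2r// le_max lexx orbT.
Qed.

(* With s the sign of the diagonal, [defect] is the potential of the
   discretized Sturm-Liouville form of the recurrence. *)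
Definition defect (s : R) a b n := b n.+1 + b n - s * a n.+1.

(** Criticality [s * y0 = 2 * x0] cancels the leading terms of b_(n+1) + b_n and s a_(n+1), so the
    relative defect starts at order 1/n. *)
Lemma pw_defect e beta s a b x0 x1 x2 y0 y1 y2 :
  0 < e -> e <= 3 -> x0 != 0 -> s * y0 = 2 * x0 ->
  pw e beta b x0 x1 x2 -> pw e beta a y0 y1 y2 ->
  xp e (fun n => defect s a b n / b n.+1) 0 (2 * x1 / x0 - s * y1 / x0 - beta)
   ((x0 * (beta * (beta - 1) / 2) + x1 * beta + (x2 - x1) + x2
     - s * (y0 * (beta * (beta - 1) / 2) + y1 * beta + (y2 - y1))
     - (2 * x1 / x0 - s * y1 / x0 - beta) * (x0 * beta + x1)) / x0).
Proof.
move=> e0 e3 x00 sy hb ha.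
have kb := pw_shift e0 e3 hb; have ka := pw_shift e0 e3 ha.
have num := xpB (xpD kb hb) (xpZ s ka).
set k := 2 * x1 / x0 - s * y1 / x0 - beta.
set N2 := (X in X / x0).
have E0 : x0 + x0 - s * y0 = 0 * x0 by rewrite sy; ring.
have E1 : x0 * beta + x1 + x1 - s * (y0 * beta + y1) = 0 * (x0 * beta + x1) + k * x0.
  by rewrite mulrDr mulrA sy /k; field.
have E2 : x0 * (beta * (beta - 1) / 2) + x1 * beta + (x2 - x1) + x2 -
    s * (y0 * (beta * (beta - 1) / 2) + y1 * beta + (y2 - y1)) =
    0 * (x0 * (beta * (beta - 1) / 2) + x1 * beta + (x2 - x1)) + k * (x0 * beta + x1) + N2 / x0 * x0.
  by rewrite mulfVK// /N2 /k; ring.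
apply: (xp_ext _ (xp_div e0 e3 num kb x00 E0 E1 E2)).
move=> n n0 /=; have : n%:R `^ beta != 0 :> R by rewrite gt_eqF// natr_pow_gt0.
by move=> nb; rewrite mulrA -mulrDl -mulrBl invf_div mulrA mulfVK.
Qed.

End PowerSequences.

(** * Decay of solutions at 0 *)

Section QuadraticDecay.
Variable R : realType.
Implicit Types (x y A B C : nat -> R) (lam gam delta kap : R).
Local Notation t n := (n%:R^-1 : R).

Lemma powR_contraction n gam : (0 < n)%N -> 0 <= gam ->
  (1 - gam * t n) * n%:R `^ (- gam) <= n.+1%:R `^ (- gam).
Proof.
move=> n0 g0; have n00 : 0 < n%:R :> R by rewrite ltr0n.
have E : n.+1%:R = n%:R * (1 + t n) :> R by rewrite -natr1; field; rewrite gt_eqF.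
have t0 : 0 < t n by rewrite invr_gt0.
rewrite E powRM ?(ltW n00) ?(ltW (addr_gt0 ltr01 t0))// [leLHS]mulrC ler_wpM2l ?powR_ge0//.
rewrite /powR gt_eqF ?addr_gt0//.
apply: le_trans (expR_ge1Dx _).
rewrite lerD2l mulNr lerN2 ler_wpM2l// le_ln1Dx//; lra.
Qed.

Lemma quad_decay x y A B C (r1 r2 r3 : nat -> R) lam gam delta kap :
  let V n := A n * x n ^+ 2 + B n * (x n * y n) + C n * y n ^+ 2 in
  0 <= gam -> gam < lam -> 0 < delta -> 0 < kap ->
  (exists N : nat, forall n, (N <= n)%N ->
     V n.+1 <= (1 - lam * t n) * V n +
       (r1 n * x n ^+ 2 + r2 n * (x n * y n) + r3 n * y n ^+ 2)) ->
  OO (1 + delta) r1 -> OO (1 + delta) r2 -> OO (1 + delta) r3 ->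
  (exists N : nat, forall n, (N <= n)%N -> kap * (x n ^+ 2 + y n ^+ 2) <= V n) ->
  OO gam (fun n => x n ^+ 2).
Proof.
move=> V g0 gl d0 k0 [N1 H1] o1 o2 o3 [N2 H2].
have eta0 : 0 < (lam - gam) * kap / 3 by rewrite divr_gt0// mulr_gt0// subr_gt0.
have d1 : 1 < 1 + delta by rewrite ltrDl.
have [M1 K1] := OO_lt d1 eta0 o1; have [M2 K2] := OO_lt d1 eta0 o2.
have [M3 K3] := OO_lt d1 eta0 o3.
pose N := (N1 + N2 + M1 + M2 + M3).+1.
have V0 n : (N2 <= n)%N -> 0 <= V n.
  by move=> /H2; apply: le_trans; rewrite mulr_ge0 ?(ltW k0)// addr_ge0 ?sqr_ge0.
have step n : (N <= n)%N -> V n.+1 <= (1 - gam * t n) * V n.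
  move=> Nn.
  have le_n k : (k <= N1 + N2 + M1 + M2 + M3)%N -> (k <= n)%N.
    by move=> h; apply: leq_trans h (ltnW Nn).
  have a1 := H1 n (le_n _ (leq_trans (leq_addr _ _) (leq_trans (leq_addr _ _) (leq_trans (leq_addr _ _) (leq_addr _ _))))).
  have a2 := H2 n (le_n _ (leq_trans (leq_addl _ _) (leq_trans (leq_addr _ _) (leq_trans (leq_addr _ _) (leq_addr _ _))))).
  have b1 := K1 n (le_n _ (leq_trans (leq_addl _ _) (leq_trans (leq_addr _ _) (leq_addr _ _)))).
  have b2 := K2 n (le_n _ (leq_trans (leq_addl _ _) (leq_addr _ _))).
  have b3 := K3 n (le_n _ (leq_addl _ _)).
  rewrite natr_powN1 in b1 b2 b3.
  set T := t n in a1 b1 b2 b3 *; set X := x n ^+ 2 in a1 a2 *; set Y := y n ^+ 2 in a1 a2 *.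
  have X0 : 0 <= X by rewrite sqr_ge0.
  have Y0 : 0 <= Y by rewrite sqr_ge0.
  have T0 : 0 <= T by rewrite invr_ge0.
  have xy : `|x n * y n| <= X + Y.
    rewrite ler_norml; have := sqr_ge0 (x n - y n); have := sqr_ge0 (x n + y n).
    by rewrite /X /Y => ? ?; apply/andP; split; nra.
  have bnd (r z : R) : `|r| <= (lam - gam) * kap / 3 * T -> `|z| <= X + Y ->
      r * z <= (lam - gam) * kap / 3 * T * (X + Y).
    by move=> h1 h2; apply: le_trans (ler_norm _) _; rewrite normrM ler_pM.
  have c1 := bnd _ X b1 (_ : _); have c2 := bnd _ _ b2 xy; have c3 := bnd _ Y b3 (_ : _).
  have {}c1 : r1 n * X <= (lam - gam) * kap / 3 * T * (X + Y).
    by apply: c1; rewrite ger0_norm// lerDl.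
  have {}c3 : r3 n * Y <= (lam - gam) * kap / 3 * T * (X + Y).
    by apply: c3; rewrite ger0_norm// lerDr.
  have k : (lam - gam) * T * (kap * (X + Y)) <= (lam - gam) * T * V n.
    by rewrite ler_wpM2l// mulr_ge0// subr_ge0 ltW.
  apply: le_trans a1 _.
  move: c1 c2 c3 k; set Vn := V n; lra.
pose K := V N * N%:R `^ gam.
have K0 : 0 <= K by rewrite mulr_ge0 ?powR_ge0// V0// /N; apply: leqW; rewrite -!addnA addnCA leq_addr.
have NN2 : (N2 <= N)%N by rewrite /N; apply: leqW; rewrite -!addnA addnCA leq_addr.
have VK n : (N <= n)%N -> V n <= K * n%:R `^ (- gam).
  elim: n => [|n ih]; first by rewrite /N.
  rewrite leq_eqVlt => /predU1P[<-|].
    by rewrite /K -mulrA -natr_powD// subrr powRr0 mulr1.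
  rewrite ltnS => Nn; have n0 : (0 < n)%N by exact: leq_ltn_trans Nn.
  have [h|h] := leP 0 (1 - gam * t n).
    apply: le_trans (step n Nn) _.
    apply: (@le_trans _ _ ((1 - gam * t n) * (K * n%:R `^ (- gam)))).
      by rewrite ler_wpM2l// ih.
    by rewrite mulrCA ler_wpM2l// powR_contraction.
  apply: le_trans (step n Nn) _.
  apply: (@le_trans _ _ 0); last by rewrite mulr_ge0// powR_ge0.
  by rewrite mulr_le0_ge0 ?(ltW h)// V0// (leq_trans NN2).
exists (K / kap); split; first by rewrite divr_ge0// ltW.
exists N => n Nn; rewrite ger0_norm ?sqr_ge0// mulrAC ler_pdivlMr// mulrC.
apply: le_trans (VK n Nn); apply: le_trans (H2 n (leq_trans NN2 Nn)).
by rewrite ler_wpM2l ?(ltW k0)// lerDl sqr_ge0.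
Qed.

End QuadraticDecay.

Section SolutionDecay.
Variable R : realType.
Implicit Types (u rho W g : nat -> R) (gam delta kap beta : R).
Local Notation t n := (n%:R^-1 : R).

Let gt01 : (0 : R) < 1 := ltr01.
Let gt02 : (0 : R) < 2. Proof. by []. Qed.
Let le12 : (1 : R) <= 2. Proof. lra. Qed.
Let le13 : (1 : R) <= 3. Proof. lra. Qed.
Let le23 : (2 : R) <= 3. Proof. lra. Qed.

Lemma OO_invS (e : R) : e <= 2 -> OO e (fun n => t n.+1 - t n).
Proof.
move=> e2; apply: (OO_le e2).
apply: xp_OO; apply: (xp_weaken2 _ (lexx 2)).
by apply: xp_eq (xpB (xp_invS gt02 le23) (xp_inv le23)); last reflexivity; rewrite subrr.
Qed.

(* The Lyapunov function is y^2 + (1 - beta/n) x^2 + g x y with x = u_n and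
   y = u_(n+1); it is definite because |g| stays below 2. *)
Lemma oscillating_decay u rho g beta gam delta kap :
  (forall n, u n.+2 = - g n.+1 * u n.+1 - rho n * u n) ->
  xp 2 rho 1 (- beta) 0 ->
  0 < delta -> delta <= 1 -> OO (1 + delta) (fun n => g n.+1 - g n) ->
  0 < kap -> (exists N : nat, forall n, (N <= n)%N -> `|g n| <= 2 - 4 * kap) ->
  0 <= gam -> gam < beta ->
  OO gam (fun n => u n ^+ 2).
Proof.
move=> ru hrho d0 d1 hg k0 [N HN] g0 gb.
have e2 : 1 + delta <= 2 by lra.
have g1 : OO 0 (fun n => g n.+1).
  exists (2 - 4 * kap); split; first by apply: le_trans (HN N (leqnn N)).
  by exists N => n Nn; rewrite oppr0 powRr0 mulr1 HN// leqW.
have hr : OO (1 + delta) (fun n => rho n - (1 - beta * t n)).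
  by apply: OO_ext (OO_le e2 hrho) => n _; ring.
have bt : OO 0 (fun n => 1 - beta * t n) by exact: OOB (OO_const _) (OOZ _ (OO_inv0 R)).
have br : OO 0 rho by exact: xp_bounded hrho.
apply: (@quad_decay _ u (fun n => u n.+1) (fun n => 1 - beta * t n) g (fun=> 1)
   (fun n => (rho n - (1 - beta * t n)) * (rho n + (1 - beta * t n)))
   (fun n => g n.+1 * (rho n - (1 - beta * t n)) + (1 - beta * t n) * (g n.+1 - g n))
   (fun n => - beta * (t n.+1 - t n)) beta gam delta kap) => //.
(* By the recurrence u_(n+2)^2 + g_(n+1) u_(n+1) u_(n+2) = - rho_n u_n u_(n+2), so V reproduces
   itself with a factor close to rho, that is 1 - beta/n; the r_i collect the deviations exactly. *)
- by exists 0%N => n _; rewrite le_eqVlt; apply/orP; left; apply/eqP; rewrite ru; ring.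
- exact: OOMl hr (OOD br bt).
- exact: OOD (OOMr g1 hr) (OOMr bt hg).
- exact: OOZ (OO_invS e2).
have k0' : 0 < kap by [].
have [M HM] := OO_small gt01 k0' (OOZ beta (OO_inv R)).
exists (N + M)%N => n NMn.
have a1 := HN n (leq_trans (leq_addr _ _) NMn).
have a2 := HM n (leq_trans (leq_addl _ _) NMn).
have xy : - ((2 - 4 * kap) * (u n ^+ 2 + u n.+1 ^+ 2)) <= 2 * (g n * (u n * u n.+1)).
  have : `|2 * (g n * (u n * u n.+1))| <= (2 - 4 * kap) * (u n ^+ 2 + u n.+1 ^+ 2).
    have -> : 2 * (g n * (u n * u n.+1)) = g n * (2 * (u n * u n.+1)) by ring.
    rewrite normrM; apply: ler_pM => //; rewrite ler_norml.
    have := sqr_ge0 (u n - u n.+1); have := sqr_ge0 (u n + u n.+1).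
    by move=> ? ?; apply/andP; split; nra.
  by rewrite ler_norml => /andP[].
have := ler_wpM2r (sqr_ge0 (u n)) a2.
have := ler_wpM2r (sqr_ge0 (u n)) (ler_norm (beta * t n)).
have := sqr_ge0 (u n); have := sqr_ge0 (u n.+1).
move: xy; set X := u n ^+ 2; set Y := u n.+1 ^+ 2; set XY := u n * u n.+1.
nra.
Qed.

(* With e = sqrt n (v_(n+1) - v_n), the Lyapunov function is
   kap v^2 + e^2 - ((1/2 - beta - kap) / sqrt n) v e. *)
Lemma turning_decay v rho W beta kap gam :
  (forall n, v n.+2 = (1 + rho n - W n) * v n.+1 - rho n * v n) ->
  xp 2 rho 1 (- beta) 0 -> xp 2 W 0 kap 0 ->
  0 < kap -> 0 <= gam -> gam < beta - 1 / 2 ->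
  OO gam (fun n => v n ^+ 2).
Proof.
move=> rv hrho hW k0 g0 gb.
(* The cross term nu v y / sqrt n moves decay from y^2 to v^2, and nu is chosen so that both squares
   decay at the common rate lam. In the continuous model nu = lam; the summand kap corrects for the
   forward difference. *)
pose lam := beta - 1 / 2; pose nu := kap + lam.
pose m n : R := Num.sqrt n%:R.
pose S n : R := (1 + 1%:R * t n) `^ (1 / 2).
pose Z n := n%:R * W n.
have W1 := xp_weaken1 0 0 (lexx 1) (xp_weaken le12 hW).
have rho1 := xp_weaken1 0 0 (lexx 1) (xp_weaken le12 hrho).
have S2 := xp_weaken2 0 (lexx 2) (xp_weaken (le23) (xp_pow (lexx 3) (1 / 2) 1)).
have S1 := xp_weaken1 0 0 (lexx 1) (xp_weaken le12 S2).
have Z1 : xp 1 Z kap 0 0.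
  by have := xp_natmul le23 hW; rewrite (_ : 2 - 1 = 1); last by ring.
have cK c := xp_weaken le13 (xp_const (lexx 3) c).
have mO : OO (1 / 2) (fun n => (m n)^-1).
  apply: OO_ext (OO_pow (1 / 2)) => n _.
  by rewrite powRN mul1r powR12_sqrt.
have msq n : m n ^+ 2 = n%:R by rewrite sqr_sqrtr.
have m_gt0 n : (0 < n)%N -> 0 < m n by move=> n0; rewrite sqrtr_gt0 ltr0n.
have mS n : (0 < n)%N -> m n.+1 = m n * S n.
  move=> n0; rewrite /m /S mul1r powR12_sqrt; last by rewrite addr_ge0// mul1r invr_ge0.
  rewrite -sqrtrM//; congr Num.sqrt; rewrite -natr1 mul1r mulrDr mulr1 divff//.
  by rewrite pnatr_eq0 -lt0n.
have S_gt0 n : 0 < S n by rewrite powR_gt0// ltr_wpDr// mulr_ge0// invr_ge0.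
pose r2 n := (m n)^-1 * (2 * kap - 2 * (S n * S n) * ((rho n - W n) * Z n)
   + nu * (rho n - 2 * W n) - nu + nu * lam * t n).
pose r1 n := t n * (S n * S n * (Z n * Z n) - nu * Z n + lam * kap).
pose r3 n := kap * t n + S n * S n * ((rho n - W n) * (rho n - W n))
   + nu * (t n * (rho n - W n)) - (1 - lam * t n).
pose y n := m n * (v n.+1 - v n).
apply: (@quad_decay _ v y (fun=> kap) (fun n => nu / m n) (fun=> 1)
   r1 r2 r3 lam gam (1 / 2) (Num.min kap 1 / 2)) => //.
- by apply: divr_gt0 => //; rewrite lt_min k0 ltr01.
- exists 1%N => n n0; rewrite le_eqVlt; apply/orP; left; apply/eqP.
  have Wn : W n = Z n * t n.
    by rewrite /Z mulrAC divff ?mul1r// pnatr_eq0 -lt0n.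
  have xS : v n.+1 = v n + y n / m n.
    by rewrite /y mulrAC divff ?gt_eqF ?m_gt0// mul1r addrC subrK.
  have yS : y n.+1 = S n * (rho n - W n) * y n - m n * S n * W n * v n.
    rewrite {1}/y rv mS// /y; ring.
  have tm : t n = (m n)^-1 ^+ 2 by rewrite exprVn msq.
  rewrite yS xS /r1 /r2 /r3 mS// Wn tm.
  have m0 := lt0r_neq0 (m_gt0 n n0); have S0 := lt0r_neq0 (S_gt0 n).
  by field; rewrite m0 S0.
- apply: (@OO_le _ 2); first by lra.
  rewrite (_ : 2 = 1 + 1); last by ring.
  apply: OOM (OO_inv R) _; apply: xp_OO.
  apply: xp_eq (xpD (xpB (xpM gt01 le13 (xpM gt01 le13 S1 S1) (xpM gt01 le13 Z1 Z1)) (xpZ nu Z1)) (cK (lam * kap))); rewrite /nu; ring.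
- rewrite (_ : 1 + 1 / 2 = 1 / 2 + 1); last by ring.
  apply: OOM mO _; apply: xp_OO.
  have t1 : xp 1 (fun n => nu * lam * t n) 0 0 0.
    by apply: xp_eq (xp_weaken1 0 0 (lexx 1) (xpZ (nu * lam) (xp_weaken le13 (xp_inv (lexx 3))))); rewrite ?mulr0.
  have SS := xpM gt01 le13 S1 S1; have rW := xpB rho1 W1.
  apply: xp_eq (xpD (xpB (xpD (xpB (cK (2 * kap)) (xpM gt01 le13 (xpZ 2 SS) (xpM gt01 le13 rW Z1))) (xpZ nu (xpB rho1 (xpZ 2 W1)))) (cK nu)) t1); ring.
- apply: (@OO_le _ 2); first by lra.
  have SS := xpM gt02 le23 S2 S2; have rW := xpB hrho hW.
  have tt := xp_weaken le23 (xp_inv (lexx 3)).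
  have one := xp_weaken le23 (xp_const (lexx 3) 1).
  apply: xp_OO; apply: (xp_weaken2 0 (lexx 2)).
  apply: xp_eq (xpB (xpD (xpD (xpZ kap tt) (xpM gt02 le23 SS (xpM gt02 le23 rW rW))) (xpZ nu (xpM gt02 le23 tt rW))) (xpB one (xpZ lam tt))); last reflexivity; rewrite /nu /lam; by field.
set kk := Num.min kap 1.
have kk0 : 0 < kk by rewrite lt_min k0 ltr01.
have half0 : (0 : R) < 1 / 2 by lra.
have [N HN] := OO_small half0 kk0 (OOZ nu mO).
exists N => n /HN h.
have kk1 : kk <= kap by rewrite ge_min lexx.
have kk2 : kk <= 1 by rewrite ge_min lexx orbT.
have xy : - (kk * (v n ^+ 2 + y n ^+ 2)) <= 2 * (nu / m n * (v n * y n)).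
  have : `|2 * (nu / m n * (v n * y n))| <= kk * (v n ^+ 2 + y n ^+ 2).
    have -> : 2 * (nu / m n * (v n * y n)) = nu / m n * (2 * (v n * y n)) by ring.
    rewrite normrM; apply: ler_pM => //; rewrite ler_norml.
    have := sqr_ge0 (v n - y n); have := sqr_ge0 (v n + y n).
    by move=> ? ?; apply/andP; split; nra.
  by rewrite ler_norml => /andP[].
have := ler_wpM2r (sqr_ge0 (v n)) kk1; have := ler_wpM2r (sqr_ge0 (y n)) kk2.
rewrite mul1r; move: xy; set X := v n ^+ 2; set Y := y n ^+ 2; lra.
Qed.

(* With g = n (v_(n+1) - v_n) - s v_n, the Lyapunov function is
   g^2 + (s (s + beta - 1) + c) v^2; the model is Euler's equation with
   exponents the roots of r (r + beta - 1) + c. *)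
Lemma euler_decay v rho W beta c s delta gam :
  (forall n, v n.+2 = (1 + rho n - W n) * v n.+1 - rho n * v n) ->
  0 < delta -> delta <= 1 ->
  xp (1 + delta) rho 1 (- beta) 0 -> xp (2 + delta) W 0 0 c ->
  0 < s * (s + beta - 1) + c ->
  0 <= gam -> gam < 2 * (beta - 1 + s) -> gam < - (2 * s) ->
  OO gam (fun n => v n ^+ 2).
Proof.
move=> rv d0 d1 hrho hW f0 g0 gl1 gl2.
pose f := s * (s + beta - 1) + c.
(* To leading order the cross terms in the increments of g^2 and f v^2 cancel, leaving -(2 (beta - 1
   + s) g^2 - 2 s f v^2) / n; lam is the smaller of the two rates. *)
pose lam := Num.min (2 * (beta - 1 + s)) (- (2 * s)).
have e0 : 0 < 1 + delta by lra.
have e3 : 1 + delta <= 3 by lra.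
have e2 : 1 + delta <= 2 by lra.
pose F n := n.+1%:R * t n * rho n - n.+1%:R * W n * t n.
pose G n := n.+1%:R * W n.
have ntn n : (0 < n)%N -> n.+1%:R = n%:R * (1 + t n) :> R.
  by move=> n0; rewrite -natr1 mulrDr mulr1 divff// pnatr_eq0 -lt0n.
have tt := xp_inv e3.
have hG : xp (1 + delta) G 0 c 0.
  have h := xp_natmul (ltac:(lra) : 2 + delta <= 3) hW.
  rewrite (_ : 2 + delta - 1 = 1 + delta) in h; last by ring.
  apply: (xp_weaken2 _ e2).
  apply: xp_eq (xp_ext _ (xpM e0 e3 h (xpD (xp_const e3 1) tt))); last first.
  - by move=> n n0; rewrite /G ntn//; ring.
  - reflexivity.
  - by ring.
  - by ring.
have hF : xp (1 + delta) F 1 (1 - beta) 0.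
  apply: (xp_weaken2 _ e2).
  apply: xp_eq (xp_ext _ (xpB (xpM e0 e3 (xpD (xp_const e3 1) tt) hrho) (xpM e0 e3 hG tt))); last first.
  - move=> n n0; rewrite /F /G; congr (_ - _); rewrite ntn//; field.
    by rewrite pnatr_eq0 -lt0n.
  - reflexivity.
  - by ring.
  - by ring.
pose r1 n := 2 * s * G n + G n * G n - 2 * s * c * t n.
pose r2 n := 2 * (s ^+ 2 + f) * t n - 2 * s * (F n - t n * G n) - 2 * (F n * G n) + 2 * s
   - 4 * s * (beta - 1 + s) * t n.
pose r3 n := (s ^+ 2 + f) * (t n * t n) - 2 * s * (t n * F n) + F n * F n - 1 + 2 * (beta - 1 + s) * t n.
pose y n := n%:R * (v n.+1 - v n).
have cK := xp_const e3.
pose kk := Num.min f 1 / (2 * (1 + s ^+ 2)).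
have s1 : 0 < 1 + s ^+ 2 by rewrite ltr_wpDr// sqr_ge0.
have kk0 : 0 < kk.
  by rewrite divr_gt0// ?mulr_gt0// lt_min f0 ltr01.
apply: (@quad_decay _ v y (fun=> s ^+ 2 + f) (fun n => - (2 * s)) (fun=> 1)
   r1 r2 r3 lam gam delta kk) => //.
- by rewrite lt_min gl1 gl2.
- exists 1%N => n n0.
  have n00 : n%:R != 0 :> R by rewrite pnatr_eq0 -lt0n.
  have xS : v n.+1 = v n + t n * y n.
    by rewrite /y mulrA mulVf// mul1r addrC subrK.
  have yS : y n.+1 = F n * y n - G n * v n.
    by rewrite {1}/y rv /F /G /y; field.
  rewrite yS xS.
  have l1 : lam <= 2 * (beta - 1 + s) by rewrite ge_min lexx.
  have l2 : lam <= - (2 * s) by rewrite ge_min lexx orbT.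
  have T0 : 0 <= t n by rewrite invr_ge0.
  have := mulr_ge0 T0 (addr_ge0
    (mulr_ge0 (ltac:(lra) : 0 <= 2 * (beta - 1 + s) - lam) (sqr_ge0 (y n - s * v n)))
    (mulr_ge0 (ltac:(lra) : 0 <= - (2 * s) - lam) (mulr_ge0 (ltW f0) (sqr_ge0 (v n))))).
  move=> D; rewrite -subr_ge0; apply: le_trans D _; rewrite le_eqVlt; apply/orP; left; apply/eqP.
  by rewrite /r1 /r2 /r3 /f; ring.
- apply: xp_OO; apply: (xp_weaken2 _ e2).
  apply: xp_eq (xpB (xpD (xpZ (2 * s) hG) (xpM e0 e3 hG hG)) (xpZ (2 * s * c) tt)); last reflexivity; ring.
- apply: xp_OO; apply: (xp_weaken2 _ e2).
  apply: xp_eq (xpB (xpD (xpB (xpB (xpZ (2 * (s ^+ 2 + f)) tt) (xpZ (2 * s) (xpB hF (xpM e0 e3 tt hG)))) (xpZ 2 (xpM e0 e3 hF hG))) (cK (2 * s))) (xpZ (4 * s * (beta - 1 + s)) tt)); last reflexivity; rewrite /f; ring.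
- apply: xp_OO; apply: (xp_weaken2 _ e2).
  apply: xp_eq (xpD (xpB (xpD (xpB (xpZ (s ^+ 2 + f) (xpM e0 e3 tt tt)) (xpZ (2 * s) (xpM e0 e3 tt hF))) (xpM e0 e3 hF hF)) (cK 1)) (xpZ (2 * (beta - 1 + s)) tt)); last reflexivity; rewrite /f; ring.
exists 0%N => n _.
set X := v n; set Y := y n.
have h1 : X ^+ 2 + Y ^+ 2 <= 2 * (1 + s ^+ 2) * (X ^+ 2 + (Y - s * X) ^+ 2).
  have : 0 <= (Y - 2 * s * X) ^+ 2 by rewrite sqr_ge0.
  have : 0 <= s ^+ 2 * (Y - s * X) ^+ 2 by rewrite mulr_ge0// sqr_ge0.
  have : 0 <= X ^+ 2 by rewrite sqr_ge0.
  nra.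
have m1 : Num.min f 1 <= f by rewrite ge_min lexx.
have m2 : Num.min f 1 <= 1 by rewrite ge_min lexx orbT.
have m0 : 0 < Num.min f 1 by rewrite lt_min f0 ltr01.
apply: (@le_trans _ _ (Num.min f 1 * (X ^+ 2 + (Y - s * X) ^+ 2))).
  rewrite /kk mulrAC ler_pdivrMr ?mulr_gt0// -mulrA ler_wpM2l ?(ltW m0)//.
  by apply: le_trans h1 _; rewrite mulrC.
have := ler_wpM2r (sqr_ge0 X) m1; have := ler_wpM2r (sqr_ge0 (Y - s * X)) m2.
nra.
Qed.

End SolutionDecay.

(** * Limit point criteria *)

Section LimitPoint.
Variables (R : realType) (a b : nat -> R).
Hypothesis b_gt0 : forall n, 0 < b n.
Implicit Types (u v w f : nat -> R) (beta c C : R).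
Local Notation t n := (n%:R^-1 : R).
Local Notation P := (rpol1 a b).
Local Notation Q := (rpol2 a b).

Lemma harmonic_large (N : nat) (M : R) : exists n, M < \sum_(N <= k < n) k.+1%:R^-1.
Proof.
apply: contrapT => H; apply: (@dvg_harmonic R).
apply: (@series_bounded_cvg _ _ (\sum_(0 <= k < N) k.+1%:R^-1 + `|M|)) => [n|n].
  by rewrite invr_ge0.
have [nN|Nn] := leqP n N.
  rewrite [X in _ <= X + _](@big_cat_nat _ _ _ n)//= -addrA lerDl.
  by apply: addr_ge0 => //; apply: sumr_ge0 => k _; rewrite invr_ge0.
rewrite (@big_cat_nat _ _ _ N) ?(ltnW Nn)//= lerD2l.
apply: le_trans (ler_norm M); rewrite leNgt; apply/negP => h.
by apply: H; exists n.
Qed.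

Lemma not_bounded_harmonic f c (N : nat) (M : R) : 0 < c ->
  (forall n, 0 <= f n) -> (forall n, (N <= n)%N -> c / n.+1%:R <= f n) ->
  ~ (forall n, \sum_(0 <= k < n) f k <= M).
Proof.
move=> c0 f0 fc H; have [n] := harmonic_large N (M / c).
rewrite ltr_pdivrMr// ltNge => /negP; apply; apply: le_trans (H n).
have [nN|Nn] := leqP n N; first by rewrite big_geq// mul0r sumr_ge0.
rewrite [leRHS](@big_cat_nat _ _ _ N) ?(ltnW Nn)//= mulr_suml ler_wpDl ?sumr_ge0//.
by apply: ler_sum_nat => k /andP[Nk _]; rewrite mulrC fc.
Qed.

(** The constant Wronskian writes 1/b_n as a combination of products of p and q, so
    square-summability would make the sum of 1/b_n converge. *)
Lemma carleman c (N : nat) : 0 < c -> (forall n, (N <= n)%N -> b n <= c * n.+1%:R) ->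
  ~ (rsummable P /\ rsummable Q).
Proof.
move=> c0 bc [[M HM] [M' HM']].
have ic0 : 0 < c^-1 by rewrite invr_gt0.
apply: (@not_bounded_harmonic (fun n => (b n)^-1) c^-1 N (2 * (M + M')) ic0).
- by move=> n; rewrite invr_ge0 ltW.
- by move=> n Nn; rewrite -invfM lef_pV2 ?posrE ?mulr_gt0// bc.
move=> n.
apply: (@le_trans _ _ (\sum_(0 <= k < n) ((P k ^+ 2 + Q k ^+ 2) + (P k.+1 ^+ 2 + Q k.+1 ^+ 2)))).
  apply: ler_sum => k _; have bk0 := lt0r_neq0 (b_gt0 k).
  have -> : (b k)^-1 = P k * Q k.+1 - P k.+1 * Q k.
    by apply: (mulfI bk0); rewrite mulfV// rpol_wronskian.
  have := sqr_ge0 (P k - Q k.+1); have := sqr_ge0 (P k.+1 + Q k).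
  have := sqr_ge0 (P k); have := sqr_ge0 (Q k).
  have := sqr_ge0 (P k.+1); have := sqr_ge0 (Q k.+1); nra.
rewrite big_split/= !big_split/=.
have h (w : nat -> R) : \sum_(0 <= k < n) w k.+1 ^+ 2 <= \sum_(0 <= k < n.+1) w k ^+ 2.
  by rewrite big_nat_recl// lerDr sqr_ge0.
have := h P; have := h Q; have := HM n; have := HM' n; have := HM n.+1; have := HM' n.+1; lra.
Qed.

Lemma recurrence_initial N (x y : R) : exists u,
  [/\ recurrence a b u, u N = x & u N.+1 = y].
Proof.
exists (fun n => b N * ((x * Q N.+1 - y * Q N) * P n + (y * P N - x * P N.+1) * Q n)).
have W := rpol_wronskian a b_gt0 N; split=> [n||].
- have hp := recurrence_rpol1 a b_gt0 n; have hq := recurrence_rpol2 a b_gt0 n.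
  transitivity (b N * (x * Q N.+1 - y * Q N) * (b n.+1 * P n.+2 + a n.+1 * P n.+1 + b n * P n)
    + b N * (y * P N - x * P N.+1) * (b n.+1 * Q n.+2 + a n.+1 * Q n.+1 + b n * Q n)); first ring.
  by rewrite hp hq !mulr0 addr0.
- by rewrite -[RHS]mulr1 -[in RHS]W; ring.
- by rewrite -[RHS]mulr1 -[in RHS]W; ring.
Qed.

(** Diagonal dominance: with equal initial values at N and N+1, the triangle inequality in the
    recurrence makes |u_n| nondecreasing. *)
Lemma growing_solution N : (forall n, (N <= n)%N -> b n.+1 + b n <= `|a n.+1|) ->
  exists2 u, recurrence a b u & ~ rsummable u.
Proof.
move=> Hab; have [u [ru uN uN1]] := recurrence_initial N 1 1.
exists u => // -[M HM].
have H k : 1 <= `|u (N + k)%N| /\ `|u (N + k)%N| <= `|u (N + k).+1|.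
  elim: k => [|k [h1 h2]]; first by rewrite addn0 uN uN1 normr1.
  rewrite addnS; split; first exact: le_trans h2.
  set n := (N + k)%N in h1 h2 *.
  rewrite -(ler_pM2l (b_gt0 n.+1)).
  have E : b n.+1 * `|u n.+2| = `|a n.+1 * u n.+1 + b n * u n|.
    rewrite -[b n.+1]gtr0_norm// -normrM -normrN; congr `|_|.
    by have := ru n; lra.
  have h3 : `|a n.+1| * `|u n.+1| - b n * `|u n| <= b n.+1 * `|u n.+2|.
    rewrite E -(opprK (b n * u n)); apply: le_trans (lerB_dist _ _).
    by rewrite normrN !normrM (gtr0_norm (b_gt0 n)).
  have h4 := ler_wpM2r (normr_ge0 (u n.+1)) (Hab n (leq_addr k N)).
  have h5 : b n * `|u n| <= b n * `|u n.+1| by rewrite ler_pM2l.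
  lra.
apply: (@not_bounded_harmonic (fun n => u n ^+ 2) 1 N M ltr01) => // [n|n Nn].
  exact: sqr_ge0.
have [h _] := H (n - N)%N; rewrite subnKC// in h.
apply: (@le_trans _ _ 1); first by rewrite ler_pdivrMr// mul1r ler1n.
by rewrite -[_ ^+ 2]real_normK ?num_real// -[1](expr1n _ 2) lerXn2r ?nnegrE.
Qed.

End LimitPoint.

(* The substitution v_n = (-s)^n u_n, with s the sign of the diagonal, turns
   the critical cases into a discretized Sturm-Liouville equation. *)
Section Flip.
Variables (R : realType) (a b : nat -> R) (s : R).
Hypothesis b_gt0 : forall n, 0 < b n.
Hypothesis s2 : s ^+ 2 = 1.

Definition flipped (v : nat -> R) := forall n,
  b n.+1 * v n.+2 + b n * v n = s * a n.+1 * v n.+1.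

Lemma sgn_sqr n : ((- s) ^+ n) ^+ 2 = 1.
Proof. by rewrite -exprM mulnC exprM sqrrN s2 expr1n. Qed.

Lemma flip_recurrence u : recurrence a b u -> flipped (fun n => (- s) ^+ n * u n).
Proof.
move=> ru n; have s2' : s * s = 1 by rewrite -expr2.
have E : b n.+1 * u n.+2 = - (a n.+1 * u n.+1) - b n * u n by have := ru n; lra.
set p := (- s) ^+ n.
transitivity (s * s * p * (b n.+1 * u n.+2) + p * (b n * u n)).
  by rewrite !exprS -/p; ring.
transitivity (- (s * s) * p * (a n.+1 * u n.+1)); first by rewrite s2' E; ring.
by rewrite !exprS -/p; ring.
Qed.

Lemma flip_sqr u n : ((- s) ^+ n * u n) ^+ 2 = u n ^+ 2.
Proof. by rewrite exprMn sgn_sqr mul1r. Qed.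

Lemma flipped_step v : flipped v -> forall n, v n.+2 =
  (1 + b n / b n.+1 - defect s a b n / b n.+1) * v n.+1 - b n / b n.+1 * v n.
Proof.
move=> fv n; have b0 := lt0r_neq0 (b_gt0 n.+1).
apply: (mulfI b0); rewrite /defect.
have -> : b n.+1 * v n.+2 = s * a n.+1 * v n.+1 - b n * v n by have := fv n; lra.
by field.
Qed.

Lemma flux_step v n : flipped v ->
  b n.+1 * (v n.+2 - v n.+1) = b n * (v n.+1 - v n) - defect s a b n * v n.+1.
Proof. by move=> /(_ n) fv; rewrite /defect; lra. Qed.

End Flip.

(** * A limit point test with a weighted energy *)

Section Levinson.
Variables (R : realType) (a b : nat -> R) (s beta Cb C1 : R) (N0 : nat).
Hypothesis b_gt0 : forall n, 0 < b n.
Hypothesis s2 : s ^+ 2 = 1.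
Hypothesis beta_le2 : beta <= 2.
Hypothesis Cb_ge0 : 0 <= Cb.
Hypothesis C1_ge0 : 0 <= C1.
Hypothesis N0_gt0 : (0 < N0)%N.
Hypothesis b_le : forall n, (N0 <= n)%N -> b n <= Cb * n%:R `^ beta.
Hypothesis defect_le : forall n, (N0 <= n)%N -> defect s a b n <= C1 * n%:R `^ (2 - beta).
Local Notation t n := (n%:R^-1 : R).

Let chi (L n : nat) : R := 1 - n%:R / L%:R.
(** The power n^(beta - 2) keeps theta times the defect bounded and, as beta <= 2, makes the squared
    increment of theta times b_n at most a multiple of theta. The factor chi^2 vanishes at L and
    removes the upper boundary term. *)
Let theta (L n : nat) : R := n%:R `^ (beta - 2) * chi L n ^+ 2.

Let chi_bounds L n : (n <= L)%N -> 0 <= chi L n <= 1.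
Proof.
case: L => [|L] nL.
  by move: nL; rewrite leqn0 => /eqP ->; rewrite /chi mul0r subr0 ler01 lexx.
rewrite /chi subr_ge0 ler_pdivrMr// mul1r ler_nat nL/=.
by rewrite lerBlDr lerDl divr_ge0.
Qed.

Let chi_step L n : (n < L)%N -> chi L n - chi L n.+1 = t L.
Proof. by move=> _; rewrite /chi -natr1 mulrDl mul1r; ring. Qed.

Let theta_ge0 L n : 0 <= theta L n.
Proof. by rewrite mulr_ge0 ?powR_ge0// sqr_ge0. Qed.

Let theta_step : exists2 K, 0 <= K & forall L n, (N0 <= n < L)%N ->
  (theta L n - theta L n.+1) ^+ 2 * b n <= K * theta L n.
Proof.
have [C C0 HC] := powR_taylor1 (beta - 2).
exists ((2 + C) ^+ 2 * Cb) => [|L n /andP[Nn nL]]; first by rewrite mulr_ge0// sqr_ge0.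
have n0 : (0 < n)%N by exact: leq_trans N0_gt0 Nn.
have n00 : 0 < n%:R :> R by rewrite ltr0n.
have T0 : 0 < t n by rewrite invr_gt0.
have /andP[x0 x1] := chi_bounds (ltnW nL); have /andP[x0' x1'] := chi_bounds nL.
have xs := chi_step nL.
have L00 : 0 < L%:R :> R by rewrite ltr0n (leq_trans n0 (ltnW nL)).
have LT : t L <= t n by rewrite lef_pV2 ?posrE// ler_nat (ltnW nL).
have L0 : 0 <= t L by rewrite invr_ge0.
pose x := 1 + t n.
have hx : 1 <= x <= 2.
  rewrite /x; apply/andP; split; first by rewrite lerDl ltW.
  suff : t n <= 1 by lra.
  by rewrite invf_le1// ler1n.
have E : n.+1%:R `^ (beta - 2) = n%:R `^ (beta - 2) * x `^ (beta - 2).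
  rewrite -powRM ?ltW//; last by rewrite addr_gt0.
  by congr (_ `^ _); rewrite -natr1 /x mulrDr mulr1 divff// gt_eqF.
set p := n%:R `^ (beta - 2); have p0 : 0 < p by rewrite natr_pow_gt0.
have D : `|theta L n - theta L n.+1| <= p * ((2 + C) * t n * chi L n).
  rewrite /theta E -/p.
  have -> : p * chi L n ^+ 2 - p * x `^ (beta - 2) * chi L n.+1 ^+ 2 =
     p * ((chi L n - chi L n.+1) * (chi L n + chi L n.+1) -
      (x `^ (beta - 2) - 1) * chi L n.+1 ^+ 2) by ring.
  rewrite normrM gtr0_norm// ler_wpM2l ?(ltW p0)//.
  apply: le_trans (ler_normB _ _) _.
  have h1 : `|(chi L n - chi L n.+1) * (chi L n + chi L n.+1)| <= 2 * t n * chi L n.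
    rewrite ger0_norm; last by rewrite xs mulr_ge0// addr_ge0.
    rewrite xs mulrAC; apply: (@le_trans _ _ (t n * (2 * chi L n))); last lra.
    by apply: ler_pM => //; [rewrite addr_ge0|lra].
  have h2 : `|(x `^ (beta - 2) - 1) * chi L n.+1 ^+ 2| <= C * t n * chi L n.
    rewrite normrM; apply: ler_pM => //.
      by have := HC x hx; rewrite /x (_ : 1 + t n - 1 = t n)//; ring.
    rewrite ger0_norm ?sqr_ge0//; nra.
  lra.
have D2 : (theta L n - theta L n.+1) ^+ 2 <= (p * ((2 + C) * t n * chi L n)) ^+ 2.
  rewrite -real_normK ?num_real// lerXn2r ?nnegrE//.
  by rewrite !mulr_ge0 ?(ltW p0) ?(ltW T0)//; lra.
apply: (@le_trans _ _ ((p * ((2 + C) * t n * chi L n)) ^+ 2 * (Cb * n%:R `^ beta))).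
  by apply: ler_pM => //; [rewrite sqr_ge0|rewrite ltW|rewrite b_le].
have key : p * t n ^+ 2 * n%:R `^ beta <= 1.
  have -> : t n ^+ 2 = n%:R `^ (- 2) by rewrite powR_invn// exprVn.
  rewrite /p -!natr_powD//.
  apply: (@le_trans _ _ (n%:R `^ 0)); last by rewrite powRr0.
  have h : beta - 2 - 2 + beta <= 0 by move: beta_le2; lra.
  exact: natr_pow_le h.
have -> : (p * ((2 + C) * t n * chi L n)) ^+ 2 * (Cb * n%:R `^ beta) =
   ((2 + C) ^+ 2 * Cb * theta L n) * (p * t n ^+ 2 * n%:R `^ beta).
  by rewrite /theta -/p; ring.
by rewrite -[leRHS]mulr1 ler_wpM2l// mulr_ge0 ?theta_ge0// mulr_ge0// sqr_ge0.
Qed.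

(** Summation by parts of theta v against the flux equation. The term with the increment of theta is
    split by the arithmetic-geometric mean, half of the energy being absorbed on the left; the bound
    does not depend on L. *)
Let energy v (M : R) : flipped a b s v -> (forall n, \sum_(0 <= k < n) v k ^+ 2 <= M) ->
  exists K, forall L, (N0 <= L)%N ->
    \sum_(N0 <= n < L) theta L n * b n * (v n.+1 - v n) ^+ 2 <= K.
Proof.
move=> fv HM; have [K K0 HK] := theta_step.
pose d n := b n * (v n.+1 - v n).
exists (2 * (N0%:R `^ (beta - 2) * `|d N0 * v N0| + (C1 + K / 2) * M)) => L NL.
have step n : (N0 <= n < L)%N -> theta L n * b n * (v n.+1 - v n) ^+ 2 / 2 <=
    (theta L n.+1 * (d n.+1 * v n.+1) - theta L n * (d n * v n)) +
    (C1 + K / 2) * v n.+1 ^+ 2.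
  move=> /andP[Nn nL]; have n0 : (0 < n)%N by exact: leq_trans N0_gt0 Nn.
  have h := HK L n; rewrite Nn nL in h; have {}h := h isT.
  pose D := theta L n * b n * (v n.+1 - v n) ^+ 2.
  have D0 : 0 <= D by rewrite mulr_ge0 ?sqr_ge0// mulr_ge0// ltW.
  have E : D = (theta L n.+1 * (d n.+1 * v n.+1) - theta L n * (d n * v n)) +
      theta L n.+1 * defect s a b n * v n.+1 ^+ 2 +
      (theta L n - theta L n.+1) * d n * v n.+1.
    by rewrite /D /d (flux_step n fv); ring.
  have h1 : theta L n.+1 * defect s a b n <= C1.
    apply: (@le_trans _ _ (theta L n.+1 * (C1 * n%:R `^ (2 - beta)))).
      by rewrite ler_wpM2l// defect_le.
    apply: (@le_trans _ _ (n%:R `^ (beta - 2) * (C1 * n%:R `^ (2 - beta)))).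
      rewrite ler_wpM2r ?mulr_ge0 ?powR_ge0// /theta -[leRHS]mulr1.
      have /andP[c0 c1] := chi_bounds nL.
      apply: ler_pM; rewrite ?powR_ge0 ?sqr_ge0// ?exprn_ile1//.
      have -> : beta - 2 = - (2 - beta) by ring.
      rewrite !powRN lef_pV2 ?posrE ?natr_pow_gt0// ge0_ler_powR ?nnegrE ?subr_ge0//.
      by rewrite ler_nat.
    rewrite mulrCA -natr_powD// (_ : beta - 2 + (2 - beta) = 0) ?powRr0 ?mulr1//; ring.
  have h2 : (theta L n - theta L n.+1) * d n * v n.+1 <= (D + K * v n.+1 ^+ 2) / 2.
    apply: le_trans (ler_norm _) _.
    have S0 : 0 <= (D + K * v n.+1 ^+ 2) / 2.
      by rewrite divr_ge0// addr_ge0// mulr_ge0// sqr_ge0.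
    rewrite -(@ler_pXn2r _ 2) ?nnegrE// real_normK ?num_real//.
    have k1 : ((theta L n - theta L n.+1) * d n * v n.+1) ^+ 2 <= D * (K * v n.+1 ^+ 2).
      have -> : ((theta L n - theta L n.+1) * d n * v n.+1) ^+ 2 =
        ((theta L n - theta L n.+1) ^+ 2 * b n) * (b n * (v n.+1 - v n) ^+ 2 * v n.+1 ^+ 2).
        by rewrite /d; ring.
      have -> : D * (K * v n.+1 ^+ 2) =
        (K * theta L n) * (b n * (v n.+1 - v n) ^+ 2 * v n.+1 ^+ 2) by rewrite /D; ring.
      by rewrite ler_wpM2r// mulr_ge0 ?sqr_ge0// mulr_ge0 ?sqr_ge0// ltW.
    apply: le_trans k1 _.
    have := sqr_ge0 (D - K * v n.+1 ^+ 2).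
    set y := K * _; nra.
  have h3 := ler_wpM2r (sqr_ge0 (v n.+1)) h1.
  rewrite -/D; lra.
have sumstep : \sum_(N0 <= n < L) theta L n * b n * (v n.+1 - v n) ^+ 2 / 2 <=
   (theta L L * (d L * v L) - theta L N0 * (d N0 * v N0)) + (C1 + K / 2) * M.
  apply: (@le_trans _ _ (\sum_(N0 <= n < L)
      ((theta L n.+1 * (d n.+1 * v n.+1) - theta L n * (d n * v n)) +
      (C1 + K / 2) * v n.+1 ^+ 2))).
    by apply: ler_sum_nat => n; exact: step.
  rewrite big_split/= telescope_sumr// lerD2l -mulr_sumr ler_wpM2l ?addr_ge0 ?divr_ge0//.
  apply: le_trans (HM L.+1); rewrite big_nat_recl//= ler_wpDl ?sqr_ge0//.
  rewrite [leRHS](@big_cat_nat _ _ _ N0)//= ler_wpDl// sumr_ge0// => k _.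
  exact: sqr_ge0.
have tLL : theta L L = 0.
  rewrite /theta /chi divff ?subrr ?expr0n ?mulr0// pnatr_eq0 -lt0n.
  exact: leq_trans NL.
have tN : - (theta L N0 * (d N0 * v N0)) <= N0%:R `^ (beta - 2) * `|d N0 * v N0|.
  apply: le_trans (ler_norm _) _; rewrite normrN normrM ler_wpM2r//.
  rewrite ger0_norm// /theta ler_piMr ?powR_ge0//.
  have /andP[c0 c1] := chi_bounds NL; exact: exprn_ile1.
move: sumstep; rewrite -mulr_suml tLL mul0r; lra.
Qed.

(** The Casoratian p dq - q dp has modulus 1, whence w <= p^2 + q^2 + w^2 (dp^2 + dq^2) for w =
    chi/n, and the last term is bounded by the energies. Were both solutions square-summable, the
    harmonic series would be bounded. *)
Lemma levinson : ~ (rsummable (rpol1 a b) /\ rsummable (rpol2 a b)).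
Proof.
move=> [[M HM] [M' HM']].
pose p n := (- s) ^+ n * rpol1 a b n; pose q n := (- s) ^+ n * rpol2 a b n.
have fp : flipped a b s p by apply: flip_recurrence => //; exact: recurrence_rpol1.
have fq : flipped a b s q by apply: flip_recurrence => //; exact: recurrence_rpol2.
have Mp n : \sum_(0 <= k < n) p k ^+ 2 <= M.
  by apply: le_trans (HM n); apply: ler_sum => k _; rewrite flip_sqr.
have Mq n : \sum_(0 <= k < n) q k ^+ 2 <= M'.
  by apply: le_trans (HM' n); apply: ler_sum => k _; rewrite flip_sqr.
have [K HK] := energy fp Mp; have [K' HK'] := energy fq Mq.
have [L] := harmonic_large N0 (1 + (M + M') + Cb * (K + K')).
have [LN|NL] := leqP L N0.
  have M0 : 0 <= M by apply: le_trans (HM 0%N); rewrite big_geq.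
  have M0' : 0 <= M' by apply: le_trans (HM' 0%N); rewrite big_geq.
  have K0 : 0 <= K by apply: le_trans (HK N0 (leqnn _)); rewrite big_geq.
  have K0' : 0 <= K' by apply: le_trans (HK' N0 (leqnn _)); rewrite big_geq.
  have : 0 <= Cb * (K + K') by rewrite mulr_ge0// addr_ge0.
  by rewrite big_geq//; lra.
rewrite ltNge => /negP; apply.
have L0 : (0 < L)%N by exact: leq_ltn_trans NL.
have step n : (N0 <= n < L)%N -> n.+1%:R^-1 <= t L + (p n ^+ 2 + q n ^+ 2) +
    (Cb * (theta L n * b n * (p n.+1 - p n) ^+ 2) +
     Cb * (theta L n * b n * (q n.+1 - q n) ^+ 2)).
  move=> /andP[Nn nL]; have n0 : (0 < n)%N by exact: leq_trans N0_gt0 Nn.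
  have n00 : 0 < n%:R :> R by rewrite ltr0n.
  pose w := chi L n * t n.
  have w0 : 0 <= w by rewrite mulr_ge0 ?invr_ge0//; case/andP: (chi_bounds (ltnW nL)).
  (* The cutoff replaces 1/n by w at the cost of 1/L per term, at most 1 in total. *)
  have wE : t n = t L + w by rewrite /w /chi; field; rewrite !pnatr_eq0 -!lt0n n0 L0.
  have h0 : n.+1%:R^-1 <= t n by rewrite lef_pV2 ?posrE ?ltr0n// ler_nat.
  pose dp := b n * (p n.+1 - p n); pose dq := b n * (q n.+1 - q n).
  have W : (p n * dq - q n * dp) ^+ 2 = 1.
    have -> : p n * dq - q n * dp = (- s) ^+ n * (- s) ^+ n.+1 *
       (b n * (rpol1 a b n * rpol2 a b n.+1 - rpol1 a b n.+1 * rpol2 a b n)).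
      by rewrite /dp /dq /p /q; ring.
    by rewrite rpol_wronskian// mulr1 exprMn !sgn_sqr// mulr1.
  have wd x : w ^+ 2 * (b n * x) ^+ 2 <= Cb * (theta L n * b n * x ^+ 2).
    have -> : w ^+ 2 * (b n * x) ^+ 2 = (chi L n ^+ 2 * b n * x ^+ 2) * (t n ^+ 2 * b n).
      by rewrite /w; ring.
    have -> : Cb * (theta L n * b n * x ^+ 2) =
       (chi L n ^+ 2 * b n * x ^+ 2) * (Cb * n%:R `^ (beta - 2)).
      by rewrite /theta; ring.
    apply: ler_wpM2l; first exact: mulr_ge0 (mulr_ge0 (sqr_ge0 _) (ltW (b_gt0 n))) (sqr_ge0 _).
    apply: (@le_trans _ _ (t n ^+ 2 * (Cb * n%:R `^ beta))).
      by rewrite ler_wpM2l ?sqr_ge0// b_le.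
    rewrite addrC natr_powD// powR_invn// exprVn; lra.
  have h1 : w <= (p n ^+ 2 + q n ^+ 2) + (w ^+ 2 * dp ^+ 2 + w ^+ 2 * dq ^+ 2).
    have : w ^+ 2 <= (p n ^+ 2 + q n ^+ 2) * (w ^+ 2 * dp ^+ 2 + w ^+ 2 * dq ^+ 2).
      have := sqr_ge0 (p n * w * dp + q n * w * dq).
      have : w ^+ 2 * (p n * dq - q n * dp) ^+ 2 = w ^+ 2 by rewrite W mulr1.
      nra.
    set A := p n ^+ 2 + q n ^+ 2; set B := w ^+ 2 * dp ^+ 2 + _ => hAB.
    have A0 : 0 <= A by rewrite addr_ge0 ?sqr_ge0.
    have B0 : 0 <= B by rewrite addr_ge0// mulr_ge0 ?sqr_ge0.
    rewrite -(@ler_pXn2r _ 2) ?nnegrE ?(addr_ge0 A0 B0)//.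
    clearbody A B; have := mulr_ge0 A0 B0; have := sqr_ge0 A; have := sqr_ge0 B.
    by rewrite sqrrD mulr2n; lra.
  have h2 := wd (p n.+1 - p n); have h3 := wd (q n.+1 - q n).
  apply: le_trans h0 _; rewrite wE -addrA lerD2l.
  by apply: le_trans h1 _; rewrite lerD2l; exact: lerD.
apply: (@le_trans _ _ _ _ _ (ler_sum_nat step)).
rewrite !big_split/= -!mulr_sumr sumr_const_nat.
have hL : t L *+ (L - N0) <= 1.
  have -> : t L *+ (L - N0) = (L - N0)%:R / L%:R by rewrite mulr_natl.
  by rewrite ler_pdivrMr ?ltr0n// mul1r ler_nat leq_subr.
have tailP (w : nat -> R) (m : R) : (forall n, \sum_(0 <= k < n) w k ^+ 2 <= m) ->
    \sum_(N0 <= k < L) w k ^+ 2 <= m.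
  move=> H; apply: le_trans (H L).
  rewrite [leRHS](@big_cat_nat _ _ _ N0) ?(ltnW NL)//= ler_wpDl// sumr_ge0// => k _.
  exact: sqr_ge0.
have := tailP _ _ Mp; have := tailP _ _ Mq.
have := ler_wpM2l Cb_ge0 (HK L (ltnW NL)); have := ler_wpM2l Cb_ge0 (HK' L (ltnW NL)).
lra.
Qed.

End Levinson.

Section Comparison.
Variables (R : realType) (a b : nat -> R) (s : R).
Hypothesis b_gt0 : forall n, 0 < b n.
Hypothesis s2 : s ^+ 2 = 1.
Local Notation t n := (n%:R^-1 : R).

(* The Casoratian of a solution against a positive subsolution is
   nondecreasing, so a solution starting like w stays above w. *)
Lemma comparison (w : nat -> R) N :
  (forall n, (N <= n)%N -> 0 < w n) ->
  (forall n, (N <= n)%N -> b n.+1 * w n.+2 + b n * w n <= s * a n.+1 * w n.+1) ->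
  exists2 u, recurrence a b u & forall n, (N <= n)%N -> w n ^+ 2 <= u n ^+ 2.
Proof.
move=> w0 Hw.
have [u [ru uN uN1]] := recurrence_initial a b_gt0 N ((- s) ^+ N * w N) ((- s) ^+ N.+1 * w N.+1).
exists u => //.
pose v n := (- s) ^+ n * u n.
have fv : flipped a b s v by exact: flip_recurrence.
have vN : v N = w N by rewrite /v uN mulrA -expr2 sgn_sqr// mul1r.
have vN1 : v N.+1 = w N.+1 by rewrite /v uN1 mulrA -expr2 sgn_sqr// mul1r.
have H k : w (N + k)%N <= v (N + k)%N /\
    v (N + k)%N * w (N + k).+1 <= v (N + k).+1 * w (N + k)%N.
  elim: k => [|k [h1 h2]]; first by rewrite addn0 vN vN1 mulrC.
  rewrite addnS; set n := (N + k)%N in h1 h2 *.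
  have Nn : (N <= n)%N by exact: leq_addr.
  have wn := w0 n Nn; have wn1 := w0 n.+1 (leqW Nn).
  have vn : 0 < v n by exact: lt_le_trans h1.
  have h1' : w n.+1 <= v n.+1.
    rewrite -(ler_pM2r wn); apply: le_trans h2.
    by rewrite mulrC ler_pM2r.
  split=> //; have vn1 : 0 < v n.+1 by exact: lt_le_trans h1'.
  rewrite -(ler_pM2l (b_gt0 n.+1)).
  have e1 : b n.+1 * v n.+2 = s * a n.+1 * v n.+1 - b n * v n by have := fv n; lra.
  have e2 : v n.+1 * (b n.+1 * w n.+2 + b n * w n) <= v n.+1 * (s * a n.+1 * w n.+1).
    by rewrite ler_pM2l// Hw.
  have e3 : b n * (v n * w n.+1) <= b n * (v n.+1 * w n) by rewrite ler_pM2l.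
  rewrite [leRHS]mulrA e1; lra.
move=> n Nn; rewrite -(flip_sqr s2 u n) -/(v n).
have [h _] := H (n - N)%N; rewrite subnKC// in h.
by rewrite lerXn2r ?nnegrE ?(ltW (w0 n Nn))// (le_trans (ltW (w0 n Nn))).
Qed.

Lemma subsolution_expansion e rho W (beta c g r2 : R) : 0 < e -> e <= 3 ->
  xp e rho 1 (- beta) r2 -> xp e W 0 0 c ->
  xp e (fun n => (1 + 2%:R * t n) `^ g - (1 + 1%:R * t n) `^ g
     - rho n * ((1 + 1%:R * t n) `^ g - 1) + W n * (1 + 1%:R * t n) `^ g)
    0 0 (g * (g + beta - 1) + c).
Proof.
move=> e0 e3 hr hW; have p1 := xp_pow e3 g 1; have p2 := xp_pow e3 g 2.
apply: xp_eq (xpD (xpB (xpB p2 p1) (xpM e0 e3 hr (xpB p1 (xp_const e3 1)))) (xpM e0 e3 hW p1)).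
- by ring.
- by ring.
- by field.
Qed.

(** The hypothesis on c says f(-1/2) <= 0. In case of equality n^(-1/2) alone need not be a
    subsolution, because of the remainder n^(-2-delta); adding n^(-1/2-eps), for which f is strictly
    negative, absorbs it. *)
Lemma euler_nonsummable (beta c delta r2 : R) : 0 < delta -> delta <= 1 -> 2 < beta ->
  xp (2 + delta) (fun n => b n / b n.+1) 1 (- beta) r2 ->
  xp (2 + delta) (fun n => defect s a b n / b n.+1) 0 0 c ->
  c <= (beta - 3 / 2) / 2 ->
  exists2 u, recurrence a b u & ~ rsummable u.
Proof.
move=> d0 d1 b2 hr hW cle.
have e0 : 0 < 2 + delta by lra.
have e3 : 2 + delta <= 3 by lra.
(* eps < delta lets the correction dominate the remainder, and eps < beta - 2 makes f(g') = f(g) -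
   eps (beta - 2 - eps) negative. *)
pose eps := Num.min (delta / 2) ((beta - 2) / 2).
have eps0 : 0 < eps by rewrite lt_min; apply/andP; split; lra.
have epsd : eps <= delta / 2 by rewrite ge_min lexx.
have epsb : eps <= (beta - 2) / 2 by rewrite ge_min lexx orbT.
pose f (x : R) := x * (x + beta - 1) + c.
pose g : R := - (1 / 2); pose g' := g - eps.
have fg : f g <= 0 by rewrite /f /g; lra.
have fg' : f g' < 0.
  have -> : f g' = f g - eps * (beta - 2 - eps) by rewrite /f /g' /g; field.
  have : 0 < eps * (beta - 2 - eps) by rewrite mulr_gt0//; lra.
  lra.
pose L (x : R) n := (1 + 2%:R * t n) `^ x - (1 + 1%:R * t n) `^ x
     - b n / b n.+1 * ((1 + 1%:R * t n) `^ x - 1) +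
     defect s a b n / b n.+1 * (1 + 1%:R * t n) `^ x.
have Lx (x : R) : OO (2 + delta) (fun n => L x n - f x * t n ^+ 2).
  apply: OO_ext (subsolution_expansion x e0 e3 hr hW) => n _ /=; rewrite /L /f; ring.
pose eta := - f g' / 2.
have eta0 : 0 < eta by rewrite /eta; lra.
have l1 : 2 + eps < 2 + delta by lra.
have l2 : 2 < 2 + delta by lra.
have [N1 H1] := OO_lt l1 eta0 (Lx g); have [N2 H2] := OO_lt l2 eta0 (Lx g').
pose w n : R := n%:R `^ g + n%:R `^ g'.
have w0 n : (0 < n)%N -> 0 < w n by move=> n0; rewrite addr_gt0// natr_pow_gt0.
have Ls (x : R) n : (0 < n)%N ->
   b n.+1 * n.+2%:R `^ x + b n * n%:R `^ x - s * a n.+1 * n.+1%:R `^ x =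
   b n.+1 * n%:R `^ x * L x n.
  move=> n0; have n00 : 0 < n%:R :> R by rewrite ltr0n.
  have ex (k : nat) : (n + k)%:R `^ x = n%:R `^ x * (1 + k%:R * t n) `^ x.
    have k0 : 0 <= 1 + k%:R * t n by rewrite addr_ge0// mulr_ge0// invr_ge0.
    rewrite -powRM ?(ltW n00)//.
    by congr (_ `^ _); rewrite natrD mulrDr mulr1 mulrCA divff ?mulr1// gt_eqF.
  have -> : n.+2 = (n + 2)%N by rewrite addn2.
  rewrite -[in X in _ - _ * X]addn1 !ex /L /defect; field.
  by rewrite gt_eqF.
pose N := (N1 + N2).+1.
have [|n Nn|u ru Hu] := @comparison w N.
- by move=> n Nn; rewrite w0// (leq_ltn_trans _ Nn).
- have n0 : (0 < n)%N by exact: leq_ltn_trans Nn.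
  have a1 := H1 n (leq_trans (leq_addr _ _) (ltnW Nn)).
  have a2 := H2 n (leq_trans (leq_addl _ _) (ltnW Nn)).
  rewrite -subr_le0 /w.
  have -> : b n.+1 * (n.+2%:R `^ g + n.+2%:R `^ g') + b n * (n%:R `^ g + n%:R `^ g')
      - s * a n.+1 * (n.+1%:R `^ g + n.+1%:R `^ g') =
      b n.+1 * (n%:R `^ g * L g n + n%:R `^ g' * L g' n).
    transitivity (b n.+1 * n%:R `^ g * L g n + b n.+1 * n%:R `^ g' * L g' n); last by ring.
    by rewrite -!Ls//; ring.
  rewrite pmulr_rle0//.
  have T2 : t n ^+ 2 = n%:R `^ (- 2) by rewrite powR_invn// exprVn.
  have T20 : 0 <= t n ^+ 2 by rewrite sqr_ge0.
  have b1 : L g n <= eta * n%:R `^ (- (2 + eps)).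
    have := le_trans (ler_norm _) a1; have : f g * t n ^+ 2 <= 0 by rewrite mulr_le0_ge0.
    lra.
  have b2' : L g' n <= (f g' + eta) * n%:R `^ (- 2).
    have := le_trans (ler_norm _) a2; rewrite -T2; lra.
  have c1 := ler_wpM2l (powR_ge0 n%:R g) b1.
  have c2 := ler_wpM2l (powR_ge0 n%:R g') b2'.
  have E1 : n%:R `^ g * n%:R `^ (- (2 + eps)) = n%:R `^ (g - 2 - eps) :> R.
    by rewrite -natr_powD//; congr (_ `^ _); ring.
  have E2 : n%:R `^ g' * n%:R `^ (- 2) = n%:R `^ (g - 2 - eps) :> R.
    by rewrite -natr_powD//; congr (_ `^ _); rewrite /g'; ring.
  rewrite mulrCA E1 in c1; rewrite mulrCA E2 in c2.
  have : (f g' + 2 * eta) * n%:R `^ (g - 2 - eps) = 0 by rewrite /eta; field.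
  lra.
exists u => // -[M HM].
apply: (@not_bounded_harmonic _ (fun n => u n ^+ 2) 1 N M ltr01) => // [n|n Nn].
  exact: sqr_ge0.
apply: le_trans (Hu n Nn).
have n0 : (0 < n)%N by exact: leq_ltn_trans Nn.
apply: (@le_trans _ _ ((n%:R `^ g) ^+ 2)).
  rewrite expr2 -natr_powD// /g (_ : - (1 / 2) + - (1 / 2) = -1); last by field.
  by rewrite natr_powN1 mul1r lef_pV2 ?posrE ?ltr0n// ler_nat.
by rewrite lerXn2r ?nnegrE ?powR_ge0 ?(ltW (w0 n n0))// lerDl powR_ge0.
Qed.

End Comparison.

(** * Upper bounds for the Nevanlinna matrix *)

Section PowerSums.
Variable R : realType.

Lemma harmonic_le_ln N : \sum_(1 <= n < N.+2) n%:R^-1 <= 1 + ln N.+1%:R :> R.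
Proof.
elim: N => [|N ih]; first by rewrite big_nat1 invr1 ln1 addr0.
rewrite big_nat_recr//=.
have n1 : (0 : R) < N.+1%:R by rewrite ltr0n.
have n2 : (0 : R) < N.+2%:R by rewrite ltr0n.
have : ln (1 + - N.+2%:R^-1) <= - N.+2%:R^-1 :> R.
  by rewrite le_ln1Dx// ltrN2 invf_lt1// ltr1n.
have -> : 1 + - N.+2%:R^-1 = N.+1%:R / N.+2%:R :> R.
  by rewrite -[N.+2]addn1 natrD; field; rewrite -natr1 in n2; rewrite gt_eqF.
rewrite lnM ?posrE ?invr_gt0// lnV ?posrE// => h.
apply: le_trans (lerD ih (lexx _)) _.
by move: (ln N.+1%:R) (ln N.+2%:R) (N.+2%:R^-1) h => x y t; lra.
Qed.

Lemma power_tail (gam : R) N n : 1 < gam -> (0 < N)%N ->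
  \sum_(N.+1 <= k < n) k%:R `^ (- gam) <= N%:R `^ (1 - gam) / (gam - 1).
Proof.
move=> g1 N0; have g0 : 0 < gam - 1 by rewrite subr_gt0.
have step k : (0 < k)%N -> k.+1%:R `^ (- gam) <=
    (k%:R `^ (1 - gam) - k.+1%:R `^ (1 - gam)) / (gam - 1).
  move=> k0; have k00 : 0 < k%:R :> R by rewrite ltr0n.
  have k1 : 0 < k.+1%:R :> R by rewrite ltr0n.
  rewrite ler_pdivlMr//.
  have t1 : 0 < k.+1%:R^-1 :> R by rewrite invr_gt0.
  have y0 : 0 < 1 - k.+1%:R^-1 :> R by rewrite subr_gt0 invf_lt1// ltr1n ltnS.
  have kE : k%:R = k.+1%:R * (1 - k.+1%:R^-1) :> R.
    by rewrite mulrBr mulr1 divff ?gt_eqF// -natr1 addrK.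
  rewrite {1}kE powRM ?(ltW k1) ?(ltW y0)//.
  have h : 1 + (gam - 1) * k.+1%:R^-1 <= (1 - k.+1%:R^-1) `^ (1 - gam) :> R.
    rewrite /powR gt_eqF//; apply: le_trans (expR_ge1Dx _); rewrite lerD2l.
    have l : ln (1 + - k.+1%:R^-1) <= - k.+1%:R^-1 :> R.
      by rewrite le_ln1Dx// ltrN2 invf_lt1// ltr1n ltnS.
    have := ler_wpM2l (ltW g0) l.
    by move: (ln _) => x; move: (k.+1%:R^-1) => y; lra.
  have E : k.+1%:R `^ (- gam) = k.+1%:R `^ (1 - gam) * k.+1%:R^-1 :> R.
    by rewrite -natr_powN1 -natr_powD//; congr (_ `^ _); ring.
  rewrite E; have := ler_wpM2l (powR_ge0 k.+1%:R (1 - gam)) h.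
  move: ((1 - _) `^ _) => z; move: (k.+1%:R `^ _) => x.
  by move: (k.+1%:R^-1) => y; lra.
have [nN|Nn] := leqP n N.+1.
  by rewrite big_geq// divr_ge0 ?powR_ge0// ltW.
case: n Nn => // n; rewrite ltnS => Nn.
rewrite big_add1 /=.
apply: (@le_trans _ _ (\sum_(N <= k < n) (k%:R `^ (1 - gam) - k.+1%:R `^ (1 - gam)) / (gam - 1))).
  by apply: ler_sum_nat => k /andP[Nk _]; apply: step; exact: leq_trans Nk.
rewrite -mulr_suml ler_pM2r ?invr_gt0//.
have -> : \sum_(N <= k < n) (k%:R `^ (1 - gam) - k.+1%:R `^ (1 - gam)) =
    - \sum_(N <= k < n) (k.+1%:R `^ (1 - gam) - k%:R `^ (1 - gam)) :> R.
  by rewrite -sumrN; apply: eq_bigr => k _; rewrite opprB.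
rewrite telescope_sumr ?(ltnW Nn)// opprB lerBlDr lerDl powR_ge0//.
Qed.

(** Bookkeeping for [coord_bound]: factors polynomial in r and N cost logarithms in the exponent,
    and the crude factor to the power M+1 costs M logarithms, so one exponential of (T + M + 1)
    times a logarithm covers the product. *)
Lemma growth_collect (T S lnN r beta K C4 C6 y : R) (M : nat) :
  0 <= T -> 1 <= r -> 0 <= lnN -> 1 < beta -> 1 <= K -> 0 <= C4 -> 0 <= C6 ->
  0 <= y -> y <= (1 + r) * expR (beta * lnN) -> S <= C4 * ((T + 1) * (1 + lnN)) ->
  expR (2 * T) * expR S * C6 * y ^+ 3 * (4 * K * (1 + r)) ^+ M.+1 <=
  expR ((2 + C4 + C6 + 3 * (1 + beta) + (4 * K + 1)) *
        ((T + M%:R + 1) * (1 + lnN + ln (1 + r)))).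
Proof.
move=> T0 r1 lnN0 be1 K1 C40 C60 y0 yle HS.
set l := 1 + lnN + ln (1 + r); set tau := T + M%:R + 1.
have r0 : 0 < 1 + r by lra.
have lnr : 0 <= ln (1 + r) by rewrite ln_ge0//; lra.
have elnr : expR (ln (1 + r)) = 1 + r by rewrite lnK.
have l1 : 1 <= l by rewrite /l; lra.
have M0 : 0 <= M%:R :> R by [].
have tau1 : 1 <= tau by rewrite /tau; lra.
have tl : 1 <= tau * l by nra.
have ltl : l <= tau * l by rewrite ler_peMl//; lra.
have le_exp (x : R) : x <= expR x by apply: ltW; apply: lt_le_trans (expR_ge1Dx _); rewrite ltrDr.
have ey : y <= expR ((1 + beta) * l).
  apply: le_trans yle _; rewrite -{1}elnr -expRD ler_expR /l.
  have : 0 <= beta * ln (1 + r) by rewrite mulr_ge0//; lra.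
  lra.
have eB : 4 * K * (1 + r) <= expR ((4 * K + 1) * l).
  have -> : expR ((4 * K + 1) * l) = expR (4 * K * l) * expR l.
    by rewrite -expRD; congr expR; ring.
  apply: ler_pM; [lra|lra| |].
    apply: le_trans (le_exp (4 * K)) _; rewrite ler_expR ler_peMr//; lra.
  by rewrite -elnr ler_expR /l; lra.
have eBM : (4 * K * (1 + r)) ^+ M.+1 <= expR ((4 * K + 1) * (tau * l)).
  apply: (@le_trans _ _ (expR ((4 * K + 1) * l) ^+ M.+1)).
    by rewrite lerXn2r ?nnegrE ?expR_ge0// !mulr_ge0//; lra.
  rewrite -expRM_natl ler_expR -natr1.
  have h1 : (M%:R + 1) * l <= tau * l by rewrite ler_wpM2r /tau; lra.
  have h0 : 0 <= 4 * K + 1 by lra.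
  have := ler_wpM2l h0 h1; lra.
have eC : C6 <= expR (C6 * (tau * l)).
  by apply: le_trans (le_exp C6) _; rewrite ler_expR ler_peMr.
have ey3 : y ^+ 3 <= expR (3 * (1 + beta) * (tau * l)).
  apply: (@le_trans _ _ (expR ((1 + beta) * l) ^+ 3)).
    by rewrite lerXn2r ?nnegrE ?expR_ge0.
  rewrite -expRM_natl ler_expR -mulrA ler_wpM2l// ler_wpM2l//; lra.
have eS : expR S <= expR (C4 * (tau * l)).
  rewrite ler_expR; apply: le_trans HS _; rewrite ler_wpM2l//.
  by apply: ler_pM; rewrite /tau /l; lra.
have eT : expR (2 * T) <= expR (2 * (tau * l)).
  rewrite ler_expR ler_wpM2l//; apply: (@le_trans _ _ tau); first by rewrite /tau; lra.
  by rewrite ler_peMr//; lra.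
have -> : expR ((2 + C4 + C6 + 3 * (1 + beta) + (4 * K + 1)) * (tau * l)) =
    expR (2 * (tau * l)) * expR (C4 * (tau * l)) * expR (C6 * (tau * l)) *
    expR (3 * (1 + beta) * (tau * l)) * expR ((4 * K + 1) * (tau * l)).
  by rewrite -!expRD -!mulrDl.
have y30 : 0 <= y ^+ 3 by rewrite exprn_ge0.
have B0 : 0 <= (4 * K * (1 + r)) ^+ M.+1 by rewrite exprn_ge0// !mulr_ge0//; lra.
have ge (x : R) : 0 <= expR x := expR_ge0 x.
have h2 := mulr_ge0 (ge (2 * T)) (ge S); have h3 := mulr_ge0 h2 C60.
have h4 := mulr_ge0 h3 y30.
exact: (ler_pM h4 B0 (ler_pM h3 y30 (ler_pM h2 C60 (ler_pM (ge _) (ge _) eT eS) eC) ey3) eBM).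
Qed.

End PowerSums.

(** * Energy estimates at the spectral parameter z *)

Section ComplexFlip.
Variables (R : realType) (a b : nat -> R) (s : R).
Hypothesis s2 : s ^+ 2 = 1.
Implicit Types u : nat -> R[i].

Definition cflip u n : R[i] := ((- s) ^+ n)%:C%C * u n.
(** The quasi-derivative of the flipped solution. With it the recurrence is a first-order system: v
    changes by d/b, and d by -(defect + s z) v. *)
Definition cflux u n : R[i] := (b n)%:C%C * (cflip u n.+1 - cflip u n).

Lemma cmod_cflip u n : cmod (cflip u n) = cmod (u n).
Proof.
rewrite cmodM cmod_real normrX normrN.
have -> : `|s| = 1 by exact: norm_of_sqr1.
by rewrite expr1n mul1r.
Qed.

Lemma cflux_step z u n :
  (b n.+1)%:C%C * u n.+2 = (z - (a n.+1)%:C%C) * u n.+1 - (b n)%:C%C * u n ->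
  cflux u n.+1 = cflux u n - ((defect s a b n)%:C%C + s%:C%C * z) * cflip u n.+1.
Proof.
move=> three_term.
have sC : s%:C%C * s%:C%C = 1 :> R[i] by rewrite -rmorphM -expr2 s2.
pose x : R[i] := ((- s) ^+ n)%:C%C.
have E1 : ((- s) ^+ n.+1)%:C%C = - s%:C%C * x by rewrite exprS rmorphM rmorphN.
have E2 : ((- s) ^+ n.+2)%:C%C = x.
  by rewrite 2!exprS mulrA mulrNN -expr2 s2 mul1r.
have F : (defect s a b n)%:C%C = (b n.+1)%:C%C + (b n)%:C%C - s%:C%C * (a n.+1)%:C%C :> R[i].
  by rewrite /defect rmorphB rmorphD rmorphM.
rewrite /cflux /cflip E1 E2 F -/x.
transitivity (x * ((b n.+1)%:C%C * u n.+2) + (b n.+1)%:C%C * (s%:C%C * x * u n.+1)).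
  by cring.
rewrite three_term.
transitivity ((b n)%:C%C * (- s%:C%C * x * u n.+1 - x * u n) +
  ((b n.+1)%:C%C + (b n)%:C%C) * (s%:C%C * x * u n.+1)
  + (s%:C%C * s%:C%C) * (x * (z - (a n.+1)%:C%C) * u n.+1)).
  by rewrite sC; cring.
by cring.
Qed.

End ComplexFlip.

Section UpperGrowth.
Variables (R : realType) (a b : nat -> R) (s beta cb Cb K Ch D : R).
Hypothesis b_gt0 : forall n, 0 < b n.
Hypothesis s2 : s ^+ 2 = 1.
Hypothesis beta_gt1 : 1 < beta.
Hypothesis cb_gt0 : 0 < cb.
Hypothesis Cb_gt0 : 0 < Cb.
Hypothesis b_bounds : forall n, (0 < n)%N -> cb * n%:R `^ beta <= b n <= Cb * n%:R `^ beta.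
Hypothesis K_ge1 : 1 <= K.
Hypothesis K_b : forall n, (b n)^-1 <= K.
Hypothesis K_a : forall n, `|a n| / b n <= K.
Hypothesis K_rho : forall n, b n / b n.+1 <= K.
Hypothesis Ch_ge1 : 1 <= Ch.
Local Notation p := (fun k => pol1 a b k (0 : R[i])).
Local Notation q := (fun k => pol2 a b k (0 : R[i])).
Hypothesis Ch_p : forall n, cmod (p n) <= Ch.
Hypothesis Ch_q : forall n, cmod (q n) <= Ch.
Hypothesis D_ge0 : 0 <= D.

Section OneSolution.
Variables (z s0 : R[i]) (u : nat -> R[i]).
Hypothesis Ju : forall k, jacobi_mul a b u k = z * u k + s0 * e0 R k.
Hypothesis u0_le1 : cmod (u 0%N) <= 1.
Hypothesis s0_le1 : cmod s0 <= 1.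
Hypothesis z_ge1 : 1 <= cmod z.
Local Notation r := (cmod z).

Let G n := cmod (u n) + cmod (u n.+1).

Let G_ge0 n : 0 <= G n.
Proof. by rewrite addr_ge0 ?cmod_ge0. Qed.

Let three_term n : (b n.+1)%:C%C * u n.+2 = (z - (a n.+1)%:C%C) * u n.+1 - (b n)%:C%C * u n.
Proof.
have := Ju n.+1; rewrite jacobi_mulE mulr0 addr0 => E.
by rewrite mulrBl -E; cring.
Qed.

(** Each row costs a factor of order r. Applied only up to row M, this contributes M log r to the
    exponent. *)
Let crude n : G n <= (4 * K * (1 + r)) ^+ n.+1.
Proof.
have K1 := K_ge1; have z1 := z_ge1.
have K0 : 0 <= K by lra.
have r0 : 0 <= 1 + r by lra.
have Kr : 1 <= K * (1 + r) by nra.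
elim: n => [|n ih].
  have : cmod (u 1%N) <= K * r + K + K.
    have J0 := Ju 0; rewrite jacobi_mulE /e0 mulr1 in J0.
    have E : (b 0%N)%:C%C * u 1%N = (z - (a 0%N)%:C%C) * u 0%N + s0.
      by transitivity (z * u 0%N + s0 - (a 0%N)%:C%C * u 0%N); [rewrite -J0; cring|cring].
    have E2 : b 0%N * cmod (u 1%N) <= r + `|a 0%N| + 1.
      have -> : b 0%N * cmod (u 1%N) = cmod ((b 0%N)%:C%C * u 1%N).
        by rewrite cmodM cmod_real gtr0_norm.
      rewrite E; apply: le_trans (cmodD _ _) _; rewrite lerD//.
      rewrite cmodM; apply: (@le_trans _ _ ((r + `|a 0%N|) * 1)); last by rewrite mulr1.
      apply: ler_pM; rewrite ?cmod_ge0//.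
      by apply: le_trans (cmodB _ _) _; rewrite cmod_real.
    have b0 := b_gt0 0; have ib : 0 < (b 0%N)^-1 by rewrite invr_gt0.
    have : cmod (u 1%N) <= (b 0%N)^-1 * (r + `|a 0%N| + 1).
      by rewrite mulrC ler_pdivlMr// mulrC.
    have h1 := K_b 0; have h2 := K_a 0; rewrite mulrC in h2.
    have h3 : (b 0%N)^-1 * r <= K * r by rewrite ler_wpM2r ?cmod_ge0.
    rewrite !mulrDr mulr1; lra.
  by rewrite expr1 /G; move: u0_le1; nra.
rewrite exprS.
apply: (@le_trans _ _ (4 * K * (1 + r) * G n)); last by rewrite ler_wpM2l// !mulr_ge0.
suff : cmod (u n.+2) <= K * (1 + r) * G n.
  move=> h; rewrite [leLHS]/G; have : cmod (u n.+1) <= G n by rewrite /G lerDr cmod_ge0.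
  have : G n <= K * (1 + r) * G n by rewrite ler_peMl.
  by have := G_ge0 n; lra.
have bn := b_gt0 n.+1; have ib : 0 < (b n.+1)^-1 by rewrite invr_gt0.
have h : b n.+1 * cmod (u n.+2) <= (r + `|a n.+1|) * cmod (u n.+1) + b n * cmod (u n).
  have -> : b n.+1 * cmod (u n.+2) = cmod ((b n.+1)%:C%C * u n.+2).
    by rewrite cmodM cmod_real gtr0_norm.
  rewrite three_term; apply: le_trans (cmodB _ _) _.
  rewrite !cmodM cmod_real (gtr0_norm (b_gt0 n)) lerD2r ler_wpM2r ?cmod_ge0//.
  by apply: le_trans (cmodB _ _) _; rewrite cmod_real.
have {}h : cmod (u n.+2) <=
    ((b n.+1)^-1 * r + `|a n.+1| / b n.+1) * cmod (u n.+1) + b n / b n.+1 * cmod (u n).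
  have -> : ((b n.+1)^-1 * r + `|a n.+1| / b n.+1) * cmod (u n.+1) + b n / b n.+1 * cmod (u n)
    = ((r + `|a n.+1|) * cmod (u n.+1) + b n * cmod (u n)) / b n.+1 by ring.
  by rewrite ler_pdivlMr// mulrC.
apply: le_trans h _.
have h1 := ler_wpM2r (cmod_ge0 z) (K_b n.+1).
have h2 : ((b n.+1)^-1 * r + `|a n.+1| / b n.+1) * cmod (u n.+1) <= K * (1 + r) * cmod (u n.+1).
  by rewrite ler_wpM2r ?cmod_ge0//; have := K_a n.+1; lra.
have h3 : b n / b n.+1 * cmod (u n) <= K * (1 + r) * cmod (u n).
  by rewrite ler_wpM2r ?cmod_ge0//; have := K_rho n; nra.
by rewrite /G; lra.
Qed.

Let v := cflip s u.
Let d := cflux b s u.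

Let cmod_v n : cmod (v n) = cmod (u n).
Proof. exact: cmod_cflip. Qed.

Let cmod_s : `|s| = 1.
Proof. exact: norm_of_sqr1. Qed.

Let d_step n : d n.+1 = d n - ((defect s a b n)%:C%C + s%:C%C * z) * v n.+1.
Proof. exact: (cflux_step s2 (three_term n)). Qed.

(* Between M and N, [H] is the natural energy of v'' = (z/b) v: the weight
   balances the spectral term (r b)^(1/2) against the drift b/n. *)
Let w n : R := Num.sqrt (r `^ (1 / 2) * n%:R `^ (beta / 2) + n%:R `^ (beta - 1)).
Let H n := w n * cmod (v n) + cmod (d n) / w n.

Let w2 n : w n ^+ 2 = r `^ (1 / 2) * n%:R `^ (beta / 2) + n%:R `^ (beta - 1).
Proof. by rewrite sqr_sqrtr// addr_ge0// ?mulr_ge0// powR_ge0. Qed.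

Let w_ge1 n : (0 < n)%N -> 1 <= w n.
Proof.
move=> n0; rewrite -(@ler_pXn2r _ 2) ?nnegrE ?sqrtr_ge0// expr1n w2.
rewrite ler_wpDl ?mulr_ge0 ?powR_ge0//.
by apply: le_trans (natr_pow_le n0 (ltW (_ : 0 < beta - 1))); rewrite ?powRr0// subr_gt0.
Qed.

Let w_mono n : (0 < n)%N -> w n <= w n.+1.
Proof.
move=> n0; rewrite -(@ler_pXn2r _ 2) ?nnegrE ?sqrtr_ge0// !w2.
have b1 := beta_gt1.
by apply: lerD; [apply: ler_wpM2l; rewrite ?powR_ge0//|]; rewrite ge0_ler_powR ?nnegrE ?ler_nat//; lra.
Qed.

Let w_le n : (0 < n)%N -> w n <= 2 * (r * n%:R `^ beta).
Proof.
move=> n0; have b1 := beta_gt1.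
apply: (@le_trans _ _ (w n ^+ 2)).
  by rewrite expr2 ler_peMl ?w_ge1// (le_trans ler01 (w_ge1 n0)).
have h1 : r `^ (1 / 2) <= r.
  by rewrite ler1_powR//; lra.
have h2 : n%:R `^ (beta / 2) <= n%:R `^ beta :> R by apply: natr_pow_le => //; lra.
have h3 : n%:R `^ (beta - 1) <= n%:R `^ beta :> R by apply: natr_pow_le => //; lra.
have h4 : 0 <= n%:R `^ beta :> R by exact: powR_ge0.
have h5 := ler_pM (powR_ge0 _ _) (powR_ge0 _ _) h1 h2.
have h6 : n%:R `^ beta <= r * n%:R `^ beta by rewrite ler_peMl.
by rewrite w2; lra.
Qed.

(** Each equation of the system for v and d changes one summand of H; relative to H the changes are
    w^2 / b and (|defect| + r) / w^2. *)
Let H_step n : (0 < n)%N ->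
  H n.+1 <= (w n.+1 / w n) *
   expR ((`|defect s a b n| + r) / w n ^+ 2 + w n ^+ 2 / b n) * H n.
Proof.
move=> n0; have w1 := w_ge1 n0; have w1' := w_ge1 (ltn0Sn n); have wm := w_mono n0.
have w0 : 0 < w n by lra.
have w0' : 0 < w n.+1 by lra.
set W := w n in w1 wm w0 *; set W' := w n.+1 in w1' wm w0' *.
set e1 := (_ + r) / W ^+ 2; set e2 := W ^+ 2 / b n.
have e10 : 0 <= e1 by rewrite divr_ge0 ?sqr_ge0// addr_ge0// cmod_ge0.
have e20 : 0 <= e2 by rewrite divr_ge0 ?sqr_ge0// ltW.
pose V := cmod (v n); pose V' := cmod (v n.+1); pose d0 := cmod (d n).
have V0 : 0 <= V by exact: cmod_ge0.
have V0' : 0 <= V' by exact: cmod_ge0.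
have d00 : 0 <= d0 by exact: cmod_ge0.
have vS : V' <= V + d0 / b n.
  have -> : V' = cmod (v n + (v n.+1 - v n)) by rewrite addrC subrK.
  apply: le_trans (cmodD _ _) _; rewrite lerD2l ler_pdivlMr//.
  by rewrite /d0 /d /cflux cmodM cmod_real gtr0_norm// mulrC.
have dS : cmod (d n.+1) <= d0 + (`|defect s a b n| + r) * V'.
  rewrite d_step; apply: le_trans (cmodB _ _) _; rewrite lerD2l cmodM ler_wpM2r//.
  by apply: le_trans (cmodD _ _) _; rewrite cmodM !cmod_real cmod_s mul1r.
have step1 : H n.+1 <= W' * V' * (1 + e1) + d0 / W.
  have h1 : cmod (d n.+1) / W' <= (d0 + (`|defect s a b n| + r) * V') / W'.
    by rewrite ler_pM2r// invr_gt0.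
  have h2 : d0 / W' <= d0 / W by rewrite ler_wpM2l// lef_pV2.
  have h3 : (`|defect s a b n| + r) * V' / W' <= W' * V' * e1.
    have -> : W' * V' * e1 = (`|defect s a b n| + r) * V' * (W' / W ^+ 2).
      by rewrite /e1; ring.
    rewrite ler_wpM2l ?mulr_ge0 ?addr_ge0 ?cmod_ge0//.
    rewrite ler_pdivlMr ?exprn_gt0// mulrC ler_pdivrMr//.
    by rewrite -expr2 lerXn2r ?nnegrE// ltW.
  by rewrite /H -/V' -/W'; move: h1; rewrite mulrDl; lra.
apply: le_trans step1 _.
have step2 : W' * V' <= (W' / W) * (W * V + e2 * (d0 / W)).
  have -> : (W' / W) * (W * V + e2 * (d0 / W)) = W' * (V + d0 / b n).
    by rewrite /e2; field; rewrite !gt_eqF.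
  by rewrite ler_wpM2l// ltW.
have q1 : 1 <= W' / W by rewrite ler_pdivlMr// mul1r.
have dW0 : 0 <= d0 / W by rewrite divr_ge0// ltW.
have step3 : W' * V' * (1 + e1) + d0 / W <= (W' / W) * ((1 + e1) * (1 + e2)) * (W * V + d0 / W).
  have k1 : W' * V' * (1 + e1) <= (W' / W) * (W * V + e2 * (d0 / W)) * (1 + e1).
    by rewrite ler_wpM2r// addr_ge0.
  have k2 : d0 / W <= (W' / W) * ((1 + e1) * (d0 / W)).
    rewrite -[leLHS]mul1r ler_pM// -[leLHS]mul1r ler_wpM2r//; lra.
  have k3 : 0 <= (W' / W) * ((1 + e1) * (e2 * (W * V))).
    have q0 : 0 <= W' / W by lra.
    exact: mulr_ge0 q0 (mulr_ge0 (addr_ge0 ler01 e10) (mulr_ge0 e20 (mulr_ge0 (ltW w0) V0))).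
  apply: le_trans (lerD k1 k2) _; rewrite -subr_ge0; apply: le_trans k3 _.
  by rewrite le_eqVlt; apply/orP; left; apply/eqP; ring.
apply: le_trans step3 _; rewrite /H -/V -/d0 -/W.
apply: ler_wpM2r; first by rewrite addr_ge0// mulr_ge0// ltW.
apply: ler_wpM2l; first by lra.
by rewrite expRD; apply: ler_pM; rewrite ?addr_ge0// expR_ge1Dx.
Qed.

Let H_ge0 n : (0 < n)%N -> 0 <= H n.
Proof.
move=> n0; have w0 := le_trans ler01 (w_ge1 n0).
exact: addr_ge0 (mulr_ge0 w0 (cmod_ge0 _)) (divr_ge0 (cmod_ge0 _) w0).
Qed.

Let H_growth M N : (0 < M)%N -> (M <= N)%N -> H N <= (w N / w M) *
  expR (\sum_(M <= n < N) ((`|defect s a b n| + r) / w n ^+ 2 + w n ^+ 2 / b n)) * H M.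
Proof.
move=> M0; have wM := w_ge1 M0; elim: N => [|N ih].
  by rewrite leqn0 => /eqP E; rewrite E in M0.
rewrite leq_eqVlt => /predU1P[<-|].
  by rewrite big_geq// expR0 mulr1 divff ?mul1r// gt_eqF//; lra.
rewrite ltnS => MN; have N0 : (0 < N)%N by exact: leq_trans MN.
have wN := w_ge1 N0; have wN' := w_ge1 (ltn0Sn N).
rewrite big_nat_recr//= expRD.
apply: le_trans (H_step N0) _.
set A := expR (\sum_(_ <= _ < _) _) in ih *; set B := expR _.
have k : w N.+1 / w N * B * H N <= w N.+1 / w N * B * (w N / w M * A * H M).
  by rewrite ler_wpM2l ?ih// mulr_ge0 ?expR_ge0// divr_ge0//; lra.
apply: le_trans k _; rewrite le_eqVlt; apply/orP; left; apply/eqP; field.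
by rewrite !gt_eqF//; lra.
Qed.

(** Through the choice of w both quotients are at most a multiple of r^(1/2) n^(-beta/2) + 1/n. As
    r^(1/2) n^(1 - beta/2) <= T, every term is O((T + 1)/n), and summation costs only a
    logarithm. *)
Let sum_bound M N T : (0 < M)%N -> (M <= N)%N -> 0 <= T ->
  (forall n, (M <= n < N)%N -> `|defect s a b n| <= D * (r + n%:R `^ (beta - 2))) ->
  (forall n, (M <= n < N)%N -> r `^ (1 / 2) * n%:R `^ (1 - beta / 2) <= T) ->
  \sum_(M <= n < N) ((`|defect s a b n| + r) / w n ^+ 2 + w n ^+ 2 / b n) <=
  (D + 1 + cb^-1) * ((T + 1) * (1 + ln N%:R)).
Proof.
move=> M0 MN T0 HD HT; have N0 : (0 < N)%N by exact: leq_trans MN.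
have r1 := z_ge1; have r0 : 0 < r by lra.
have D0 := D_ge0; have icb : 0 < cb^-1 by rewrite invr_gt0.
have C40 : 0 <= D + 1 + cb^-1 by lra.
have step n : (M <= n < N)%N ->
    (`|defect s a b n| + r) / w n ^+ 2 + w n ^+ 2 / b n <= (D + 1 + cb^-1) * (T + 1) * n%:R^-1.
  move=> MnN; have n0 : (0 < n)%N by case/andP: MnN => Mn _; exact: leq_trans Mn.
  have n00 : 0 < n%:R :> R by rewrite ltr0n.
  pose A := r `^ (1 / 2) * n%:R `^ (- (beta / 2)) + n%:R^-1.
  have w20 : 0 < w n ^+ 2 by rewrite exprn_gt0// (lt_le_trans ltr01 (w_ge1 n0)).
  have x0 : 0 <= r `^ (1 / 2) by exact: powR_ge0.
  have AT : A <= (T + 1) * n%:R^-1.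
    rewrite /A [leRHS]mulrDl [X in _ <= _ + X]mul1r lerD2r.
    have -> : n%:R `^ (- (beta / 2)) = n%:R `^ (1 - beta / 2) * n%:R^-1 :> R.
      by rewrite -(@natr_powN1 R n) -natr_powD//; congr (_ `^ _); ring.
    by rewrite mulrA ler_wpM2r ?invr_ge0 ?HT// ltW.
  have rr : r `^ (1 / 2) * r `^ (1 / 2) = r.
    rewrite -powRD; last by rewrite gt_eqF ?implybT.
    by rewrite -splitr powRr1// ltW.
  have e1 : n%:R `^ (- (beta / 2)) * n%:R `^ (beta / 2) = 1 :> R.
    by rewrite -natr_powD// addNr powRr0.
  have e2 : n%:R^-1 * n%:R `^ (beta - 1) = n%:R `^ (beta - 2) :> R.
    by rewrite -(@natr_powN1 R n) -natr_powD//; congr (_ `^ _); ring.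
  have h1 : (`|defect s a b n| + r) / w n ^+ 2 <= (D + 1) * A.
    rewrite ler_pdivrMr// w2.
    apply: (@le_trans _ _ ((D + 1) * (r + n%:R `^ (beta - 2)))).
      have := HD n MnN; have : 0 <= n%:R `^ (beta - 2) :> R by exact: powR_ge0.
      by move=> ? ?; lra.
    rewrite -mulrA ler_wpM2l//; first by lra.
    have -> : A * (r `^ (1 / 2) * n%:R `^ (beta / 2) + n%:R `^ (beta - 1)) =
      r + n%:R `^ (beta - 2) + (r `^ (1 / 2) * (n%:R `^ (- (beta / 2)) * n%:R `^ (beta - 1)) +
        n%:R^-1 * (r `^ (1 / 2) * n%:R `^ (beta / 2))).
      transitivity ((r `^ (1 / 2) * r `^ (1 / 2)) * (n%:R `^ (- (beta / 2)) * n%:R `^ (beta / 2))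
        + n%:R^-1 * n%:R `^ (beta - 1) +
        (r `^ (1 / 2) * (n%:R `^ (- (beta / 2)) * n%:R `^ (beta - 1)) +
        n%:R^-1 * (r `^ (1 / 2) * n%:R `^ (beta / 2)))); first by rewrite /A; ring.
      by rewrite rr e1 e2 mulr1.
    by rewrite lerDl addr_ge0 ?mulr_ge0 ?powR_ge0 ?invr_ge0// ltW.
  have h2 : w n ^+ 2 / b n <= cb^-1 * A.
    have /andP[hb _] := b_bounds n0.
    have nb : 0 < n%:R `^ beta :> R by exact: natr_pow_gt0.
    apply: (@le_trans _ _ (w n ^+ 2 / (cb * n%:R `^ beta))).
      by rewrite ler_pM2l// lef_pV2 ?posrE// mulr_gt0.
    rewrite w2 invfM mulrCA ler_pM2l// le_eqVlt; apply/orP; left; apply/eqP.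
    rewrite -powRN mulrDl -mulrA -!natr_powD// /A -(@natr_powN1 R n).
    by congr (_ * _ `^ _ + _ `^ _); field.
  apply: le_trans (lerD h1 h2) _; rewrite -mulrDl -mulrA ler_wpM2l//.
apply: le_trans (ler_sum_nat step) _.
rewrite -mulr_sumr -mulrA ler_wpM2l// ler_wpM2l//; first by lra.
case: N N0 MN HD HT step => // N _ MN _ _ _.
apply: le_trans (harmonic_le_ln R N).
rewrite [leRHS]big_nat_recr//= [X in _ <= X + _](@big_cat_nat _ _ _ M) ?M0//=.
rewrite addrAC lerDr; apply: addr_ge0; last by rewrite invr_ge0.
by apply: sumr_ge0 => k _; rewrite invr_ge0.
Qed.

Let coord_le_G N : coord_norm a b 0 z s0 u N.+1 <= 2 * Ch * (b N * G N).
Proof.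
have bN := b_gt0 N.
have bnd (f : nat -> R[i]) : (forall k, cmod (f k) <= Ch) ->
    cmod ((b N)%:C%C * (u N * f N.+1 - u N.+1 * f N)) <= b N * (Ch * G N).
  move=> Hf; rewrite cmodM cmod_real gtr0_norm// ler_pM2l//.
  apply: le_trans (cmodB _ _) _; rewrite !cmodM /G mulrDr.
  by rewrite ![Ch * _]mulrC lerD// ler_wpM2l ?cmod_ge0.
rewrite /coord_norm (coordXE 0 b_gt0 Ju) (coordYE 0 b_gt0 Ju).
apply: le_trans (lerD (bnd _ Ch_q) (bnd _ Ch_p)) _.
by rewrite le_eqVlt; apply/orP; left; apply/eqP; ring.
Qed.

Let G_le_H N : (0 < N)%N -> b N * G N <= (2 * b N + w N) * H N.
Proof.
move=> N0; have bN := b_gt0 N; have wN := w_ge1 N0.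
have w0 : 0 < w N by lra.
have h1 : cmod (u N) <= H N.
  rewrite -cmod_v /H; have : 0 <= cmod (d N) / w N by rewrite divr_ge0 ?cmod_ge0// ltW.
  have : cmod (v N) <= w N * cmod (v N) by rewrite ler_peMl ?cmod_ge0.
  lra.
have h2 : cmod (u N.+1) <= cmod (u N) + cmod (d N) / b N.
  rewrite -!cmod_v.
  have -> : cmod (v N.+1) = cmod (v N + (v N.+1 - v N)) by rewrite addrC subrK.
  apply: le_trans (cmodD _ _) _; rewrite lerD2l ler_pdivlMr//.
  by rewrite /d /cflux cmodM cmod_real gtr0_norm// mulrC.
have h3 : cmod (d N) <= w N * H N.
  have -> : w N * H N = w N * (w N * cmod (v N)) + cmod (d N).
    by rewrite /H; field; rewrite gt_eqF.
  by rewrite lerDr !mulr_ge0 ?cmod_ge0// ltW.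
have h4 : b N * cmod (u N.+1) <= b N * cmod (u N) + cmod (d N).
  apply: le_trans (ler_wpM2l (ltW bN) h2) _.
  by rewrite mulrDr [X in _ + X]mulrCA divff ?mulr1// gt_eqF.
have h5 := ler_wpM2l (ltW bN) h1.
by rewrite /G mulrDr; lra.
Qed.

Let H_le_G M : (0 < M)%N -> H M <= (w M + b M) * G M.
Proof.
move=> M0; have bM := b_gt0 M; have wM := w_ge1 M0.
have w0 : 0 < w M by lra.
have G0 := G_ge0 M.
have dM : cmod (d M) <= b M * G M.
  by rewrite /d /cflux cmodM cmod_real gtr0_norm// ler_pM2l// /G -!cmod_v [leRHS]addrC; exact: cmodB.
have h1 : cmod (d M) / w M <= b M * G M.
  rewrite ler_pdivrMr//.
  by apply: le_trans dM _; rewrite ler_peMr// mulr_ge0// ltW.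
have h2 : w M * cmod (v M) <= w M * G M.
  by rewrite ler_wpM2l ?(ltW w0)// cmod_v /G lerDl cmod_ge0.
by rewrite [leRHS]mulrDl; exact: lerD.
Qed.

(** The constant of [growth_collect] for the C4 of [sum_bound] and the product of constants in
    passing from G to H and back; it does not depend on z, M, N and T. *)
Definition growth_const := 2 + (D + 1 + cb^-1) +
  4 * Ch * (2 * Cb + 2) * (2 + Cb) + 3 * (1 + beta) + (4 * K + 1).

Lemma coord_bound M N T : (0 < M)%N -> (M <= N)%N -> 0 <= T ->
  (forall n, (M <= n < N)%N -> `|defect s a b n| <= D * (r + n%:R `^ (beta - 2))) ->
  (forall n, (M <= n < N)%N -> r `^ (1 / 2) * n%:R `^ (1 - beta / 2) <= T) ->
  (forall n, r * \sum_(N.+1 <= k < n) (cmod (p k) ^+ 2 + cmod (q k) ^+ 2) <= T) ->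
  forall n, (N < n)%N -> coord_norm a b 0 z s0 u n <=
    expR (growth_const * ((T + M%:R + 1) * (1 + ln N%:R + ln (1 + r)))).
Proof.
move=> M0 MN T0 HD HT Htail n Nn.
have N0 : (0 < N)%N by exact: leq_trans MN.
have r1 := z_ge1; have r0 : 0 < r by lra.
have wM := w_ge1 M0; have wN := w_ge1 N0.
have bN := b_gt0 N; have bM := b_gt0 M.
pose y := r * N%:R `^ beta.
have [p1 p2 p3 y0 yl] : [/\ 2 * b N + w N <= (2 * Cb + 2) * y, w N / w M <= 2 * y,
    w M + b M <= (2 + Cb) * y, 0 <= y & y <= (1 + r) * expR (beta * ln N%:R)].
  have Cb0 := Cb_gt0; have be1 := beta_gt1.
  have Nb0 : 0 <= N%:R `^ beta :> R by exact: powR_ge0.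
  have /andP[_ bNle] := b_bounds N0; have /andP[_ bMle] := b_bounds M0.
  have MNb : M%:R `^ beta <= N%:R `^ beta :> R by rewrite ge0_ler_powR ?nnegrE ?ler_nat//; lra.
  have wNle := w_le N0; have wMle := w_le M0; rewrite -/y in wNle.
  have Nby : N%:R `^ beta <= y by rewrite /y ler_peMl.
  have rMy : r * M%:R `^ beta <= y by rewrite /y ler_wpM2l// ltW.
  have CbNy := ler_wpM2l (ltW Cb_gt0) Nby.
  have CbMy := ler_wpM2l (ltW Cb_gt0) (le_trans MNb Nby).
  have y0 : 0 <= y by rewrite mulr_ge0// ltW.
  split => //; first lra.
  - rewrite ler_pdivrMr; last by lra.
    by apply: le_trans wNle _; rewrite ler_peMr//; lra.
  - lra.
  - rewrite /y /powR gt_eqF ?ltr0n// ler_wpM2r ?expR_ge0//; lra.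
have HS := sum_bound M0 MN T0 HD HT; set S := \sum_(M <= n < N) _ in HS.
have HM0 := H_ge0 M0; have HN0 := H_ge0 N0.
have Cb0 := ltW Cb_gt0; have Ch0 := le_trans ler01 Ch_ge1.
pose B := (4 * K * (1 + r)) ^+ M.+1.
have HMB : H M <= (2 + Cb) * y * B.
  apply: le_trans (H_le_G M0) _.
  exact: (ler_pM (addr_ge0 (le_trans ler01 wM) (ltW bM)) (G_ge0 M) p3 (crude M)).
have wNM : 0 <= w N / w M := divr_ge0 (le_trans ler01 wN) (le_trans ler01 wM).
have HNB : H N <= 2 * y * expR S * ((2 + Cb) * y * B).
  apply: le_trans (H_growth M0 MN) _.
  exact: (ler_pM (mulr_ge0 wNM (expR_ge0 _)) HM0 (ler_wpM2r (expR_ge0 _) p2) HMB).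
have GNB : b N * G N <= (2 * Cb + 2) * y * (2 * y * expR S * ((2 + Cb) * y * B)).
  apply: le_trans (G_le_H N0) _.
  exact: (ler_pM (addr_ge0 (mulr_ge0 (ler0n _ _) (ltW bN)) (le_trans ler01 wN)) HN0 p1 HNB).
have c1 : coord_norm a b 0 z s0 u n <= expR (2 * T) * coord_norm a b 0 z s0 u N.+1.
  apply: le_trans (coord_growth 0 b_gt0 Ju (Nn : (N.+1 <= n)%N)) _.
  rewrite ler_wpM2r ?coord_norm_ge0// ler_expR -mulrA ler_wpM2l//.
  by rewrite sub0r cmodN Htail.
apply: le_trans c1 _.
apply: (@le_trans _ _ (expR (2 * T) * (2 * Ch * ((2 * Cb + 2) * y * (2 * y * expR S * ((2 + Cb) * y * B)))))).
  rewrite ler_wpM2l ?expR_ge0//; apply: le_trans (coord_le_G N) _.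
  by apply: (ler_wpM2l (mulr_ge0 (ler0n _ _) Ch0) GNB).
have -> : expR (2 * T) * (2 * Ch * ((2 * Cb + 2) * y * (2 * y * expR S * ((2 + Cb) * y * B))))
  = expR (2 * T) * expR S * (4 * Ch * (2 * Cb + 2) * (2 + Cb)) * y ^+ 3 * B by ring.
apply: growth_collect => //.
- by rewrite ln_ge0// ler1n.
- by rewrite addr_ge0 ?invr_ge0 ?(ltW cb_gt0)// addr_ge0.
- by rewrite !mulr_ge0// addr_ge0// mulr_ge0.
Qed.

End OneSolution.
End UpperGrowth.

(** * The Nevanlinna matrix as a limit of coordinates *)

Section NevanlinnaBounds.
Variables (R : realType) (a b : nat -> R).
Hypothesis b_gt0 : forall n, 0 < b n.
Local Notation p := (fun k => pol1 a b k (0 : R[i])).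
Local Notation q := (fun k => pol2 a b k (0 : R[i])).
Hypothesis p2 : ell2 p.
Hypothesis q2 : ell2 q.
Local Notation W := (nevanlinna a b).

Lemma mxmod_le (M : 'M[R[i]]_2) E : 0 <= E -> (forall i j, cmod (M i j) <= E) -> mxmod M <= E.
Proof. by move=> E0 ME; apply: bigmax_le => // i _; apply: bigmax_le => // j _. Qed.

Lemma entry_le_mxmod (M : 'M[R[i]]_2) i j : cmod (M i j) <= mxmod M.
Proof.
apply: le_trans (le_bigmax _ (fun i => \big[Num.max/0]_(j < 2) cmod (M i j)) i).
exact: (le_bigmax _ (fun j => cmod (M i j)) j).
Qed.

Lemma csum_to_affine_le f (l c z : R[i]) E N : csum_to f l ->
  (forall n, (N < n)%N -> cmod (c + z * \sum_(0 <= k < n) f k) <= E) ->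
  cmod (c + z * l) <= E.
Proof.
move=> fl H; apply/ler_addgt0Pr => e e0.
have d0 : 0 < e / (1 + cmod z) by rewrite divr_gt0// ltr_wpDr// cmod_ge0.
have [N' HN'] := fl _ d0.
pose n := (maxn N N').+1.
have h1 := H n (_ : (N < n)%N); rewrite ltnS leq_maxl in h1; have {}h1 := h1 isT.
have h2 := HN' n (leqW (leq_maxr _ _)).
have -> : c + z * l = (c + z * \sum_(0 <= k < n) f k) - z * (\sum_(0 <= k < n) f k - l) by cring.
apply: le_trans (cmodB _ _) (lerD h1 _); rewrite cmodM.
apply: le_trans (ler_wpM2l (cmod_ge0 z) h2) _.
rewrite mulrCA ler_piMr ?(ltW e0)// ler_pdivrMr ?mul1r ?ltr_wpDr ?cmod_ge0//.
by rewrite lerDr.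
Qed.

Let sol1 z : ell2 (fun k => pol1 a b k z).
Proof. by apply: (@ell2_transfer _ a b 0 z 0) => // k; rewrite pol1_J// mul0r addr0. Qed.

Let sol2 z : ell2 (fun k => pol2 a b k z).
Proof. by apply: (@ell2_transfer _ a b 0 z 1) => // k; rewrite pol2_J// mul1r. Qed.

Lemma nevanlinna_le z E N :
  (forall n, (N < n)%N -> coord_norm a b 0 z 0 (fun k => pol1 a b k z) n <= E) ->
  (forall n, (N < n)%N -> coord_norm a b 0 z 1 (fun k => pol2 a b k z) n <= E) ->
  mxmod (W z) <= E.
Proof.
move=> H1 H2.
have E0 : 0 <= E by apply: le_trans (H1 N.+1 (ltnSn _)); exact: coord_norm_ge0.
have X (s : R[i]) u n : cmod (coordX a b 0 z u n) <= coord_norm a b 0 z s u n.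
  by rewrite /coord_norm lerDl cmod_ge0.
have Y (s : R[i]) u n : cmod (coordY a b 0 z s u n) <= coord_norm a b 0 z s u n.
  by rewrite /coord_norm lerDr cmod_ge0.
apply: mxmod_le => // i j; rewrite mxE.
case: eqP => _; case: eqP => _.
- rewrite /nevA -[_ * _]add0r; apply: (csum_to_affine_le (N := N) (ell2_pairing q2 (sol2 z))).
  move=> n Nn; apply: le_trans (H2 n Nn); apply: le_trans (X 1 _ n).
  by rewrite -cmodN /coordX /pol2 /= sub0r !add0r mulNr.
- rewrite /nevC; apply: (csum_to_affine_le (N := N) (ell2_pairing p2 (sol2 z))).
  move=> n Nn; apply: le_trans (H2 n Nn); apply: le_trans (Y 1 _ n).
  by rewrite -cmodN /coordY sub0r opprD mulNr.
- rewrite /nevB; apply: (csum_to_affine_le (N := N) (ell2_pairing q2 (sol1 z))).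
  move=> n Nn; apply: le_trans (H1 n Nn); apply: le_trans (X 0 _ n).
  by rewrite -cmodN /coordX sub0r opprD opprK mulNr.
- rewrite /nevD -[_ * _]add0r; apply: (csum_to_affine_le (N := N) (ell2_pairing p2 (sol1 z))).
  move=> n Nn; apply: le_trans (H1 n Nn); apply: le_trans (Y 0 _ n).
  by rewrite -cmodN /coordY sub0r oppr0 !add0r mulNr.
Qed.

(* Im(conj D_n * B_n) is the Christoffel-Darboux kernel on the diagonal. *)
Lemma christoffel_darboux z n :
  complex.Im z * l2part (fun k => pol1 a b k z) n.+1 =
  complex.Im ((coordY a b 0 z 0 (fun k => pol1 a b k z) n.+1)^*%C *
              coordX a b 0 z (fun k => pol1 a b k z) n.+1).
Proof.
have Ju k : jacobi_mul a b (fun k => pol1 a b k z) k = z * pol1 a b k z + 0 * e0 R k.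
  by rewrite pol1_J// mul0r addr0.
rewrite (pol1_green a b_gt0) (coordXE 0 b_gt0 Ju) (coordYE 0 b_gt0 Ju) !pol1_real !pol2_real.
have Wr := rpol_wronskian a b_gt0 n; move: Wr.
move: (b n) (rpol1 a b n) (rpol1 a b n.+1) (rpol2 a b n) (rpol2 a b n.+1) => c s t x y Wr.
case: (pol1 a b n z) => u1 u2; case: (pol1 a b n.+1 z) => v1 v2 /=.
transitivity (c * (u1 * v2 - u2 * v1) * (c * (s * y - t * x))); last ring.
by rewrite Wr; ring.
Qed.

(** The coordinates of [pol1] tend to -B and -D, so the limit of the Christoffel-Darboux identity
    bounds Im z times the kernel by |B| |D|. *)
Lemma kernel_le_mxmod z n :
  `|complex.Im z| * l2part (fun k => pol1 a b k z) n <= mxmod (W z) ^+ 2.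
Proof.
have m0 : 0 <= mxmod (W z) by exact: le_trans (cmod_ge0 _) (entry_le_mxmod (W z) 0 0).
have B_le : cmod (nevB a b z) <= mxmod (W z).
  by have := entry_le_mxmod (W z) 1 0; rewrite mxE.
have D_le : cmod (nevD a b z) <= mxmod (W z).
  by have := entry_le_mxmod (W z) 1 1; rewrite mxE.
have cB := ell2_pairing q2 (sol1 z); have cD := ell2_pairing p2 (sol1 z).
suff H (e : R) : 0 < e -> e <= 1 -> `|complex.Im z| * l2part (fun k => pol1 a b k z) n <=
    mxmod (W z) ^+ 2 + e * (2 * mxmod (W z) + 1).
  apply/ler_addgt0Pr => e e0.
  have c0 : 0 < 2 * mxmod (W z) + 1 by lra.
  have d0 : 0 < Num.min 1 (e / (2 * mxmod (W z) + 1)) by rewrite lt_min ltr01 divr_gt0.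
  apply: le_trans (H _ d0 _) _; first by rewrite ge_min lexx.
  by rewrite lerD2l -ler_pdivlMr// ge_min lexx orbT.
move=> e0 e1.
have z0 : 0 < 1 + cmod z by rewrite ltr_wpDr// cmod_ge0.
have d0 : 0 < e / (1 + cmod z) by rewrite divr_gt0.
have [N1 H1] := cB _ d0; have [N2 H2] := cD _ d0.
pose m := (N1 + N2 + n)%N.
have zd : cmod z * (e / (1 + cmod z)) <= e.
  rewrite mulrCA ler_piMr ?(ltW e0)// ler_pdivrMr// mul1r lerDr//.
have X_le : cmod (coordX a b 0 z (fun k => pol1 a b k z) m.+1) <= mxmod (W z) + e.
  have -> : coordX a b 0 z (fun k => pol1 a b k z) m.+1 =
     - (nevB a b z + z * (\sum_(0 <= k < m.+1) pol2 a b k 0 * pol1 a b k z -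
        csum (fun k => pol2 a b k 0 * pol1 a b k z))).
    by rewrite /coordX /nevB /pol1 /= sub0r; cring.
  rewrite cmodN; apply: le_trans (cmodD _ _) (lerD B_le _); rewrite cmodM.
  apply: le_trans zd; rewrite ler_wpM2l ?cmod_ge0//; apply: H1.
  by rewrite leqW// /m -addnA leq_addr.
have Y_le : cmod (coordY a b 0 z 0 (fun k => pol1 a b k z) m.+1) <= mxmod (W z) + e.
  have -> : coordY a b 0 z 0 (fun k => pol1 a b k z) m.+1 =
     - (nevD a b z + z * (\sum_(0 <= k < m.+1) pol1 a b k 0 * pol1 a b k z -
        csum (fun k => pol1 a b k 0 * pol1 a b k z))).
    by rewrite /coordY /nevD sub0r oppr0; cring.
  rewrite cmodN; apply: le_trans (cmodD _ _) (lerD D_le _); rewrite cmodM.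
  apply: le_trans zd; rewrite ler_wpM2l ?cmod_ge0//; apply: H2.
  by rewrite leqW// /m addnAC leq_addl.
apply: (@le_trans _ _ (`|complex.Im z| * l2part (fun k => pol1 a b k z) m.+1)).
  by rewrite ler_wpM2l// l2part_mono// leqW// leq_addl.
rewrite -[X in _ * X]ger0_norm ?l2part_ge0// -normrM christoffel_darboux.
apply: le_trans (le_Im_cmod _) _; rewrite cmodM cmodJ.
apply: le_trans (ler_pM (cmod_ge0 _) (cmod_ge0 _) Y_le X_le) _.
by move: m0 e0 e1; set x := mxmod _; nra.
Qed.

End NevanlinnaBounds.

(** * The order from two-sided bounds *)

Section GrowthOrder.
Variables (R : realType) (F : R[i] -> 'M[R[i]]_2).

Lemma limf_esup_eq (g : R -> R) (rho : R) :
  (forall x, rho < x -> exists r0, forall r, r0 <= r -> g r <= x) ->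
  (forall x, x < rho -> exists r0, forall r, r0 <= r -> x <= g r) ->
  limf_esup (fun r => (g r)%:E) (pinfty_nbhs R) = rho%:E.
Proof.
move=> up low; apply/eqP; rewrite eq_le; apply/andP; split.
  apply/lee_addgt0Pr => e e0.
  have [|r0 H] := up (rho + e); first by rewrite ltrDl.
  apply: ge_ereal_inf; exists (ereal_sup [set (g r)%:E | r in [set r | r0 < r]]).
    exists [set r | r0 < r] => //.
    by exists r0; split=> //; rewrite num_real.
  by apply: ge_ereal_sup => _ [r /= r0r <-]; rewrite -EFinD lee_fin H// ltW.
apply: le_ereal_inf_tmp => _ [V [M [_ HV]] <-].
apply/lee_subgt0Pr => e e0.
have [|r0 H] := low (rho - e); first by rewrite ltrBlDr ltrDl.
pose r := Num.max r0 (M + 1).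
apply: (@le_trans _ _ (g r)%:E); first by rewrite -EFinB lee_fin H// le_max lexx.
apply: ereal_sup_ubound; exists r => //; apply: HV.
by rewrite lt_max ltrDl ltr01 orbT.
Qed.

Lemma growth_orderE (rho : R) : 0 < rho ->
  (forall x, rho < x -> exists r0, forall z, r0 <= cmod z ->
     mxmod (F z) <= expR (cmod z `^ x)) ->
  (forall x, 0 < x -> x < rho -> exists r0, forall r, r0 <= r ->
     exists2 z, cmod z = r & expR (r `^ x) <= mxmod (F z)) ->
  growth_order F = rho%:E.
Proof.
move=> rho0 up low.
have bound x : rho < x -> exists2 r0, 1 < r0 & forall r, r0 <= r ->
    max_modulus F r <= expR (r `^ x) /\
    (forall z, cmod z = r -> mxmod (F z) <= max_modulus F r).
  move=> rx; have [r0 H] := up x rx; exists (Num.max r0 2); first by rewrite lt_max ltr1n orbT.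
  move=> r; rewrite ge_max => /andP[r0r r2].
  have ubd : ubound [set mxmod (F z) | z in [set z : R[i] | cmod z = r]] (expR (r `^ x)).
    by move=> _ [z /= zr <-]; rewrite -zr; apply: H; rewrite zr.
  have cr : cmod (r%:C%C : R[i]) = r by rewrite cmod_real ger0_norm//; lra.
  split.
    by apply: ge_sup => //; exists (mxmod (F r%:C%C)); exists r%:C%C.
  move=> z zr; apply: ub_le_sup; first by exists (expR (r `^ x)).
  by exists z.
apply: limf_esup_eq => [x rx|x xr].
  have [r0 r01 H] := bound x rx; exists r0 => r r0r.
  have [H1 _] := H r r0r; have r1 : 1 < r by lra.
  have lr : 0 < ln r by rewrite ln_gt0.
  have x0 : 0 < x by lra.
  rewrite ler_pdivrMr//.
  (* [ln] is 0 on nonpositive arguments, so for a maximum modulus up to 1 the iterated logarithm is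
     at most 0. *)
  have [m0|m0] := leP (max_modulus F r) 1.
    rewrite (le_trans (ln_le0 _) _)//; last by rewrite mulr_ge0// ltW.
    by apply: le_trans (ln_le0 m0) ler01.
  have l0 : 0 < ln (max_modulus F r) by rewrite ln_gt0.
  have h : ln (max_modulus F r) <= r `^ x.
    by rewrite -[leRHS]expRK ler_ln ?posrE ?expR_gt0//; lra.
  rewrite -ln_powR ler_ln ?posrE// powR_gt0; lra.
(* The lower bound needs some upper bound too: [sup] of an unbounded set is a default value. *)
have [bp _ Hp] := bound (rho + 1) (ltac:(by rewrite ltrDl)).
(* The lower hypothesis is available for positive exponents only. *)
pose y := Num.max x (rho / 2).
have y0 : 0 < y by rewrite lt_max divr_gt0// orbT.
have yr : y < rho by rewrite gt_max xr/= ltr_pdivrMr// mulr_natr mulr2n ltrDl.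
have [r0 H] := low y y0 yr.
exists (Num.max r0 (Num.max bp 2)) => r; rewrite !ge_max => /and3P[h1 h2 h3].
have r1 : 1 < r by lra.
have lr : 0 < ln r by rewrite ln_gt0.
have [z zr Hz] := H r h1; have [_ Hp2] := Hp r h2.
have M1 := le_trans Hz (Hp2 z zr).
have h : r `^ y <= ln (max_modulus F r).
  by rewrite -[leLHS]expRK ler_ln ?posrE ?expR_gt0// (lt_le_trans (expR_gt0 _) M1).
have ry : 0 < r `^ y by rewrite powR_gt0; lra.
apply: (@le_trans _ _ y); first by rewrite le_max lexx.
rewrite ler_pdivlMr// -ln_powR ler_ln ?posrE//.
exact: lt_le_trans h.
Qed.

End GrowthOrder.

Section UpperOrder.
Variable R : realType.
Implicit Types (x y r : R).

Lemma natr_pow_ge1 n x : (0 < n)%N -> 0 <= x -> 1 <= n%:R `^ x :> R.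
Proof. by move=> n0 x0; have := natr_pow_le n0 x0; rewrite powRr0. Qed.

Lemma natr_pow_le1 n x : (0 < n)%N -> x <= 0 -> n%:R `^ x <= 1 :> R.
Proof. by move=> n0 x0; have := natr_pow_le n0 x0; rewrite powRr0. Qed.

Lemma le0_ler_powR (e x y : R) : e <= 0 -> 0 < x -> x <= y -> y `^ e <= x `^ e.
Proof.
move=> e0 x0 xy; have y0 : 0 < y by exact: lt_le_trans xy.
rewrite -(opprK e) [leLHS]powRN [leRHS]powRN lef_pV2 ?posrE ?powR_gt0//.
by rewrite ge0_ler_powR ?nnegrE ?oppr_ge0// ltW.
Qed.

Lemma OO_all (e : R) f : OO e f -> exists2 C, 0 <= C &
  forall n, (0 < n)%N -> `|f n| <= C * n%:R `^ (- e).
Proof.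
move=> [C [C0 [N HN]]].
have S0 : 0 <= \sum_(0 <= k < N) `|f k| * k%:R `^ e.
  by apply: sumr_ge0 => k _; rewrite mulr_ge0// powR_ge0.
exists (C + \sum_(0 <= k < N) `|f k| * k%:R `^ e); first exact: addr_ge0.
move=> n n0; have [Nn|nN] := leqP N n.
  by apply: le_trans (HN n Nn) _; rewrite ler_wpM2r ?powR_ge0// lerDl.
have pn : 0 < n%:R `^ e :> R by exact: natr_pow_gt0.
rewrite powRN -ler_pdivrMr ?invr_gt0// invrK.
apply: (@le_trans _ _ (\sum_(0 <= k < N) `|f k| * k%:R `^ e)); last by rewrite lerDr.
rewrite big_mkord (bigD1 (Ordinal nN))//= lerDl.
by apply: sumr_ge0 => k _; rewrite mulr_ge0// powR_ge0.
Qed.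

Definition upnat x : nat := (Num.truncn x).+1.

Lemma upnat_ge x : x <= (upnat x)%:R.
Proof. by apply: ltW; rewrite real_truncnS_gt// num_real. Qed.

Lemma upnat_le x : 1 <= x -> (upnat x)%:R <= 2 * x.
Proof.
move=> x1; have x0 : 0 <= x by lra.
by have := truncn_le x; rewrite x0 /upnat -natr1 => h; lra.
Qed.

Lemma upnat_lt x n : 0 <= x -> (n < upnat x)%N -> n%:R <= x.
Proof. by move=> x0; rewrite ltnS truncn_ge_nat. Qed.

Lemma upnat_mono x y : 0 <= x -> x <= y -> (upnat x <= upnat y)%N.
Proof.
move=> x0 xy; rewrite ltnS truncn_ge_nat ?(le_trans x0)//.
by apply: le_trans xy; rewrite truncn_le.
Qed.

Lemma ln_le_powR (d r : R) : 0 < d -> 1 <= r -> ln r <= r `^ d / d.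
Proof.
move=> d0 r1; rewrite ler_pdivlMr// /powR gt_eqF; last by lra.
apply: (@le_trans _ _ (1 + d * ln r)); first by rewrite mulrC; lra.
exact: expR_ge1Dx.
Qed.

(** Any gap between exponents absorbs constants and logarithms, which is why the estimates of log
    |W| may lose logarithmic factors. *)
Lemma powR_dominates (tau x C : R) : tau < x -> exists r0, 1 <= r0 /\
  forall r, r0 <= r -> C * (r `^ tau * (1 + ln r)) <= r `^ x.
Proof.
move=> tx; pose d := (x - tau) / 2.
have d0 : 0 < d by rewrite divr_gt0// subr_gt0.
pose A := `|C| * (1 + d^-1) + 1.
have A1 : 1 <= A by rewrite lerDr mulr_ge0// addr_ge0// invr_ge0 ltW.
have iA : 1 <= A `^ d^-1 by rewrite -(powRr0 A) ler_powR// invr_ge0 ltW.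
exists (A `^ d^-1); split=> // r Ar.
have r1 : 1 <= r by exact: le_trans Ar.
have r0 : 0 < r by lra.
have rd : A <= r `^ d.
  have := @ge0_ler_powR R d (ltW d0) (A `^ d^-1) r.
  rewrite !nnegrE powR_ge0 (ltW r0) -powRrM mulVf ?gt_eqF// powRr1; last by lra.
  exact.
have rdge : 1 <= r `^ d by lra.
have E : r `^ x = r `^ tau * r `^ d * r `^ d.
  rewrite -!powRD ?(gt_eqF r0) ?implybT//; congr (_ `^ _).
  by rewrite /d; field.
rewrite E.
apply: (@le_trans _ _ (`|C| * (r `^ tau * (1 + ln r)))).
  by rewrite ler_wpM2r ?ler_norm// mulr_ge0 ?powR_ge0// addr_ge0// ln_ge0.
have h := ln_le_powR d0 r1.
have h2 : 1 + ln r <= (1 + d^-1) * r `^ d by rewrite mulrDl mul1r mulrC; lra.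
have t0 : 0 <= r `^ tau by exact: powR_ge0.
have h3 : `|C| * (1 + ln r) <= r `^ d * r `^ d.
  apply: (@le_trans _ _ (`|C| * ((1 + d^-1) * r `^ d))); first by rewrite ler_wpM2l.
  by rewrite mulrA ler_wpM2r ?powR_ge0//; move: rd; rewrite /A; lra.
by rewrite mulrCA -mulrA ler_wpM2l.
Qed.

Variables (a b : nat -> R) (s beta cb Cb Ca Ch gam D : R).
Hypothesis b_gt0 : forall n, 0 < b n.
Hypothesis s2 : s ^+ 2 = 1.
Hypothesis beta_gt1 : 1 < beta.
Hypothesis cb_gt0 : 0 < cb.
Hypothesis Cb_gt0 : 0 < Cb.
Hypothesis b_bounds : forall n, (0 < n)%N -> cb * n%:R `^ beta <= b n <= Cb * n%:R `^ beta.
Hypothesis a_bound : forall n, (0 < n)%N -> `|a n| <= Ca * n%:R `^ beta.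
Hypothesis gam_gt1 : 1 < gam.
Hypothesis Ch_ge0 : 0 <= Ch.
Local Notation p := (fun k => pol1 a b k (0 : R[i])).
Local Notation q := (fun k => pol2 a b k (0 : R[i])).
Hypothesis pq_decay : forall n, (0 < n)%N ->
  cmod (p n) ^+ 2 + cmod (q n) ^+ 2 <= Ch * n%:R `^ (- gam).
Hypothesis D_ge0 : 0 <= D.
Local Notation W := (nevanlinna a b).

Let cmod_pq n : cmod (p n) <= Ch + 1 /\ cmod (q n) <= Ch + 1.
Proof.
have Ch0 := Ch_ge0; have c1 := cmod_ge0 (p n); have c2 := cmod_ge0 (q n).
case: (posnP n) => [->|n0].
  by rewrite [X in cmod X <= _ /\ _](_ : _ = 1) // [X in _ /\ cmod X <= _](_ : _ = 0) // cmod0 cmod1; split; lra.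
have h := pq_decay n0; have n1 : n%:R `^ (- gam) <= 1 :> R.
  by apply: natr_pow_le1 => //; have := gam_gt1; lra.
have := ler_wpM2l Ch0 n1; split; nra.
Qed.

Lemma pol_ell2 : ell2 p /\ ell2 q.
Proof.
have g0 : 0 < gam - 1 by have := gam_gt1; lra.
have Ch0 := Ch_ge0.
have H n : \sum_(2 <= k < n) (cmod (p k) ^+ 2 + cmod (q k) ^+ 2) <= Ch * (gam - 1)^-1.
  apply: (@le_trans _ _ (\sum_(2 <= k < n) Ch * k%:R `^ (- gam))).
    by apply: ler_sum_nat => k /andP[k2 _]; apply: pq_decay; exact: leq_trans k2.
  rewrite -mulr_sumr ler_wpM2l//.
  by have := @power_tail R gam 1 n gam_gt1 isT; rewrite powR1 mul1r.
have G (f : nat -> R[i]) : (forall k, cmod (f k) ^+ 2 <= cmod (p k) ^+ 2 + cmod (q k) ^+ 2) -> ell2 f.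
  move=> Hf; apply/ell2P; exists (cmod (f 0%N) ^+ 2 + cmod (f 1%N) ^+ 2 + Ch * (gam - 1)^-1) => n.
  apply: le_trans (l2part_mono f (_ : (n <= n.+2)%N)) _; first by rewrite -addn2 leq_addr.
  rewrite /l2part (@big_cat_nat _ _ _ 2)//= [X in X + _](_ : _ = cmod (f 0%N) ^+ 2 + cmod (f 1%N) ^+ 2).
    by rewrite lerD2l; apply: le_trans (H n.+2); apply: ler_sum.
  by rewrite big_nat_recr//= big_nat1.
by split; apply: G => k; rewrite ?lerDl ?lerDr sqr_ge0.
Qed.

Let bounded_const : exists2 K, 1 <= K &
  forall n, [/\ (b n)^-1 <= K, `|a n| / b n <= K & b n / b n.+1 <= K].
Proof.
have cb0 := cb_gt0; have Cb0 := Cb_gt0; have be1 := beta_gt1.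
have i1 : 0 < cb^-1 by rewrite invr_gt0.
have pow1 n : (0 < n)%N -> 1 <= n%:R `^ beta :> R.
  by move=> n0; apply: natr_pow_ge1 => //; lra.
have Ca0 : 0 <= Ca.
  by have := a_bound (ltn0Sn 0); rewrite powR1 mulr1; apply: le_trans.
have binv n : (0 < n)%N -> (b n)^-1 <= cb^-1 * (n%:R `^ beta)^-1.
  move=> n0; have /andP[h _] := b_bounds n0; have := pow1 n n0 => h1.
  rewrite -invfM lef_pV2 ?posrE// mulr_gt0//; lra.
pose K := 1 + (b 0%N)^-1 + `|a 0%N| / b 0%N + b 0%N / b 1%N + cb^-1 + Ca * cb^-1 + Cb * cb^-1.
have p1 : 0 < (b 0%N)^-1 by rewrite invr_gt0.
have p2 : 0 <= `|a 0%N| / b 0%N by rewrite mulr_ge0// ltW.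
have p3 : 0 < b 0%N / b 1%N by rewrite divr_gt0.
have p4 : 0 <= Ca * cb^-1 by rewrite mulr_ge0// ltW.
have p5 : 0 < Cb * cb^-1 by rewrite mulr_gt0.
exists K; first by rewrite /K; lra.
case=> [|n]; first by rewrite /K; split; lra.
have n0 := ltn0Sn n; have x1 := pow1 _ n0.
have bi := binv _ n0; have ab := a_bound n0; have /andP[_ bb] := b_bounds n0.
set X := n.+1%:R `^ beta in x1 bi ab bb.
have X0 : 0 < X by lra.
have iX : X^-1 <= 1 by rewrite invf_le1.
have bi0 : 0 < (b n.+1)^-1 by rewrite invr_gt0.
split.
- apply: le_trans bi _; apply: (@le_trans _ _ cb^-1); last by rewrite /K; lra.
  by rewrite ler_piMr// ltW.
- apply: (@le_trans _ _ (Ca * X * (cb^-1 * X^-1))).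
    by apply: ler_pM => //; exact: ltW.
  have -> : Ca * X * (cb^-1 * X^-1) = Ca * cb^-1 by field; rewrite !gt_eqF.
  by rewrite /K; lra.
- have bi' := binv _ (ltn0Sn n.+1).
  have XX : (n.+2%:R `^ beta)^-1 <= X^-1.
    by rewrite lef_pV2 ?posrE ?natr_pow_gt0// ge0_ler_powR ?nnegrE ?ler_nat//; lra.
  have bi2 : (b n.+2)^-1 <= cb^-1 * X^-1.
    by apply: le_trans bi' _; rewrite ler_wpM2l// ltW.
  apply: (@le_trans _ _ (Cb * X * (cb^-1 * X^-1))).
    by apply: ler_pM => //; rewrite ?invr_ge0 ltW.
  have -> : Cb * X * (cb^-1 * X^-1) = Cb * cb^-1 by field; rewrite !gt_eqF.
  by rewrite /K; lra.
Qed.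

(* For |z| = r, rows up to r^m are estimated crudely, rows between r^m and
   r^kap by the energy method, and rows beyond r^kap as a perturbation of the
   square-summable solutions at 0. *)
Variables (m kap tau : R).
Hypothesis m_gt0 : 0 < m.
Hypothesis m_kap : m <= kap.
Hypothesis region_two : forall r n, 1 <= r ->
  (upnat (r `^ m) <= n)%N -> (n < upnat (r `^ kap))%N ->
  `|defect s a b n| <= D * (r + n%:R `^ (beta - 2)).
Hypothesis m_tau : m <= tau.
Hypothesis turn_m : 1 / 2 + m * (1 - beta / 2) <= tau.
Hypothesis turn_kap : 1 / 2 + kap * (1 - beta / 2) <= tau.
Hypothesis tail_tau : 1 + kap * (1 - gam) <= tau.

(** Each condition on tau pays for one contribution to log |W|: m for the crude rows; the energy
    exponent at both ends of its range, enough because n^(1 - beta/2) is monotone; and 1 + kap (1 -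
    gam) for r times the tail of n^(-gam) beyond r^kap. *)
Lemma nevanlinna_order_le x : tau < x ->
  exists r0, forall z, r0 <= cmod z -> mxmod (W z) <= expR (cmod z `^ x).
Proof.
move=> tx.
have [K K1 HK] := bounded_const.
have Ch1 : 1 <= Ch + 1 by have := Ch_ge0; lra.
have bd z (s0 : R[i]) u := @coord_bound R a b s beta cb Cb K (Ch + 1) D b_gt0 s2 beta_gt1 cb_gt0
   Cb_gt0 b_bounds K1 (fun n => let: And3 h _ _ := HK n in h)
   (fun n => let: And3 _ h _ := HK n in h) (fun n => let: And3 _ _ h := HK n in h) Ch1
   (fun n => proj1 (cmod_pq n)) (fun n => proj2 (cmod_pq n)) D_ge0 z s0 u.
set G := growth_const _ _ _ _ _ _ in bd.
have g1 : 0 < gam - 1 by have := gam_gt1; lra.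
have Ch0 := Ch_ge0; have D0 := D_ge0; have m0 := m_gt0.
have kap0 : 0 < kap by exact: lt_le_trans m_kap.
have tau0 : 0 < tau by exact: lt_le_trans m_tau.
have G0 : 0 <= G.
  have cb0 : 0 < cb^-1 by rewrite invr_gt0 cb_gt0.
  have : 0 <= 4 * (Ch + 1) * (2 * Cb + 2) * (2 + Cb).
    by rewrite !mulr_ge0//; have := Cb_gt0; lra.
  rewrite /G /growth_const; have := beta_gt1; lra.
pose T0 := 2 + Ch / (gam - 1).
have T00 : 0 <= T0 by rewrite addr_ge0// divr_ge0// ltW.
have [r0 [r01 Hr0]] := @powR_dominates tau x (G * ((T0 + 3) * (3 + kap))) tx.
exists r0 => z r0z; set r := cmod z in r0z *.
have r1 : 1 <= r by lra.
have r0' : 0 < r by lra.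
pose M := upnat (r `^ m); pose N := upnat (r `^ kap).
have pow1 y : 0 <= y -> 1 <= r `^ y by move=> y0; rewrite -(powRr0 r) ler_powR.
have rm1 := pow1 m (ltW m0); have rk1 := pow1 kap (ltW kap0).
have rt0 : 0 < r `^ tau by rewrite powR_gt0.
have MN : (M <= N)%N by apply: upnat_mono; [rewrite powR_ge0|rewrite ler_powR].
have Nle : N%:R <= 2 * r `^ kap by exact: upnat_le.
have Mle : M%:R <= 2 * r `^ tau.
  apply: le_trans (upnat_le rm1) _; rewrite ler_pM2l// ler_powR//.
have N0 : (0 < N)%N by [].
have HT n : (M <= n < N)%N -> r `^ (1 / 2) * n%:R `^ (1 - beta / 2) <= T0 * r `^ tau.
  move=> /andP[Mn nN]; have n0 : (0 < n)%N by exact: leq_trans Mn.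
  have n00 : 0 < n%:R :> R by rewrite ltr0n.
  apply: (@le_trans _ _ (1 * r `^ tau)); last by rewrite ler_wpM2r ?(ltW rt0)// /T0 -addrA lerDl // addr_ge0// divr_ge0// ltW.
  rewrite [leRHS]mul1r.
  have rn : r `^ m <= n%:R by apply: le_trans (upnat_ge _) _; rewrite ler_nat.
  have nr : n%:R <= r `^ kap by apply: upnat_lt => //; rewrite powR_ge0.
  have [h|h] := leP 0 (1 - beta / 2).
    apply: (@le_trans _ _ (r `^ (1 / 2) * (r `^ kap) `^ (1 - beta / 2))).
      by rewrite ler_wpM2l ?powR_ge0// ge0_ler_powR ?nnegrE ?powR_ge0// ltW.
    by rewrite -powRrM -powRD ?(gt_eqF r0') ?implybT// ler_powR.
  apply: (@le_trans _ _ (r `^ (1 / 2) * (r `^ m) `^ (1 - beta / 2))).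
    rewrite ler_wpM2l ?powR_ge0//.
    by apply: le0_ler_powR; rewrite ?powR_gt0//; lra.
  by rewrite -powRrM -powRD ?(gt_eqF r0') ?implybT// ler_powR.
have Htail n : r * \sum_(N.+1 <= k < n) (cmod (p k) ^+ 2 + cmod (q k) ^+ 2) <= T0 * r `^ tau.
  have h1 : \sum_(N.+1 <= k < n) (cmod (p k) ^+ 2 + cmod (q k) ^+ 2) <=
      Ch * (N%:R `^ (1 - gam) / (gam - 1)).
    apply: (@le_trans _ _ (\sum_(N.+1 <= k < n) Ch * k%:R `^ (- gam))).
      by apply: ler_sum_nat => k /andP[k2 _]; apply: pq_decay; exact: leq_trans k2.
    by rewrite -mulr_sumr ler_wpM2l// power_tail.
  have h2 : N%:R `^ (1 - gam) <= r `^ (kap * (1 - gam)).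
    by rewrite powRrM; apply: le0_ler_powR; rewrite ?powR_gt0 ?upnat_ge//; lra.
  have h3 : r * r `^ (kap * (1 - gam)) <= r `^ tau.
    by rewrite -{1}(powRr1 (ltW r0')) -powRD ?(gt_eqF r0') ?implybT// ler_powR.
  have c0 : 0 <= Ch / (gam - 1) by rewrite divr_ge0// ltW.
  have h4 : r * N%:R `^ (1 - gam) <= r `^ tau.
    by apply: (le_trans _ h3); rewrite ler_wpM2l// ltW.
  have h5 := ler_wpM2l (ltW r0') h1.
  have h6 : r * (Ch * (N%:R `^ (1 - gam) / (gam - 1))) = Ch / (gam - 1) * (r * N%:R `^ (1 - gam)).
    by ring.
  rewrite h6 in h5; apply: le_trans h5 _.
  apply: le_trans (ler_wpM2l c0 h4) _; rewrite ler_wpM2r ?(ltW rt0)// /T0; lra.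
have [p2 q2] := pol_ell2.
have HD n : (M <= n < N)%N -> `|defect s a b n| <= D * (r + n%:R `^ (beta - 2)).
  by move=> /andP[]; exact: region_two.
have Tt : 0 <= T0 * r `^ tau by rewrite mulr_ge0// ltW.
have final : G * ((T0 * r `^ tau + M%:R + 1) * (1 + ln N%:R + ln (1 + r))) <= r `^ x.
  apply: le_trans (Hr0 r r0z); rewrite -mulrA ler_wpM2l//.
  have lr : 0 <= ln r by exact: ln_ge0.
  have rt1 := pow1 tau (ltW tau0).
  have l2 : ln 2 <= 1 :> R.
    by have := @le_ln1Dx R 1; rewrite (_ : 1 + 1 = 2 :> R) // => ->//; rewrite ltrN10.
  have lN : ln N%:R <= 1 + kap * ln r.
    apply: (@le_trans _ _ (ln (2 * r `^ kap))); first by rewrite ler_ln ?posrE ?ltr0n// mulr_gt0// powR_gt0.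
    by rewrite lnM ?posrE ?powR_gt0// ln_powR lerD2r.
  have l1r : ln (1 + r) <= 1 + ln r.
    apply: (@le_trans _ _ (ln (2 * r))); first by rewrite ler_ln ?posrE; lra.
    by rewrite lnM ?posrE// lerD2r.
  have lN0 : 0 <= ln N%:R :> R by rewrite ln_ge0// ler1n.
  have l1r0 : 0 <= ln (1 + r) by rewrite ln_ge0//; lra.
  have -> : (T0 + 3) * (3 + kap) * (r `^ tau * (1 + ln r)) =
     ((T0 + 3) * r `^ tau) * ((3 + kap) * (1 + ln r)) by ring.
  apply: ler_pM; [by rewrite !addr_ge0|by rewrite !addr_ge0|lra|].
  have : 0 <= kap * ln r by rewrite mulr_ge0// ltW.
  lra.
apply: le_trans (_ : expR (G * ((T0 * r `^ tau + M%:R + 1) * (1 + ln N%:R + ln (1 + r)))) <= _);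
  last by rewrite ler_expR.
apply: (nevanlinna_le b_gt0 p2 q2 (N := N)) => n Nn.
- apply: (bd z 0 (fun k => pol1 a b k z) _ _ _ _ M N) => //.
  + by move=> k; rewrite pol1_J// mul0r addr0.
  + by have := lexx (1 : R); rewrite -{1}(@cmod1 R).
  + by have : 0 <= 1 :> R by []; rewrite -{1}(@cmod0 R).
- apply: (bd z 1 (fun k => pol2 a b k z) _ _ _ _ M N) => //.
  + by move=> k; rewrite pol2_J// mul1r.
  + by have : 0 <= 1 :> R by []; rewrite -{1}(@cmod0 R).
  + by have := lexx (1 : R); rewrite -{1}(@cmod1 R).
Qed.

End UpperOrder.

(** * Lower bounds for the Nevanlinna matrix *)

Section LowerOrder.
Variables (R : realType) (a b : nat -> R) (beta Cb : R).
Hypothesis b_gt0 : forall n, 0 < b n.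
Hypothesis beta_gt1 : 1 < beta.
Hypothesis Cb_gt0 : 0 < Cb.
Hypothesis b_le : forall n, (0 < n)%N -> b n <= Cb * n%:R `^ beta.
Hypothesis p2 : ell2 (fun k => pol1 a b k (0 : R[i])).
Hypothesis q2 : ell2 (fun k => pol2 a b k (0 : R[i])).
Local Notation W := (nevanlinna a b).

Lemma cmod_imag (y : R) : cmod (Complex 0 y) = `|y|.
Proof.
apply/eqP; rewrite -(@eqrXn2 _ 2) ?cmod_ge0// cmod_sqr/= expr0n add0r.
by rewrite real_normK ?num_real.
Qed.

(** Keeping only the last square in Green's identity gives y |p_n|^2 <= b_n |p_n| |p_(n+1)|. *)
Lemma pol1_imag_growth (y : R) n : 0 < y ->
  y / b n * cmod (pol1 a b n (Complex 0 y)) <= cmod (pol1 a b n.+1 (Complex 0 y)).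
Proof.
move=> y0; have := pol1_green a b_gt0 (Complex 0 y) n.
set u := fun k => pol1 a b k (Complex 0 y) => /= E.
have bn := b_gt0 n.
have h1 : y * cmod (u n) ^+ 2 <= b n * (cmod (u n) * cmod (u n.+1)).
  apply: (@le_trans _ _ (y * l2part u n.+1)).
    by rewrite ler_wpM2l ?(ltW y0)// l2part_term.
  rewrite E ler_pM2l// -(cmodJ (u n)) -cmodM.
  by apply: le_trans (ler_norm _) (le_Im_cmod _).
have un : 0 < cmod (u n).
  rewrite lt_def cmod_ge0 andbT; apply/eqP => h0.
  have := E; rewrite -/(u n) (cmod_eq0 h0) rmorph0 mul0r mulr0 => /eqP.
  rewrite gt_eqF// mulr_gt0//; apply: lt_le_trans (l2part_term u (ltn0Sn n)).
  by rewrite (_ : u 0%N = 1) // cmod1 expr1n.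
rewrite mulrAC ler_pdivrMr// -(ler_pM2l un).
move: h1; rewrite -/(u n) -/(u n.+1); move: (cmod (u n)) (cmod (u n.+1)) => c d.
by rewrite expr2; lra.
Qed.

Lemma nevanlinna_order_ge x : 0 < x -> x < 1 / beta ->
  exists r0, forall r, r0 <= r -> exists2 z, cmod z = r & expR (r `^ x) <= mxmod (W z).
Proof.
move=> x0 xb; have be1 := beta_gt1.
pose E := expR 1 : R; have E0 : 0 < E := expR_gt0 1.
(* For 0 < k <= (c r)^(1/beta) this gives b_k <= r/e, so every such step multiplies the modulus by
   at least e; the condition [E * b 0 <= r] treats k = 0. *)
pose c := (E * Cb)^-1; have c0 : 0 < c by rewrite invr_gt0 mulr_gt0.
have ib0 : 0 < 1 / beta by rewrite divr_gt0//; lra.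
have [r0 [r01 Hr0]] := powR_dominates (2 * (c `^ (1 / beta))^-1) xb.
exists (Num.max r0 (E * b 0%N)) => r; rewrite ge_max => /andP[r0r Er].
have r1 : 1 <= r by lra.
have rp : 0 < r by lra.
exists (Complex 0 r); first by rewrite cmod_imag ger0_norm// ltW.
pose w := (c * r) `^ (1 / beta); pose n := Num.truncn w.
have w0 : 0 <= w by exact: powR_ge0.
have wE : w `^ beta = c * r.
  by rewrite -powRrM mul1r mulVf ?powRr1 ?mulr_ge0// ?ltW//; lra.
pose u k := pol1 a b k (Complex 0 r).
have un k : (k <= n)%N -> E ^+ k <= cmod (u k).
  elim: k => [_|k ih kn]; first by rewrite expr0 -/(u 0%N) (_ : u 0%N = 1) // cmod1.
  apply: le_trans (pol1_imag_growth k rp); rewrite exprS.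
  apply: ler_pM; rewrite ?(ltW E0) ?exprn_ge0 ?(ltW E0) ?ih ?(ltnW kn)//.
  rewrite ler_pdivlMr//; case: (posnP k) => [->//|k0].
  apply: (@le_trans _ _ (E * (Cb * (c * r)))); last first.
    by rewrite le_eqVlt /c; apply/orP; left; apply/eqP; field; rewrite !gt_eqF.
  rewrite ler_pM2l//; apply: le_trans (b_le k0) _; rewrite ler_pM2l// -wE.
  rewrite ge0_ler_powR ?nnegrE//; first lra.
  by rewrite -truncn_ge_nat//; exact: ltnW.
have m0 : 0 <= mxmod (W (Complex 0 r)) by exact: le_trans (cmod_ge0 _) (entry_le_mxmod (W _) 0 0).
have := kernel_le_mxmod b_gt0 p2 q2 (Complex 0 r) n.+1; rewrite /= (gtr0_norm rp) => K.
have Em : E ^+ n <= mxmod (W (Complex 0 r)).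
  rewrite -(@ler_pXn2r _ 2) ?nnegrE ?exprn_ge0 ?(ltW E0)//; apply: le_trans K.
  apply: (@le_trans _ _ (cmod (u n) ^+ 2)).
    by rewrite lerXn2r ?nnegrE ?cmod_ge0 ?exprn_ge0 ?(ltW E0)// un.
  apply: le_trans (l2part_term u (ltnSn n)) _.
  by rewrite ler_peMl// l2part_ge0.
apply: (le_trans _ Em); rewrite -expRM_natl mulr1 ler_expR.
have wn : w < n.+1%:R by rewrite real_truncnS_gt// num_real.
have lr : 0 <= ln r by exact: ln_ge0.
have rx1 : 1 <= r `^ x by rewrite -(powRr0 r) ler_powR// ltW.
have cp : 0 < c `^ (1 / beta) by rewrite powR_gt0.
have h : 2 * r `^ x <= w.
  rewrite /w powRM ?(ltW c0) ?(ltW rp)// [leRHS]mulrC -ler_pdivrMr//.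
  apply: le_trans (Hr0 r r0r).
  have -> : 2 * r `^ x / c `^ (1 / beta) = 2 * (c `^ (1 / beta))^-1 * (r `^ x * 1) by ring.
  have cc : 0 <= 2 * (c `^ (1 / beta))^-1 by rewrite mulr_ge0// invr_ge0 ltW.
  by apply: (ler_wpM2l cc); rewrite ler_pM2l ?lerDl// (lt_le_trans ltr01).
rewrite -natr1 in wn; rewrite -(lerD2r 1); apply: le_trans (ltW wn).
by apply: le_trans h; rewrite [leRHS]mulrC mulrDr mulr1 lerD2l.
Qed.

(** * Exponential growth before the turning point *)

Section CriticalDiagonal.
Variables (s D : R).
Hypothesis s2 : s ^+ 2 = 1.
Hypothesis beta_lt2 : beta < 2.
Hypothesis D_gt0 : 0 < D.
Hypothesis defect_le : forall n, (0 < n)%N -> defect s a b n <= D * n%:R `^ (beta - 1).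

Section OneFrequency.
Variable y : R.
Hypothesis y_gt0 : 0 < y.
(** The sign gives s z = -i y, so that the flux equation takes the same form d' = (i y - defect) v
    for both values of s. *)
Let z : R[i] := Complex 0 (- s * y).
Let u n := pol1 a b n z.
Let v := cflip s u.
Let d := cflux b s u.
(* For v'' = (i y/b) v the growing solution has flux proportional to
   (1 + i) v, so both the real and the imaginary part of conj(v) d grow;
   the factor 2 absorbs the defect. *)
Let g n : R := complex.Re ((v n.+1)^*%C * d n) + 2 * complex.Im ((v n.+1)^*%C * d n).

Let v_step n : v n.+1 = v n + (b n)%:C%C^-1 * d n.
Proof.
have bn : (b n)%:C%C != 0 :> R[i] by exact: bC_neq0.
by rewrite /d /cflux (mulKf bn) addrC subrK.
Qed.

Let d_step n : d n.+1 = d n - ((defect s a b n)%:C%C - Complex 0 y) * v n.+1.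
Proof.
have Ju : (b n.+1)%:C%C * u n.+2 + (a n.+1)%:C%C * u n.+1 + (b n)%:C%C * u n = z * u n.+1.
  by rewrite -jacobi_mulS; exact: pol1_J.
have E : (b n.+1)%:C%C * u n.+2 = (z - (a n.+1)%:C%C) * u n.+1 - (b n)%:C%C * u n.
  by rewrite mulrBl -Ju; cring.
rewrite /d (cflux_step s2 E); congr (_ - (_ + _) * _).
apply/eqP; rewrite eq_complex /= !mul0r mulr0 subrr addr0 mulrA mulrN -expr2 s2.
by rewrite !mulN1r eqxx oppr0 eqxx.
Qed.

Let g_step n : g n.+1 = g n + cmod (d n.+1) ^+ 2 / b n.+1 +
  (2 * y - defect s a b n) * cmod (v n.+1) ^+ 2.
Proof.
have bn := b_gt0 n.+1.
have E2 : d n = d n.+1 + ((defect s a b n)%:C%C - Complex 0 y) * v n.+1.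
  by rewrite d_step subrK.
rewrite /g (v_step n.+1) E2 !cmod_sqr -fmorphV.
move: (defect s a b n) => e; case: (d n.+1) => d1 d2; case: (v n.+1) => v1 v2 /=.
by field; rewrite gt_eqF.
Qed.

Let g_le n : g n <= 3 * (cmod (v n.+1) * cmod (d n)).
Proof.
rewrite -(cmodJ (v n.+1)) -cmodM /g; set c := _ * _.
have h1 := le_trans (ler_norm _) (le_Re_cmod c).
have h2 := le_trans (ler_norm _) (le_Im_cmod c).
lra.
Qed.

Let g_grow n t : 0 < t -> t <= 1 -> t ^+ 2 * b n.+1 <= y -> defect s a b n <= y -> 0 <= g n ->
  g n * expR (t / 5) <= g n.+1.
Proof.
move=> t0 t1 tb cy g0.
have bn := b_gt0 n.+1; have y0 := y_gt0.
pose V := cmod (v n.+1); pose A := cmod (d n.+1).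
have V0 : 0 <= V by exact: cmod_ge0.
have A0 : 0 <= A by exact: cmod_ge0.
have gE : g n + A ^+ 2 / b n.+1 + y * V ^+ 2 <= g n.+1.
  by rewrite g_step lerD2l ler_wpM2r ?sqr_ge0//; lra.
have A2 : 0 <= A ^+ 2 / b n.+1 by rewrite divr_ge0 ?sqr_ge0// ltW.
have V2 : 0 <= y * V ^+ 2 by rewrite mulr_ge0 ?sqr_ge0// ltW.
have VA : t * (V * A) <= (A ^+ 2 / b n.+1 + y * V ^+ 2) / 2.
  have sq : 0 <= (A - t * b n.+1 * V) ^+ 2 / b n.+1 by rewrite divr_ge0 ?sqr_ge0// ltW.
  have E : (A - t * b n.+1 * V) ^+ 2 / b n.+1 =
     A ^+ 2 / b n.+1 - 2 * (t * (V * A)) + t ^+ 2 * b n.+1 * V ^+ 2 by field; rewrite gt_eqF.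
  have h := ler_wpM2r (sqr_ge0 V) tb.
  by rewrite E in sq; lra.
have vS : cmod (v n.+2) <= V + A / b n.+1.
  rewrite v_step; apply: le_trans (cmodD _ _) _.
  by rewrite (cmodM _ (d n.+1)) cmodV cmod_real gtr0_norm// [X in _ + X]mulrC.
(* By [g_le] and [vS] the left side is at most 3 t V A + 3 t A^2 / b. The first term is at most 3/2
   of the bracket by [VA], the second at most 3 times it as t <= 1. *)
have gS : t * g n.+1 <= 5 * (A ^+ 2 / b n.+1 + y * V ^+ 2).
  have h1 : t * g n.+1 <= t * (3 * ((V + A / b n.+1) * A)).
    rewrite ler_pM2l//; apply: le_trans (g_le _) _; rewrite ler_pM2l//.
    by rewrite ler_wpM2r.
  have h2 : t * (A ^+ 2 / b n.+1) <= A ^+ 2 / b n.+1 by rewrite ler_piMl.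
  have E : t * (3 * ((V + A / b n.+1) * A)) = 3 * (t * (V * A)) + 3 * (t * (A ^+ 2 / b n.+1)).
    by field; rewrite gt_eqF.
  by rewrite E in h1; lra.
have gS0 : 0 <= g n.+1 by lra.
have h : g n <= g n.+1 * (1 - t / 5) by lra.
have e : 1 - t / 5 <= expR (- (t / 5)) by exact: expR_ge1Dx.
have h3 := ler_wpM2l gS0 e.
have : g n <= g n.+1 * expR (- (t / 5)) by lra.
by rewrite expRN ler_pdivlMr ?expR_gt0.
Qed.

(** t is a common lower bound for the rates sqrt(y / b_n) up to N. The final value of g is at most a
    multiple of b_N times the kernel, and t^2 b_N <= y trades b_N for the factor y of the kernel
    inequality. *)
Lemma critical_growth N t : 0 < t -> t <= 1 -> (0 < N)%N ->
  (forall n, (n < N)%N -> t ^+ 2 * b n.+1 <= y /\ defect s a b n <= y) ->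
  5 + b 0%N + `|a 0%N| <= y ->
  t ^+ 2 * expR (N%:R * t / 5) <= mxmod (W z) ^+ 2.
Proof.
move=> t0 t1 N0 H y5.
have y0 := y_gt0; have b0 := b_gt0 0.
have s1 : `|s| = 1 by exact: norm_of_sqr1.
(* The 5 cancels the factor 5 in [up] below. *)
have g0 : 5 <= g 0%N.
  have D0 : d 0%N = Complex (s * a 0%N - b 0%N) y.
    rewrite /d /cflux /cflip /u /pol1 /z /= expr0 expr1 -fmorphV.
    have bb : b 0%N != 0 by rewrite gt_eqF.
    apply/eqP; rewrite eq_complex /=; apply/andP; split; apply/eqP.
      by rewrite ?expr0 ?expr1; field.
    transitivity (s ^+ 2 * y); last by rewrite s2 mul1r.
    by field.
  have v1 : v 1%N = 1 + (b 0%N)^-1%:C%C * d 0%N.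
    by rewrite v_step fmorphV /v /cflip expr0 mul1r.
  have sa : s * a 0%N <= `|a 0%N| by rewrite (le_trans (ler_norm _))// normrM s1 mul1r.
  have sa' : - `|a 0%N| <= s * a 0%N by rewrite lerNl (le_trans (ler_norm _))// normrN normrM s1 mul1r.
  rewrite /g v1 D0 /=; set e := s * a 0%N in sa sa' *.
  have q0 : 0 <= (b 0%N)^-1 * ((e - b 0%N) ^+ 2 + y ^+ 2).
    by rewrite mulr_ge0 ?invr_ge0 ?(ltW b0)// addr_ge0// sqr_ge0.
  rewrite [leRHS](_ : _ = (e - b 0%N) + 2 * y + (b 0%N)^-1 * ((e - b 0%N) ^+ 2 + y ^+ 2)); last by ring.
  by lra.
have gn n : (n <= N)%N -> 5 * expR (n%:R * t / 5) <= g n.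
  elim: n => [_|n ih nN]; first by rewrite mul0r mul0r expR0 mulr1.
  have [h1 h2] := H n nN; have gi := ih (ltnW nN).
  have gn0 : 0 <= g n by apply: le_trans gi; rewrite mulr_ge0 ?expR_ge0.
  apply: le_trans (g_grow t0 t1 h1 h2 gn0).
  have -> : n.+1%:R * t / 5 = n%:R * t / 5 + t / 5 by rewrite -natr1; ring.
  by rewrite expRD mulrA ler_wpM2r ?expR_ge0.
have bN := b_gt0 N.
have dN : cmod (d N) <= b N * (cmod (v N.+1) + cmod (v N)).
  by rewrite /d /cflux cmodM cmod_real gtr0_norm// ler_pM2l// cmodB.
have gN := gn N (leqnn N).
have up : g N <= 5 * (b N * l2part u N.+2).
  apply: le_trans (g_le N) _.
  have := cmod_ge0 (v N.+1); have := cmod_ge0 (v N) => h1 h2.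
  have h3 := ler_wpM2l h2 dN.
  have h4 : cmod (v N) ^+ 2 + cmod (v N.+1) ^+ 2 <= l2part u N.+2.
    by rewrite !l2partS !cmod_cflip// -addrA lerDr l2part_ge0.
  have h5 := ler_wpM2l (ltW bN) h4.
  have h6 : 0 <= b N * (cmod (v N.+1) - cmod (v N)) ^+ 2 by rewrite mulr_ge0 ?sqr_ge0// ltW.
  have h7 : 0 <= b N * cmod (v N) ^+ 2 by rewrite mulr_ge0 ?sqr_ge0// ltW.
  have h8 : 0 <= b N * cmod (v N.+1) ^+ 2 by rewrite mulr_ge0 ?sqr_ge0// ltW.
  by move: h3 h5 h6 h7 h8; move: (cmod (v N)) (cmod (v N.+1)) (b N) => A B c; lra.
have := kernel_le_mxmod b_gt0 p2 q2 z N.+2.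
rewrite /z /= normrM normrN s1 mul1r (gtr0_norm y0) -/z; apply: le_trans.
have [tb _] : t ^+ 2 * b N <= y /\ True by case: N N0 H {gn gN up dN bN} => // N _ H; have [] := H N (ltnSn N).
have L0 := l2part_ge0 u N.+2.
have h1 := ler_wpM2r L0 tb.
have h2 : expR (N%:R * t / 5) <= b N * l2part u N.+2.
  by rewrite -(@ler_pM2l _ 5)//; exact: le_trans gN up.
by apply: le_trans h1; rewrite -[leRHS]mulrA ler_wpM2l ?sqr_ge0.
Qed.

End OneFrequency.

(** N is about ep y^kap with kap = 1/(beta - 1), and ep is so small that the defect stays below y up
    to N. With t^2 = y / (Cb N^beta), the exponent satisfies (N t)^2 = N^(2 - beta) y / Cb, of size
    y^(kap (2 - beta) + 1) = y^kap, so N t grows like y^(kap/2). *)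
Lemma critical_order_ge x : 0 < x -> x < 1 / (2 * (beta - 1)) ->
  exists r0, forall r, r0 <= r -> exists2 z, cmod z = r & expR (r `^ x) <= mxmod (W z).
Proof.
move=> x0 xr; have be1 := beta_gt1; have be2 := beta_lt2; have D0 := D_gt0; have Cb0 := Cb_gt0.
have b10 : 0 < beta - 1 by lra.
pose kap := (beta - 1)^-1; have kap0 : 0 < kap by rewrite invr_gt0.
have kap1 : kap * (beta - 1) = 1 by rewrite mulVf// gt_eqF.
pose rho := 1 / (2 * (beta - 1)).
have rhoE : kap = 2 * rho by rewrite /kap /rho; field; rewrite gt_eqF.
pose ep := (D + 1) `^ (- kap).
have ep0 : 0 < ep by rewrite powR_gt0//; lra.
have epE : ep `^ (beta - 1) = (D + 1)^-1.
  by rewrite -powRrM mulNr kap1 powR_inv1//; lra.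
(* Since N lies between w/2 and w, c1 bounds N t / y^rho from below; c2 serves the lower bound of
   t^2, and cA the condition t <= 1. *)
pose c1 := Num.sqrt ((ep / 2) `^ (2 - beta) / Cb).
have ep2 : 0 < ep / 2 by rewrite divr_gt0.
have c10 : 0 < c1 by rewrite sqrtr_gt0 divr_gt0// powR_gt0.
have c12 : c1 ^+ 2 = (ep / 2) `^ (2 - beta) / Cb.
  by rewrite sqr_sqrtr// divr_ge0 ?powR_ge0// ltW.
pose c2 := (Cb * ep `^ beta)^-1.
have c20 : 0 < c2 by rewrite invr_gt0 mulr_gt0// powR_gt0.
have kb1 : 1 < kap * beta by move: kap1; rewrite mulrBr mulr1; lra.
pose cA := (Cb * (ep / 2) `^ beta)^-1.
have cA0 : 0 < cA by rewrite invr_gt0 mulr_gt0// powR_gt0.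
(* The 2 comes from squaring the matrix norm; the other summands compensate the factor t^2, which is
   polynomially small in y. *)
pose L := 2 + `|ln c2| + (kap * beta - 1).
have L0 : 0 <= L by rewrite /L; have := normr_ge0 (ln c2); lra.
have [r1 [r11 H1]] := @powR_dominates R x rho (5 * c1^-1 * L) xr.
have [r2 [r21 H2]] := @powR_dominates R 1 (kap * beta) cA kb1.
have [r3 [r31 H3]] := @powR_dominates R 0 kap (2 / ep) kap0.
exists (Num.max (Num.max r1 r2) (Num.max r3 (Num.max (5 + b 0%N + `|a 0%N|) `|defect s a b 0|))) => y.
rewrite !ge_max => /andP[/andP[r1y r2y] /and3P[r3y ay cy]].
have {H1} := H1 y r1y; have {H2} := H2 y r2y; have {H3} := H3 y r3y => H3 H2 H1.
have y1 : 1 <= y by lra.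
have y0 : 0 < y by lra.
have ly : 0 <= ln y by exact: ln_ge0.
exists (Complex 0 (- s * y)).
  rewrite cmod_imag normrM normrN (gtr0_norm y0).
  have -> : `|s| = 1 by exact: norm_of_sqr1.
  by rewrite mul1r.
pose w := ep * y `^ kap; pose N := Num.truncn w.
have yk0 : 0 < y `^ kap by rewrite powR_gt0.
have w0 : 0 < w by rewrite mulr_gt0.
have w2 : 2 <= w.
  have : 2 / ep <= y `^ kap.
    apply: le_trans H3; rewrite powRr0 mul1r ler_peMr ?divr_ge0// ?lerDl//; exact: ltW.
  by rewrite ler_pdivrMr// mulrC.
have Nw : N%:R <= w by rewrite truncn_le ltW.
have wN : w / 2 <= N%:R.
  have : w < N.+1%:R by rewrite real_truncnS_gt// num_real.
  by rewrite -[N.+1]addn1 natrD; move: (N%:R) w2 => k; lra.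
have N0 : (0 < N)%N by rewrite -(ltr0n R); apply: lt_le_trans wN; rewrite divr_gt0.
have Np : 0 < N%:R :> R by rewrite ltr0n.
have Nb : 0 < N%:R `^ beta :> R by exact: natr_pow_gt0.
pose t := Num.sqrt (y / (Cb * N%:R `^ beta)).
have t2 : t ^+ 2 = y / (Cb * N%:R `^ beta).
  by rewrite sqr_sqrtr// divr_ge0 ?(ltW y0)// mulr_ge0// ltW.
have t0 : 0 < t by rewrite sqrtr_gt0 divr_gt0// mulr_gt0.
have w2b : (w / 2) `^ beta = (ep / 2) `^ beta * y `^ (kap * beta).
  by rewrite /w mulrAC [LHS]powRM ?(ltW ep2) ?(ltW yk0)// powRrM.
have t1 : t <= 1.
  rewrite -(@ler_pXn2r _ 2) ?nnegrE ?(ltW t0)// expr1n t2 ler_pdivrMr ?mulr_gt0// mul1r.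
  apply: (@le_trans _ _ (Cb * (w / 2) `^ beta)).
    rewrite w2b mulrA mulrC -ler_pdivrMr; last by rewrite mulr_gt0// powR_gt0.
    apply: le_trans H2; rewrite powRr1 ?(ltW y0)// mulrC ler_pM2l//.
    by rewrite ler_peMr ?(ltW y0)// lerDl.
  rewrite ler_pM2l// ge0_ler_powR ?nnegrE// ltW//; first by lra.
  by rewrite divr_gt0.
have H n : (n < N)%N -> t ^+ 2 * b n.+1 <= y /\ defect s a b n <= y.
  move=> nN; split.
    rewrite t2 mulrAC ler_pdivrMr ?mulr_gt0// ler_pM2l//.
    apply: le_trans (b_le (ltn0Sn n)) _; rewrite ler_pM2l//.
    by rewrite ge0_ler_powR ?nnegrE ?ler_nat//; lra.
  case: (posnP n) => [->|n0]; first exact: le_trans (ler_norm _) cy.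
  apply: le_trans (defect_le n0) _.
  apply: (@le_trans _ _ (D * w `^ (beta - 1))).
    rewrite ler_pM2l// ge0_ler_powR ?nnegrE ?(ltW w0) ?(ltW b10)//.
    by apply: le_trans Nw; rewrite ler_nat ltnW.
  rewrite /w powRM ?(ltW ep0) ?(ltW yk0)// epE -powRrM kap1 powRr1 ?(ltW y0)//.
  rewrite mulrA ler_piMl ?(ltW y0)// ler_pdivrMr; lra.
have M := critical_growth y0 t0 t1 N0 H ay.
set m := mxmod _ in M *.
have m0 : 0 <= m by exact: le_trans (cmod_ge0 _) (entry_le_mxmod (W _) 0 0).
rewrite -(@ler_pXn2r _ 2) ?nnegrE ?expR_ge0//; apply: le_trans M.
have Nt : c1 * y `^ rho <= N%:R * t.
  rewrite -(@ler_pXn2r _ 2) ?nnegrE ?mulr_ge0 ?powR_ge0 ?(ltW t0) ?(ltW c10)// !exprMn c12 t2.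
  have -> : (y `^ rho) ^+ 2 = y `^ kap by rewrite -powR_mulrn ?powR_ge0// -powRrM mulrC -rhoE.
  have -> : N%:R ^+ 2 * (y / (Cb * N%:R `^ beta)) = N%:R `^ (2 - beta) / Cb * y.
    by rewrite natr_powD// powRN powR_mulrn//; field; rewrite !gt_eqF.
  apply: (@le_trans _ _ ((w / 2) `^ (2 - beta) / Cb * y)); last first.
    rewrite ler_pM2r// ler_pM2r ?invr_gt0// ge0_ler_powR ?nnegrE// ltW//; first by lra.
    by rewrite divr_gt0.
  have -> : (w / 2) `^ (2 - beta) = (ep / 2) `^ (2 - beta) * y `^ (kap * (2 - beta)).
    by rewrite /w mulrAC [LHS]powRM ?(ltW ep2) ?(ltW yk0)// powRrM.
  have -> : y `^ kap = y `^ (kap * (2 - beta)) * y.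
    rewrite -[X in _ * X](powRr1 (ltW y0)) -powRD ?(gt_eqF y0) ?implybT//; congr (_ `^ _).
    by rewrite -[X in _ + X]kap1; ring.
  by rewrite le_eqVlt; apply/orP; left; apply/eqP; ring.
have t2ge : expR (ln c2 - (kap * beta - 1) * ln y) <= t ^+ 2.
  have E : w `^ beta = ep `^ beta * y `^ (kap * beta).
    by rewrite /w powRM ?(ltW ep0) ?(ltW yk0)// powRrM.
  rewrite expRD lnK ?posrE//.
  have -> : expR (- ((kap * beta - 1) * ln y)) = y / y `^ (kap * beta).
    rewrite -[X in X / _](powRr1 (ltW y0)) -powRN -powRD ?(gt_eqF y0) ?implybT//.
    by rewrite /powR gt_eqF//; congr expR; ring.
  have -> : c2 * (y / y `^ (kap * beta)) = y / (Cb * w `^ beta).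
    have yb : 0 < y `^ (kap * beta) by rewrite powR_gt0.
    have eb : 0 < ep `^ beta by rewrite powR_gt0.
    by rewrite E /c2; field; rewrite !gt_eqF.
  rewrite t2 ler_pM2l// lef_pV2 ?posrE ?mulr_gt0 ?powR_gt0// ler_pM2l//.
  by rewrite ge0_ler_powR ?nnegrE ?(ltW w0)//; lra.
rewrite -expRM_natl.
apply: (@le_trans _ _ (expR (ln c2 - (kap * beta - 1) * ln y) * expR (N%:R * t / 5))); last first.
  by rewrite ler_wpM2r ?expR_ge0.
rewrite -expRD ler_expR.
have yx1 : 1 <= y `^ x by rewrite -(powRr0 y) ler_powR// ltW.
have HL : L * (y `^ x * (1 + ln y)) <= N%:R * t / 5.
  rewrite ler_pdivlMr//; apply: le_trans Nt; rewrite mulrC mulrA -ler_pdivrMl//.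
  by apply: le_trans H1; rewrite le_eqVlt; apply/orP; left; apply/eqP; ring.
apply: le_trans (_ : _ <= ln c2 - (kap * beta - 1) * ln y + L * (y `^ x * (1 + ln y))) _; last by rewrite lerD2l.
have h1 := ler_norm (- ln c2); rewrite normrN in h1.
have q1 : 1 <= y `^ x * (1 + ln y) by nra.
have q2' : ln y <= y `^ x * (1 + ln y) by nra.
have q3 : y `^ x <= y `^ x * (1 + ln y) by nra.
have n0 := normr_ge0 (ln c2).
have kk : 0 < kap * beta - 1 by lra.
have k1 := ler_wpM2l (ltW kk) q2'; have k2 := ler_wpM2l n0 q1.
move: h1 q3 k1 k2; rewrite /L.
move: (ln c2) `|ln c2| (ln y) (y `^ x) (kap * beta - 1) (y `^ x * _) => c e l A k B.
lra.
Qed.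

End CriticalDiagonal.
End LowerOrder.

(** * The three cases *)

Section Asymptotics.
Variables (R : realType) (a b : nat -> R) (delta beta1 beta2 x0 x1 x2 y0 y1 y2 : R).
Hypothesis b_gt0 : forall n, 0 < b n.
Hypothesis x0_gt0 : 0 < x0.
Hypothesis y0_neq0 : y0 != 0.
Hypothesis delta_gt0 : 0 < delta.
Hypothesis delta_le1 : delta <= 1.
Local Notation e := (2 + delta).
Hypothesis b_pw : pw e beta1 b x0 x1 x2.
Hypothesis a_pw : pw e beta2 a y0 y1 y2.
Local Notation t n := (n%:R^-1 : R).

Let e_gt0 : 0 < e. Proof. by have := delta_gt0; lra. Qed.
Let e_le3 : e <= 3. Proof. by have := delta_le1; lra. Qed.
Let e_ge2 : 2 <= e. Proof. by have := delta_gt0; lra. Qed.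
Let x0_neq0 : x0 != 0. Proof. by rewrite gt_eqF. Qed.

Lemma xp_quotient f g p0 p1 p2 q0 q1 q2 : xp e f p0 p1 p2 -> xp e g q0 q1 q2 ->
  q0 != 0 -> exists r1 r2, xp e (fun n => f n / g n) (p0 / q0) r1 r2.
Proof.
move=> hf hg q00; pose r1 := (p1 - p0 / q0 * q1) / q0.
exists r1, ((p2 - p0 / q0 * q2 - r1 * q1) / q0).
by apply: (xp_div e_gt0 e_le3 hf hg q00); rewrite /r1; field.
Qed.

Lemma ratio_xp : exists r2, xp e (fun n => b n / b n.+1) 1 (- beta1) r2.
Proof. exact: (pw_ratio e_gt0 e_le3 x0_neq0 b_pw). Qed.

Lemma ratio_xp2 : xp 2 (fun n => b n / b n.+1) 1 (- beta1) 0.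
Proof. by have [r2 h] := ratio_xp; exact: xp_weaken2 (lexx 2) (xp_weaken e_ge2 h). Qed.

Lemma pw_quotient : exists r1 r2,
  xp e (fun n => (a n / b n) * n%:R `^ (beta1 - beta2)) (y0 / x0) r1 r2.
Proof.
have [r1 [r2 h]] := xp_quotient a_pw b_pw x0_neq0; exists r1, r2.
apply: xp_ext h => n n0.
have p1' := @natr_pow_gt0 R n beta1 n0; have p2' := @natr_pow_gt0 R n beta2 n0.
rewrite natr_powD// powRN; have bn := b_gt0 n.
by field; rewrite !gt_eqF.
Qed.

Lemma diagonal_bound : beta2 <= beta1 -> exists C, forall n, (0 < n)%N -> `|a n| <= C * n%:R `^ beta1.
Proof.
move=> be; have [C C0 H] := OO_all (xp_bounded e_gt0 a_pw); exists C => n n0.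
have p2' := @natr_pow_gt0 R n beta2 n0.
have := H n n0; rewrite oppr0 powRr0 mulr1 normrM normfV (gtr0_norm p2') ler_pdivrMr// => h.
by apply: le_trans h _; rewrite ler_wpM2l// natr_pow_le.
Qed.

Definition decays gam := forall u, recurrence a b u -> OO gam (fun n => u n ^+ 2).

Lemma small_decay gam : small_diagonal beta1 beta2 x0 y0 -> 0 <= gam -> gam < beta1 -> decays gam.
Proof.
move=> sm g0 gb u ru; pose g n := a n / b n.
have uE n : u n.+2 = - g n.+1 * u n.+1 - b n / b n.+1 * u n.
  apply: (mulfI (lt0r_neq0 (b_gt0 n.+1))); have bn := b_gt0 n.+1.
  transitivity (- a n.+1 * u n.+1 - b n * u n); last by rewrite /g; field; rewrite gt_eqF.
  by have := ru n; lra.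
have [r1 [r2 hh]] := pw_quotient.
set th := beta1 - beta2 in hh.
have diffE p0 p1 p2 f : xp e f p0 p1 p2 -> OO 2 (fun n => f n.+1 - f n).
  move=> hf; have h := xpB (xp_shift e_gt0 e_le3 hf) hf.
  have h' : xp e (fun n => f n.+1 - f n) 0 0 (- p1) by apply: xp_eq h; ring.
  have := xp_weaken2 0 (lexx 2) (xp_weaken e_ge2 h').
  by apply: OO_ext => n _ /=; rewrite !mul0r !addr0 subr0.
case: sm => [be|[be yx]].
  have th0 : 0 < th by rewrite /th; lra.
  pose h n : R := g n * n%:R `^ th.
  have gE n : (0 < n)%N -> g n = n%:R `^ (- th) * h n.
    move=> n0; rewrite /h mulrCA -natr_powD// addNr powRr0 mulr1 //.
  have hb : OO 0 h := xp_bounded e_gt0 hh.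
  have gO : OO th g.
    by apply: (OO_ext (f := fun n => n%:R `^ (- th) * h n)) (OOMl (OO_pow th) hb) => n /gE.
  (* Writing g = n^(-th) h, differencing n^(-th) gains 1/n and the increments of h are O(n^-2), so g
     may decay slowly and still have summable increments. *)
  have dO : OO (1 + th) (fun n => g n.+1 - g n).
    have k1 := xp_pow e_le3 (- th) 1.
    have k2 : OO 1 (fun n => (1 + 1%:R * t n) `^ (- th) - 1).
      have e1 : 1 <= e by have := delta_gt0; lra.
      have k3 := xpB k1 (xp_const e_le3 1).
      have k4 := xp_weaken1 0 0 (lexx 1) (xp_weaken e1 k3).
      by apply: OO_ext k4 => n _ /=; rewrite !mul0r !addr0 subrr subr0.
    have k5 : OO 0 (fun n => (1 + 1%:R * t n) `^ (- th)) := xp_bounded e_gt0 k1.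
    have k6 := OOM (OO_pow th) (OOD (OOMr k5 (OO_le (ler1n R 2) (diffE _ _ _ _ hh))) (OOMl k2 hb)).
    rewrite addrC; apply: OO_ext k6 => n n0.
    have n00 : 0 < n%:R :> R by rewrite ltr0n.
    have E : n.+1%:R `^ (- th) = n%:R `^ (- th) * (1 + 1%:R * t n) `^ (- th) :> R.
      rewrite -powRM ?addr_ge0 ?mulr_ge0 ?invr_ge0//; congr (_ `^ _).
      by rewrite -natr1; field; rewrite gt_eqF.
    by rewrite (gE n.+1)// (gE n)// E /h /g; ring.
  pose d := Num.min 1 th.
  have d0 : 0 < d by rewrite lt_min ltr01.
  have d1 : d <= 1 by rewrite ge_min lexx.
  have dth : 1 + d <= 1 + th by rewrite lerD2l ge_min lexx orbT.
  apply: (@oscillating_decay _ u _ g beta1 gam d (1 / 4) uE ratio_xp2 d0 d1 (OO_le dth dO)) => //.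
  have [N HN] := OO_small th0 ltr01 gO.
  by exists N => n /HN; lra.
have th0 : th = 0 by rewrite /th be subrr.
have hg : xp e g (y0 / x0) r1 r2.
  by apply: xp_ext hh => n _; rewrite th0 powRr0 mulr1.
pose k := (2 - `|y0| / x0) / 8.
have k0 : 0 < k by rewrite divr_gt0// subr_gt0 ltr_pdivrMr.
apply: (@oscillating_decay _ u _ g beta1 gam 1 k uE ratio_xp2 ltr01 (lexx 1) _ k0) => //.
  by rewrite (_ : 1 + 1 = 2 :> R) //; exact: diffE hg.
have k40 : 0 < 4 * k by rewrite mulr_gt0.
have [N HN] := xp_lim e_gt0 hg k40.
exists N => n /HN h.
have E : `|y0 / x0| = 2 - 8 * k.
  by rewrite normrM normfV (gtr0_norm x0_gt0) /k; field.
have := ler_normD (g n - y0 / x0) (y0 / x0); rewrite subrK E; lra.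
Qed.

(** |a_n / b_n| eventually exceeds some q > 2 while b_n / b_(n+1) tends to 1, so the diagonal
    eventually dominates. *)
Lemma large_growing : beta1 < beta2 \/ (beta1 = beta2 /\ 2 * x0 < `|y0|) ->
  exists2 u, recurrence a b u & ~ rsummable u.
Proof.
move=> lg.
have [r2 hr] := ratio_xp; have [k1 [k2 hk]] := pw_quotient.
suff [q q2 [N HN]] : exists2 q, 2 < q & exists N : nat, forall n, (N <= n)%N -> q <= `|a n / b n|.
  have q0 : 0 < q - 2 by lra.
  have [M HM] := xp_lim e_gt0 hr q0.
  apply: (growing_solution b_gt0 (N := maxn N M)) => n; rewrite geq_max => /andP[Nn Mn].
  have bn := b_gt0 n.+1.
  have h1 := HN n.+1 (leqW Nn); have h2 := HM n Mn.
  rewrite normrM normfV (gtr0_norm bn) ler_pdivlMr// in h1.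
  apply: le_trans h1; have h3 : b n / b n.+1 <= q - 1.
    by have := ler_norm (b n / b n.+1 - 1); lra.
  rewrite ler_pdivrMr// in h3; lra.
pose th := beta2 - beta1.
have yx0 : 0 < `|y0| / x0 by rewrite divr_gt0// normr_gt0.
have lim0 : `|y0 / x0| = `|y0| / x0 by rewrite normrM normfV (gtr0_norm x0_gt0).
case: lg => [be|[be yx]].
  have th0 : 0 < th by rewrite /th; lra.
  have h0 : 0 < `|y0| / x0 / 2 by rewrite divr_gt0.
  have [N HN] := xp_lim e_gt0 hk h0.
  have [M HM] := @natr_pow_large R th (3 / (`|y0| / x0 / 2)) th0.
  exists 3; first by lra.
  exists (maxn N M).+1 => n; rewrite gtn_max => /andP[Nn Mn].
  have n0 : (0 < n)%N by exact: leq_ltn_trans Nn.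
  have h1 := HN n (ltnW Nn); have h2 := HM n (ltnW Mn).
  rewrite ler_pdivrMr// in h2.
  have h3 : `|y0| / x0 / 2 <= `|a n / b n * n%:R `^ (beta1 - beta2)|.
    have := ler_normD (y0 / x0 - a n / b n * n%:R `^ (beta1 - beta2)) (a n / b n * n%:R `^ (beta1 - beta2)).
    by rewrite subrK lim0 distrC; lra.
  have pn := @natr_pow_gt0 R n th n0.
  apply: le_trans h2 _; rewrite mulrC; apply: le_trans (ler_wpM2r (ltW pn) h3) _.
  rewrite normrM -mulrA [X in _ * X](_ : _ = 1) ?mulr1//.
  rewrite ger0_norm ?powR_ge0// -natr_powD// /th.
  by rewrite (_ : beta1 - beta2 + (beta2 - beta1) = 0) ?powRr0//; ring.
pose q := 1 + `|y0| / x0 / 2.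
have yx2 : 2 < `|y0| / x0 by rewrite ltr_pdivlMr.
have q2 : 2 < q by rewrite /q; lra.
exists q => //.
have h0 : 0 < `|y0| / x0 - q by move: q2; rewrite /q; lra.
have [N HN] := xp_lim e_gt0 hk h0.
exists N => n /HN; rewrite be subrr powRr0 mulr1 => h.
have := ler_normD (y0 / x0 - a n / b n) (a n / b n).
by rewrite subrK lim0 distrC; lra.
Qed.

Lemma diagonal_bounds : exists cb Cb : R, [/\ 0 < cb, 0 < Cb &
  forall n, (0 < n)%N -> cb * n%:R `^ beta1 <= b n <= Cb * n%:R `^ beta1].
Proof. exact: (pw_bounds e_gt0 x0_gt0 b_gt0 e_le3 b_pw). Qed.

Lemma small_beta_limit_point : beta1 <= 1 -> ~ limit_circle a b.
Proof.
move=> be1 /(limit_circle_real a b_gt0) H.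
have [cb [Cb [_ Cb0 Hb]]] := diagonal_bounds.
apply: (carleman b_gt0 Cb0 (N := 1%N)).
  2: by split; apply: H; [exact: recurrence_rpol1|exact: recurrence_rpol2].
move=> n n0; have /andP[_ h] := Hb n n0; apply: le_trans h _; rewrite ler_pM2l//.
apply: le_trans (natr_pow_le n0 be1) _.
by rewrite powRr1// ler_nat.
Qed.

Lemma growing_limit_point : (exists2 u, recurrence a b u & ~ rsummable u) -> ~ limit_circle a b.
Proof. by move=> [u ru nu] /(limit_circle_real a b_gt0) /(_ u ru). Qed.

Lemma limit_point_of_pols : ~ (rsummable (rpol1 a b) /\ rsummable (rpol2 a b)) -> ~ limit_circle a b.
Proof.
move=> h /(limit_circle_real a b_gt0) H; apply: h.
by split; apply: H; [exact: recurrence_rpol1|exact: recurrence_rpol2].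
Qed.

Section CriticalRatio.
Variable s : R.
Hypothesis s2 : s ^+ 2 = 1.
Hypothesis sy : s * y0 = 2 * x0.
Hypothesis beta_eq : beta1 = beta2.
Local Notation sigma := (2 * x1 / x0 - 2 * y1 / y0).
Local Notation eta := (2 * (2 * x2 / x0 - 2 * y2 / y0 + y1 / y0
                  - 2 * x1 * y1 / (x0 * y0) + 2 * y1 ^+ 2 / y0 ^+ 2)).

Let sE : s = 2 * x0 / y0. Proof. by rewrite -sy mulfK. Qed.

Lemma defect_xp : exists k2, xp e (fun n => defect s a b n / b n.+1) 0 (sigma - beta1) k2.
Proof.
have ha : pw e beta1 a y0 y1 y2 by rewrite beta_eq.
eexists; apply: xp_eq (pw_defect e_gt0 e_le3 x0_neq0 sy b_pw ha) => //.
by rewrite sE; field; rewrite x0_neq0 y0_neq0.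
Qed.

(** The origin of eta: at beta1 = sigma the coefficient of 1/n vanishes, and eta is twice the
    coefficient of 1/n^2 after beta1 is eliminated in favour of sigma. *)
Lemma defect_xp_double : beta1 = sigma ->
  xp e (fun n => defect s a b n / b n.+1) 0 0 (eta / 2).
Proof.
move=> bs; have ha : pw e beta1 a y0 y1 y2 by rewrite beta_eq.
apply: xp_eq (pw_defect e_gt0 e_le3 x0_neq0 sy b_pw ha) => //.
  by rewrite [X in _ - X]bs sE; field; rewrite x0_neq0 y0_neq0.
by rewrite !bs sE; field; rewrite x0_neq0 y0_neq0.
Qed.

Lemma defect_bound m : 0 <= beta1 -> OO m (fun n => defect s a b n / b n.+1) ->
  exists2 C, 0 <= C & forall n, (0 < n)%N -> `|defect s a b n| <= C * n%:R `^ (beta1 - m).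
Proof.
move=> be0 h; have [C C0 H] := OO_all h; have [cb [Cb [_ Cb0 Hb]]] := diagonal_bounds.
exists (C * (Cb * 2 `^ beta1)); first by rewrite !mulr_ge0 ?powR_ge0// ltW.
move=> n n0; have bn := b_gt0 n.+1.
have n00 : 0 < n%:R :> R by rewrite ltr0n.
have /andP[_ h1] := Hb n.+1 (ltn0Sn n).
have h2 : n.+1%:R `^ beta1 <= 2 `^ beta1 * n%:R `^ beta1 :> R.
  rewrite -powRM//; apply: ge0_ler_powR; rewrite ?nnegrE ?mulr_ge0//.
  by rewrite -natrM ler_nat mul2n -addnn -addn1 leq_add2l.
have h3 := H n n0; rewrite normrM normfV (gtr0_norm bn) ler_pdivrMr// in h3.
apply: le_trans h3 _; rewrite natr_powD//.
have -> : C * (Cb * 2 `^ beta1) * (n%:R `^ beta1 * n%:R `^ (- m)) =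
  C * n%:R `^ (- m) * (Cb * (2 `^ beta1 * n%:R `^ beta1)) by ring.
rewrite ler_wpM2l ?mulr_ge0 ?powR_ge0//; apply: le_trans h1 _.
by rewrite ler_pM2l.
Qed.

Lemma defect_bound1 : 0 <= beta1 ->
  exists2 C, 0 <= C & forall n, (0 < n)%N -> `|defect s a b n| <= C * n%:R `^ (beta1 - 1).
Proof.
move=> be0; apply: (defect_bound be0); have [k2 h] := defect_xp.
have e1 : 1 <= e by have := delta_gt0; lra.
exact: xp_OO (xp_weaken1 0 0 (lexx 1) (xp_weaken e1 h)).
Qed.

Lemma defect_bound2 : 0 <= beta1 -> beta1 = sigma ->
  exists2 C, 0 <= C & forall n, (0 < n)%N -> `|defect s a b n| <= C * n%:R `^ (beta1 - 2).
Proof.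
move=> be0 bs; apply: (defect_bound be0).
exact: xp_OO (xp_weaken2 0 (lexx 2) (xp_weaken e_ge2 (defect_xp_double bs))).
Qed.

Lemma flip_decay gam : (forall v, flipped a b s v -> OO gam (fun n => v n ^+ 2)) -> decays gam.
Proof.
move=> H u ru; have := H _ (flip_recurrence s2 ru).
by apply: OO_ext => n _; rewrite flip_sqr.
Qed.

Lemma simply_decay gam : beta1 < sigma -> 0 <= gam -> gam < beta1 - 1 / 2 -> decays gam.
Proof.
move=> bs g0 gb; apply: flip_decay => v fv.
have [k2 h] := defect_xp.
have kap0 : 0 < sigma - beta1 by rewrite subr_gt0.
have hW := xp_weaken2 0 (lexx 2) (xp_weaken e_ge2 h).
exact: (turning_decay (flipped_step b_gt0 fv) ratio_xp2 hW kap0 g0 gb).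
Qed.

(** At s = -1/2 the form of [euler_decay] is definite by the strict inequality for eta, but its rate
    -2s is only 1. Moving s to -1/2 - h keeps it definite, since h (beta1 - 2) <= f/2, and gives a
    rate above 1. *)
Lemma doubly_decay : 2 < beta1 -> beta1 = sigma -> beta1 < 3 / 2 + eta ->
  exists2 gam, 1 < gam & decays gam.
Proof.
move=> be2 bs be; pose c := eta / 2.
have hc := defect_xp_double bs; rewrite -/c in hc.
have c0 : 0 < c - (beta1 - 3 / 2) / 2.
  by rewrite /c; move: be; set E := eta; lra.
have [r2 hr] := ratio_xp.
have b20 : 0 < beta1 - 2 by lra.
pose f := c - (beta1 - 3 / 2) / 2.
pose h := Num.min (f / (2 * (beta1 - 2))) ((beta1 - 2) / 2).
have h0 : 0 < h by rewrite lt_min !divr_gt0// mulr_gt0.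
have hb : h <= (beta1 - 2) / 2 by rewrite ge_min lexx orbT.
have hf : h * (2 * (beta1 - 2)) <= f.
  by rewrite -ler_pdivlMr ?mulr_gt0// ge_min lexx.
exists (1 + h); first by lra.
apply: flip_decay => v fv.
apply: (euler_decay (s := - (1 / 2) - h) (flipped_step b_gt0 fv) delta_gt0 delta_le1 _ hc).
- have d1 : 1 + delta <= 2 by have := delta_le1; lra.
  have d2 : 1 + delta <= e by lra.
  exact: xp_weaken2 0 d1 (xp_weaken d2 hr).
- by move: hf c0 h0; rewrite -/f /f; nra.
- by lra.
- by lra.
- by lra.
Qed.

(** The defect is eventually negative, which is diagonal dominance. *)
Lemma critical_small_limit_point : sigma < beta1 -> ~ limit_circle a b.
Proof.
move=> sb; apply: growing_limit_point.
have [k2 h] := defect_xp.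
have h1 := xp_natmul e_le3 h.
have e10 : 0 < e - 1 by have := delta_gt0; lra.
have k0 : 0 < beta1 - sigma by rewrite subr_gt0.
have [N HN] := xp_lim e10 h1 k0.
apply: (growing_solution b_gt0 (N := N.+1)) => n Nn.
have n0 : 0 < n%:R :> R by rewrite ltr0n; exact: leq_ltn_trans Nn.
have bn := b_gt0 n.+1.
have h2 : n%:R * (defect s a b n / b n.+1) <= 0.
  by have := ler_norm (n%:R * (defect s a b n / b n.+1) - (sigma - beta1)); have := HN n (ltnW Nn); lra.
rewrite pmulr_rle0// pmulr_lle0 ?invr_gt0// /defect subr_le0 in h2.
apply: le_trans h2 _; apply: le_trans (ler_norm _) _; rewrite normrM.
have -> : `|s| = 1 by exact: norm_of_sqr1.
by rewrite mul1r.
Qed.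

(** The test needs the defect to be O(n^(2 - beta1)). A defect of order n^(beta1 - 1) allows this up
    to beta1 = 3/2, one of order n^(beta1 - 2) up to beta1 = 2. *)
Lemma levinson_limit_point : 0 <= beta1 -> beta1 <= 3 / 2 \/ (beta1 <= 2 /\ beta1 = sigma) ->
  ~ limit_circle a b.
Proof.
move=> be0 be; apply: limit_point_of_pols.
have [cb [Cb [_ Cb0 Hb]]] := diagonal_bounds.
have be2 : beta1 <= 2 by case: be => [|[]]; lra.
have [C C0 H] : exists2 C, 0 <= C &
    forall n, (1 <= n)%N -> defect s a b n <= C * n%:R `^ (2 - beta1).
  case: be => [be|[be bs]].
    have [C C0 H] := defect_bound1 be0; exists C => // n n0.
    apply: le_trans (ler_norm _) _; apply: le_trans (H n n0) _.
    by rewrite ler_wpM2l// natr_pow_le//; lra.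
  have [C C0 H] := defect_bound2 be0 bs; exists C => // n n0.
  apply: le_trans (ler_norm _) _; apply: le_trans (H n n0) _.
  by rewrite ler_wpM2l// natr_pow_le//; lra.
apply: (levinson b_gt0 s2 be2 (ltW Cb0) C0 (ltn0Sn 0) _ H) => n n0.
by have /andP[] := Hb n n0.
Qed.

Lemma doubly_limit_point : 2 < beta1 -> beta1 = sigma -> 3 / 2 + eta <= beta1 -> ~ limit_circle a b.
Proof.
move=> be2 bs be; apply: growing_limit_point.
have [r2 hr] := ratio_xp.
apply: (euler_nonsummable b_gt0 s2 delta_gt0 delta_le1 be2 hr (defect_xp_double bs)).
by move: be; set E := eta; lra.
Qed.

End CriticalRatio.

End Asymptotics.

(** * Decay exponents and orders in the limit circle cases *)

Section Orders.
Variables (R : realType) (a b : nat -> R) (delta beta1 beta2 x0 x1 x2 y0 y1 y2 : R).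
Hypothesis b_gt0 : forall n, 0 < b n.
Hypothesis x0_gt0 : 0 < x0.
Hypothesis y0_neq0 : y0 != 0.
Hypothesis delta_gt0 : 0 < delta.
Hypothesis delta_le1 : delta <= 1.
Hypothesis b_pw : pw (2 + delta) beta1 b x0 x1 x2.
Hypothesis a_pw : pw (2 + delta) beta2 a y0 y1 y2.
Local Notation W := (nevanlinna a b).

Lemma decay_pols gam : decays a b gam -> exists2 Ch, 0 <= Ch & forall n, (0 < n)%N ->
  cmod (pol1 a b n 0) ^+ 2 + cmod (pol2 a b n 0) ^+ 2 <= Ch * n%:R `^ (- gam).
Proof.
move=> H; have h := OOD (H _ (recurrence_rpol1 a b_gt0)) (H _ (recurrence_rpol2 a b_gt0)).
have [C C0 {}H] := OO_all h; exists C => // n n0; apply: le_trans (H n n0).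
rewrite pol1_real pol2_real !cmod_real !real_normK ?num_real//; exact: ler_norm.
Qed.

Lemma decay_ell2 gam : 1 < gam -> decays a b gam ->
  ell2 (fun n => pol1 a b n 0) /\ ell2 (fun n => pol2 a b n 0).
Proof. by move=> g1 /decay_pols[Ch Ch0 H]; exact: pol_ell2 g1 Ch0 H. Qed.

Lemma decay_limit_circle gam : 1 < gam -> decays a b gam -> limit_circle a b.
Proof. by move=> g1 /(decay_ell2 g1) h; apply/limit_circleP. Qed.

Lemma decay_order_le (s gam D m kap tau : R) : s ^+ 2 = 1 -> 1 < beta1 -> beta2 <= beta1 ->
  1 < gam -> decays a b gam -> 0 <= D -> 0 < m -> m <= kap ->
  (forall r n, 1 <= r -> (upnat (r `^ m) <= n)%N -> (n < upnat (r `^ kap))%N ->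
    `|defect s a b n| <= D * (r + n%:R `^ (beta1 - 2))) ->
  m <= tau -> 1 / 2 + m * (1 - beta1 / 2) <= tau ->
  1 / 2 + kap * (1 - beta1 / 2) <= tau -> 1 + kap * (1 - gam) <= tau ->
  forall x, tau < x -> exists r0, forall z, r0 <= cmod z -> mxmod (W z) <= expR (cmod z `^ x).
Proof.
move=> s2 be1 be2 g1 dec D0 m0 mk reg h1 h2 h3 h4 x tx.
have [cb [Cb [cb0 Cb0 Hb]]] := diagonal_bounds b_gt0 x0_gt0 delta_gt0 delta_le1 b_pw.
have [Ca Ha] := diagonal_bound delta_gt0 a_pw be2.
have [Ch Ch0 Hpq] := decay_pols dec.
exact: (nevanlinna_order_le b_gt0 s2 be1 cb0 Cb0 Hb Ha g1 Ch0 Hpq D0 m0 mk reg h1 h2 h3 h4 tx).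
Qed.

Lemma decay_order_ge gam : 1 < beta1 -> 1 < gam -> decays a b gam ->
  forall x, 0 < x -> x < 1 / beta1 -> exists r0, forall r, r0 <= r ->
     exists2 z, cmod z = r & expR (r `^ x) <= mxmod (W z).
Proof.
move=> be1 g1 dec x x0' xb; have [p2 q2] := decay_ell2 g1 dec.
have [cb [Cb [cb0 Cb0 Hb]]] := diagonal_bounds b_gt0 x0_gt0 delta_gt0 delta_le1 b_pw.
by apply: (nevanlinna_order_ge b_gt0 be1 Cb0 _ p2 q2) => // n /Hb/andP[].
Qed.

Lemma small_order : small_diagonal beta1 beta2 x0 y0 -> 1 < beta1 ->
  limit_circle a b /\ growth_order W = (1 / beta1)%:E.
Proof.
move=> sm be1; have b0 : 0 < beta1 by lra.
have dec gam : 1 < gam -> gam < beta1 -> decays a b gam.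
  move=> g1 gb.
  apply: (small_decay b_gt0 x0_gt0 delta_gt0 delta_le1 b_pw a_pw sm) => //; lra.
have be2 : beta2 <= beta1 by case: sm => [|[]]; lra.
have g0 : 1 < (1 + beta1) / 2 by lra.
have g0b : (1 + beta1) / 2 < beta1 by lra.
split; first exact: (decay_limit_circle g0 (dec _ g0 g0b)).
apply: growth_orderE; first by rewrite divr_gt0.
- move=> x bx; have x0' : 0 < x by apply: le_lt_trans bx; rewrite divr_ge0// ltW.
  pose gam := (Num.max 1 x^-1 + beta1) / 2.
  have xb : x^-1 < beta1 by rewrite invf_plt ?posrE// -div1r.
  have mb : Num.max 1 x^-1 < beta1 by rewrite gt_max be1.
  have m1 : 1 <= Num.max 1 x^-1 by rewrite le_max lexx.
  have mx : x^-1 <= Num.max 1 x^-1 by rewrite le_max lexx orbT.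
  have g1 : 1 < gam by rewrite /gam; lra.
  have gb : gam < beta1 by rewrite /gam; lra.
  have gx : x^-1 < gam by rewrite /gam; lra.
  have gp : 0 < gam by lra.
  have ig : 0 < gam^-1 by rewrite invr_gt0.
  have igE : gam^-1 * gam = 1 by rewrite mulVf// gt_eqF.
  have ib : 1 <= gam^-1 * beta1 by rewrite mulrC ler_pdivlMr// mul1r ltW.
  (* With m = kap = 1/gam the energy region is empty, and the tail exponent 1 + (1 - gam)/gam is
     1/gam as well; gam lies between 1/x and beta1. *)
  apply: (@decay_order_le 1 gam 0 gam^-1 gam^-1 gam^-1) => //.
  + by rewrite expr1n.
  + exact: dec.
  + by move=> r n _ h1 h2; have := leq_ltn_trans h1 h2; rewrite ltnn.
  + by move: ib; lra.
  + by move: ib; lra.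
  + by move: igE; lra.
  + by rewrite invf_plt ?posrE.
- exact: (decay_order_ge be1 g0 (dec _ g0 g0b)).
Qed.

Section CriticalOrders.
Variable s : R.
Hypothesis s2 : s ^+ 2 = 1.
Hypothesis sy : s * y0 = 2 * x0.
Hypothesis beta_eq : beta1 = beta2.
Local Notation sigma := (2 * x1 / x0 - 2 * y1 / y0).
Local Notation eta := (2 * (2 * x2 / x0 - 2 * y2 / y0 + y1 / y0
                  - 2 * x1 * y1 / (x0 * y0) + 2 * y1 ^+ 2 / y0 ^+ 2)).

Let beta_le : beta2 <= beta1. Proof. by rewrite beta_eq. Qed.

Lemma doubly_order : 2 < beta1 -> beta1 = sigma -> beta1 < 3 / 2 + eta ->
  limit_circle a b /\ growth_order W = (1 / beta1)%:E.
Proof.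
move=> be2 bs be.
have [gam g1 dec] := doubly_decay b_gt0 x0_gt0 y0_neq0 delta_gt0 delta_le1 b_pw a_pw s2 sy beta_eq be2 bs be.
split; first exact: decay_limit_circle g1 dec.
have be1 : 1 < beta1 by lra.
have b0 : 0 < beta1 by lra.
have ib : 0 < 1 / beta1 by rewrite divr_gt0.
apply: (growth_orderE ib); last exact: (decay_order_ge be1 g1 dec).
have [C C0 HC] := defect_bound2 b_gt0 x0_gt0 y0_neq0 delta_gt0 delta_le1 b_pw a_pw sy beta_eq (ltW b0) bs.
(* A gam barely above 1 suffices: as beta1 > 2 the energy exponent decreases in kap, so kap may be
   so large that the tail is bounded. *)
pose kap := Num.max (gam - 1)^-1 (1 / beta1).
have g10 : 0 < gam - 1 by lra.
have k1 : (gam - 1)^-1 <= kap by rewrite le_max lexx.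
have k2 : 1 / beta1 <= kap by rewrite le_max lexx orbT.
have ibE : 1 / beta1 * beta1 = 1 by rewrite mulfVK// gt_eqF.
move=> x bx; apply: (@decay_order_le s gam C (1 / beta1) kap (1 / beta1)) => //.
- move=> r n r1 rn _; have n0 : (0 < n)%N by exact: leq_trans rn.
  apply: le_trans (HC n n0) _; rewrite ler_wpM2l// lerDr; lra.
- by move: ibE; lra.
- have h := ler_wnM2r (_ : 1 - beta1 / 2 <= 0) k2.
  have {}h : kap * (1 - beta1 / 2) <= 1 / beta1 * (1 - beta1 / 2) by apply: h; lra.
  by move: ibE h; lra.
- have h : 1 <= kap * (gam - 1) by rewrite -ler_pdivrMr// div1r.
  lra.
Qed.

Lemma simply_order : 3 / 2 < beta1 -> beta1 < sigma ->
  limit_circle a b /\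
  growth_order W = (if beta1 < 2 then 1 / (2 * (beta1 - 1)) else 1 / beta1)%:E.
Proof.
move=> be32 bs.
have be1 : 1 < beta1 by lra.
have b0 : 0 < beta1 by lra.
have b10 : 0 < beta1 - 1 by lra.
have dec gam : 1 < gam -> gam < beta1 - 1 / 2 -> decays a b gam.
  move=> g1 gb.
  apply: (simply_decay b_gt0 x0_gt0 y0_neq0 delta_gt0 delta_le1 b_pw a_pw s2 sy beta_eq bs) => //; lra.
pose g0 := (1 + (beta1 - 1 / 2)) / 2.
have g01 : 1 < g0 by rewrite /g0; lra.
have g0b : g0 < beta1 - 1 / 2 by rewrite /g0; lra.
split; first exact: decay_limit_circle g01 (dec _ g01 g0b).
have [C C0 HC] := defect_bound1 b_gt0 x0_gt0 y0_neq0 delta_gt0 delta_le1 b_pw a_pw sy beta_eq (ltW b0).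
set rho := if _ then _ else _.
have ib : 0 < 1 / beta1 by rewrite divr_gt0.
have ibE : 1 / beta1 * beta1 = 1 by rewrite mulfVK// gt_eqF.
(* At r^kap the defect bound n^(beta1 - 1) reaches r. The energy exponent there is kap/2, and so is
   the tail exponent for gam = beta1 - 1/2. *)
pose kap := (beta1 - 1)^-1; have kap0 : 0 < kap by rewrite invr_gt0.
have kE : kap * (beta1 - 1) = 1 by rewrite mulVf// gt_eqF.
have hE : 1 / (2 * (beta1 - 1)) = kap / 2 by rewrite /kap; field; rewrite gt_eqF.
have [rb rk] : 1 / beta1 <= rho /\ kap / 2 <= rho.
  rewrite /rho hE; have [h|h] := ltP beta1 2; split=> //.
    rewrite -hE ler_pdivrMr// mulrAC mul1r ler_pdivlMr ?mulr_gt0//; lra.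
  rewrite -hE ler_pdivrMr ?mulr_gt0// mulrAC mul1r ler_pdivlMr//; lra.
have rho0 : 0 < rho by exact: lt_le_trans rb.
have ikap : 1 / beta1 <= kap.
  by rewrite /kap div1r lef_pV2 ?posrE// lerBlDr lerDl.
apply: growth_orderE => //.
(* The loss h in gam raises the tail exponent to kap/2 + kap h, which must stay below the midpoint
   of rho and x; the other bound on h keeps gam above 1. *)
- move=> x rx; pose h := Num.min ((beta1 - 3 / 2) / 2) ((beta1 - 1) * ((x - rho) / 2)).
  have xr : 0 < x - rho by rewrite subr_gt0.
  have h0 : 0 < h by rewrite lt_min !(divr_gt0, mulr_gt0)// subr_gt0.
  have hb : h <= (beta1 - 3 / 2) / 2 by rewrite ge_min lexx.
  have hx : kap * h <= (x - rho) / 2.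
    by rewrite /kap mulrC ler_pdivrMr// mulrC ge_min lexx orbT.
  have g1 : 1 < beta1 - 1 / 2 - h by lra.
  have gb : beta1 - 1 / 2 - h < beta1 - 1 / 2 by lra.
  apply: (@decay_order_le s (beta1 - 1 / 2 - h) C (1 / beta1) kap ((x + rho) / 2)) => //.
  + exact: dec.
  + move=> r n r1 rn nk; have n0 : (0 < n)%N by exact: leq_trans rn.
    apply: le_trans (HC n n0) _; rewrite ler_wpM2l//.
    have nr : n%:R <= r `^ kap by apply: upnat_lt => //; exact: powR_ge0.
    apply: (@le_trans _ _ r); last by rewrite lerDl powR_ge0.
    apply: (@le_trans _ _ ((r `^ kap) `^ (beta1 - 1))).
      by rewrite ge0_ler_powR ?nnegrE ?powR_ge0// ltW.
    rewrite -powRrM kE powRr1//; lra.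
  + lra.
  + by move: ibE; lra.
  + by move: kE; lra.
  + by move: kE hx; lra.
  + lra.
- move=> x xp; rewrite /rho; have [be2|be2] := ltP beta1 2.
    move=> xr; have [p2 q2] := decay_ell2 g01 (dec _ g01 g0b).
    have [cb [Cb [cb0 Cb0 Hb]]] := diagonal_bounds b_gt0 x0_gt0 delta_gt0 delta_le1 b_pw.
    have Hb' n : (0 < n)%N -> b n <= Cb * n%:R `^ beta1 by move=> /Hb/andP[].
    have C10 : 0 < C + 1 by lra.
    apply: (critical_order_ge b_gt0 be1 Cb0 Hb' p2 q2 s2 be2 C10 _ xp xr) => n n0.
    apply: le_trans (ler_norm _) _; apply: le_trans (HC n n0) _.
    by rewrite ler_wpM2r ?powR_ge0// lerDl.
  exact: (decay_order_ge be1 g01 (dec _ g01 g0b)).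
Qed.

End CriticalOrders.
End Orders.

(** The exponent of the remainder is capped at 3, the order of the cubic terms that the calculus of
    expansions discards. *)
Lemma pw_of_bigO (R : realType) (f chi : nat -> R) (beta eps p0 p1 p2 : R) : 0 < eps ->
  (forall n, (1 <= n)%N -> f n = n%:R `^ beta * (p0 + p1 / n%:R + chi n)) ->
  (fun n => chi n - p2 / n%:R ^+ 2) =O_\oo (fun n : nat => (n%:R : R) `^ (- (2 + eps))) ->
  pw (2 + Num.min eps 1) beta f p0 p1 p2.
Proof.
move=> e0 fE /eqO_exP[k /= k0 [N _ HN]].
have h : OO (2 + eps) (fun n => chi n - p2 / n%:R ^+ 2).
  exists k; split; first exact: ltW.
  by exists N => n Nn; have := HN n Nn; rewrite /= (ger0_norm (powR_ge0 _ _)).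
have ee : 2 + Num.min eps 1 <= 2 + eps by rewrite lerD2l ge_min lexx.
apply: OO_ext (OO_le ee h) => n n0; rewrite fE//.
have nb : 0 < n%:R `^ beta :> R by exact: natr_pow_gt0.
have nn : 0 < n%:R :> R by rewrite ltr0n.
by field; rewrite !gt_eqF.
Qed.

Theorem theorem1p5 (R : realType) (a b : nat -> R)
    (beta1 beta2 x0 x1 x2 y0 y1 y2 epsilon : R) (chi mu : nat -> R)
    (b_gt0 : forall n, 0 < b n)
    (x0_gt0 : 0 < x0) (y0_neq0 : y0 != 0) (epsilon_gt0 : 0 < epsilon)
    (bE : forall n, (1 <= n)%N ->
      b n = n%:R `^ beta1 * (x0 + x1 / n%:R + chi n))
    (aE : forall n, (1 <= n)%N ->
      a n = n%:R `^ beta2 * (y0 + y1 / n%:R + mu n))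
    (chiO : (fun n => chi n - x2 / n%:R ^+ 2)
      =O_\oo (fun n : nat => (n%:R : R) `^ (- (2 + epsilon))))
    (muO : (fun n => mu n - y2 / n%:R ^+ 2)
      =O_\oo (fun n : nat => (n%:R : R) `^ (- (2 + epsilon)))) :
  let sigma := 2 * x1 / x0 - 2 * y1 / y0 in
  let eta := 2 * (2 * x2 / x0 - 2 * y2 / y0 + y1 / y0
                  - 2 * x1 * y1 / (x0 * y0) + 2 * y1 ^+ 2 / y0 ^+ 2) in
  let rho := growth_order (nevanlinna a b) in
  (limit_circle a b <->
    [\/ small_diagonal beta1 beta2 x0 y0 /\ 1 < beta1,
        simply_critical beta1 beta2 x0 y0 sigma /\
          (3 / 2 < beta1 /\ beta1 < sigma) |
        doubly_critical beta1 beta2 x0 y0 sigma /\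
          (2 < beta1 /\ beta1 < 3 / 2 + eta)]) /\
  (limit_circle a b ->
    (simply_critical beta1 beta2 x0 y0 sigma /\
       (3 / 2 < beta1 /\ beta1 < 2) ->
     rho = (1 / (2 * (beta1 - 1)))%:E) /\
    (~ (simply_critical beta1 beta2 x0 y0 sigma /\
          (3 / 2 < beta1 /\ beta1 < 2)) ->
     rho = (1 / beta1)%:E)).
Proof.
pose delta := Num.min epsilon 1.
have d0 : 0 < delta by rewrite lt_min epsilon_gt0 ltr01.
have d1 : delta <= 1 by rewrite ge_min lexx orbT.
have bp := pw_of_bigO epsilon_gt0 bE chiO; have ap := pw_of_bigO epsilon_gt0 aE muO.
rewrite -/delta in bp ap.
move=> sigma eta rho.
have [s s2 sy] : exists2 s : R, s ^+ 2 = 1 & s * y0 = `|y0|.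
  exists (Num.sg y0); first by rewrite sqr_sg y0_neq0.
  by rewrite [RHS]normrEsg.
have LP1 : beta1 <= 1 -> ~ limit_circle a b.
  exact: small_beta_limit_point b_gt0 x0_gt0 d0 d1 bp.
have cases : limit_circle a b ->
    [\/ small_diagonal beta1 beta2 x0 y0 /\ 1 < beta1,
        simply_critical beta1 beta2 x0 y0 sigma /\
          (3 / 2 < beta1 /\ beta1 < sigma) |
        doubly_critical beta1 beta2 x0 y0 sigma /\
          (2 < beta1 /\ beta1 < 3 / 2 + eta)].
  move=> LC; have be1 : 1 < beta1 by case: (ltP 1 beta1) => // /LP1.
  have NL : ~ (beta1 < beta2 \/ (beta1 = beta2 /\ 2 * x0 < `|y0|)).
    move=> h; apply: (growing_limit_point b_gt0 _ LC).
    exact: (large_growing b_gt0 x0_gt0 y0_neq0 d0 d1 bp ap h).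
  case: (ltgtP beta1 beta2) => [h|h|be]; first by case: NL; left.
    by apply: Or31; split=> //; left.
  case: (ltgtP `|y0| (2 * x0)) => [h|h|yx]; first by apply: Or31; split=> //; right.
    by case: NL; right.
  rewrite yx in sy; have b0 : 0 <= beta1 by lra.
  case: (ltgtP beta1 sigma) => [bs|bs|bs].
  - apply: Or32; split; first by split=> //; apply/eqP; rewrite lt_eqF.
    split=> //; case: (ltP (3 / 2) beta1) => // h.
    by case: (levinson_limit_point b_gt0 x0_gt0 y0_neq0 d0 d1 bp ap s2 sy be b0 _ LC); left.
  - by case: (critical_small_limit_point b_gt0 x0_gt0 y0_neq0 d0 d1 bp ap s2 sy be bs LC).
  - apply: Or33; split=> //; split.
      case: (ltP 2 beta1) => // h.
      by case: (levinson_limit_point b_gt0 x0_gt0 y0_neq0 d0 d1 bp ap s2 sy be b0 _ LC); right.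
    case: (ltP beta1 (3 / 2 + eta)) => // h; case: (ltP 2 beta1) => h2.
      by case: (doubly_limit_point b_gt0 x0_gt0 y0_neq0 d0 d1 bp ap s2 sy be h2 bs h LC).
    by case: (levinson_limit_point b_gt0 x0_gt0 y0_neq0 d0 d1 bp ap s2 sy be b0 _ LC); right.
have small : small_diagonal beta1 beta2 x0 y0 -> 1 < beta1 ->
    limit_circle a b /\ rho = (1 / beta1)%:E.
  exact: (small_order b_gt0 x0_gt0 d0 d1 bp ap).
have simply : simply_critical beta1 beta2 x0 y0 sigma -> 3 / 2 < beta1 -> beta1 < sigma ->
    limit_circle a b /\
    rho = (if beta1 < 2 then 1 / (2 * (beta1 - 1)) else 1 / beta1)%:E.
  move=> [be yx _]; rewrite yx in sy.
  exact: (simply_order b_gt0 x0_gt0 y0_neq0 d0 d1 bp ap s2 sy be).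
have doubly : doubly_critical beta1 beta2 x0 y0 sigma -> 2 < beta1 -> beta1 < 3 / 2 + eta ->
    limit_circle a b /\ rho = (1 / beta1)%:E.
  move=> [be yx bs] be2; rewrite yx in sy.
  exact: (doubly_order b_gt0 x0_gt0 y0_neq0 d0 d1 bp ap s2 sy be be2 bs).
split.
  split=> // -[[h1 h2]|[h1 [h2 h3]]|[h1 [h2 h3]]].
  - by have [] := small h1 h2.
  - by have [] := simply h1 h2 h3.
  - by have [] := doubly h1 h2 h3.
move=> LC; case: (cases LC) => [[h1 h2]|[h1 [h2 h3]]|[h1 [h2 h3]]].
- have [_ E] := small h1 h2; split=> // -[[be yx _] _]; move: h1.
  by rewrite /small_diagonal be yx ltxx => -[//|[_]]; rewrite ltxx.
- have [_ E] := simply h1 h2 h3; rewrite E; split=> [[_ [_ ->]] //|nc].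
  by case: ltP => // be2; case: nc.
- have [_ E] := doubly h1 h2 h3; split=> // -[[_ _ ns] _].
  by case: h1 => _ _ bs; case: ns.
Qed.
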